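(* For any finite-type $\mathbb Z$-algebra $R$, there exists a rank $3$ matroid $M$ whose realization space is (isomorphic to) an open subset $U\subset \mathbb A^N\times\operatorname{Spec} R$, for some $N$, such that $U$ projects surjectively onto $\operatorname{Spec} R$. Moreover, if $R$ has an elementary monic representation with $n$ free variables, $a$ additions, $m$ multiplications, $o$ increments, $e$ equalities, and $i$ inequalities, then $M$ can be taken to have $$3n+7a+7o+6m+5e+6i+6$$ elements, with $$N=3(n+a+o+m+e+i)+1.$$
   Context: A rank $3$ simple matroid $M$ consists of a finite set of elements and a collection of subsets, called flats (always meaning rank $2$ flats), such that any pair of (distinct) elements is contained in exactly one flat, and such that there are at least two flats; ''rank $3$ matroid'' means rank $3$ simple matroid. Realization space: if $M$ has $s$ elements, each flat of $M$ defines a closed determinantal condition in $(\mathbb P^2_{\mathbb Z})^s$ (the points indexed by the elements of the flat are collinear), and each triple of elements not contained in any flat defines an open condition (the three points are not collinear). The realization space of $M$ is the quotient by $\operatorname{PGL}_3$ (over $\mathbb Z$) of the scheme-theoretic intersection of these conditions; only the case when this action is free is considered, in which case the quotient is an affine scheme over $\operatorname{Spec}\mathbb Z$. Elementary monic representation: let $S_n=\mathbb Z[y_1,\dots,y_n]$. In $S_n[t]$ set $x_0=t$ and $x_j=y_j+t$ for $1\le j\le n$. For $n<j\le L$, suppose we have elements $x_j\in S_n[t]$ such that (1) each $x_j$ is defined as one of $x_j=x_k+x_l$, $x_j=x_kx_l$, or $x_j=x_k+1$, where $k,l<j$; (2) each $x_j$ is monic as a polynomial in $t$ with coefficients in $S_n$.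 The $x_j$ with $1\le j\le n$ are called free variables, and the three operations in (1) are called addition, multiplication and incrementing respectively. Suppose also we have finite sets $E$ (equalities) and $I$ (inequalities) of pairs $(j,k)$ such that $x_j-x_k\in S_n\subset S_n[t]$. Then the algebra $$S_n[(x_{j'}-x_{k'})^{-1}]_{(j',k')\in I}\,/\,\langle x_j-x_k\mid (j,k)\in E\rangle$$ is said to have an elementary monic representation consisting of this data: the integers $n$ and $L$, the expression of each $x_j$ for $n<j\le L$ as an addition, multiplication or increment, and the sets of equalities and inequalities. In the theorem, $a,m,o$ are the numbers of $x_j$, $n<j\le L$, defined by addition, multiplication and incrementing, and $e=|E|$, $i=|I|$. *)

(* Defs.v *)
From HB Require Import structures.
From mathcomp Require Import all_boot all_order all_algebra.
From mathcomp Require Import mpoly.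
From Stdlib Require Import FunctionalExtensionality ProofIrrelevance.

Set Implicit Arguments.
Unset Strict Implicit.
Unset Printing Implicit Defensive.

Import GRing.Theory.
Local Open Scope ring_scope.

(* Rings are [comPzRingType]s, so that the zero ring is allowed. *)

Variant is_unit (A : comPzRingType) (x : A) : Prop :=
  IsUnit (y : A) of x * y = 1.

Inductive ideal_gen (A : comPzRingType) (D : A -> Prop) : A -> Prop :=
| ideal_gen0 : ideal_gen D 0
| ideal_genMD (r d x : A) : D d -> ideal_gen D x -> ideal_gen D (r * d + x).

Inductive mul_closure (A : comPzRingType) (D : A -> Prop) : A -> Prop :=
| mul_closure1 : mul_closure D 1
| mul_closureM (d x : A) : D d -> mul_closure D x -> mul_closure D (d * x).

(* phi : A -> B exhibits B as A[d^-1 : d in D]. *)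
Definition is_localization (A B : comPzRingType) (D : A -> Prop)
    (phi : {rmorphism A -> B}) : Prop :=
  [/\ forall d, D d -> is_unit (phi d),
      forall b, exists a s, mul_closure D s /\ b * phi s = phi a
    & forall a a', phi a = phi a' ->
        exists2 s, mul_closure D s & s * a = s * a'].

(* phi : A -> B exhibits B as A / <D>. *)
Definition is_quotient_ring (A B : comPzRingType) (D : A -> Prop)
    (phi : {rmorphism A -> B}) : Prop :=
  (forall b, exists a, phi a = b) /\
  (forall a, phi a = 0 <-> ideal_gen D a).

Definition finite_type (R : comPzRingType) : Prop :=
  exists (k : nat) (phi : {rmorphism {mpoly int[k]} -> R}),
    forall r, exists p, phi p = r.

Lemma rmorph_ext (A B : comPzRingType) (f g : {rmorphism A -> B}) :
  f =1 g -> f = g.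
Proof.
case: f g => f cf [g cg] /= /functional_extensionality efg; rewrite efg in cf *.
by congr GRing.RMorphism.Pack; case: cf cg => [[a] [b]] [[a'] [b']];
   rewrite (proof_irrelevance _ a a') (proof_irrelevance _ b b').
Qed.

(* Schemes over Spec Z are handled through their functors of points.  A        *)
(* [zfunctor] is a functor from commutative rings to sets.                     *)

Record zfunctor := ZFunctor {
  pts :> comPzRingType -> Type;
  fmap : forall A B : comPzRingType, {rmorphism A -> B} -> pts A -> pts B;
  fmap_id : forall (A : comPzRingType) (f : {rmorphism A -> A}) (x : pts A),
    f =1 id -> fmap f x = x;
  fmap_comp : forall (A B C : comPzRingType) (f : {rmorphism A -> B})
    (g : {rmorphism B -> C}) (h : {rmorphism A -> C}) (x : pts A),
    h =1 g \o f -> fmap h x = fmap g (fmap f x) }.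

Arguments fmap {z A B} f x.

Record morphism (X Y : zfunctor) := Morphism {
  mor :> forall A : comPzRingType, X A -> Y A;
  morE : forall (A B : comPzRingType) (f : {rmorphism A -> B}) (x : X A),
    mor (fmap f x) = fmap f (mor x) }.

Definition Spec (R : comPzRingType) : zfunctor.
Proof.
refine (@ZFunctor (fun A => {rmorphism R -> A})
  (fun A B f x => (f \o x : {rmorphism R -> B})) _ _).
- by move=> A f x f1; apply: rmorph_ext => r /=; rewrite f1.
- by move=> A B C f g h x hE; apply: rmorph_ext => r /=; rewrite hE.
Defined.

Definition affine_space (N : nat) : zfunctor.
Proof.
refine (@ZFunctor (fun A => 'rV[A]_N) (fun A B f x => map_mx f x) _ _).
- by move=> A f x f1; apply: map_mx_id.
- by move=> A B C f g h x hE; apply/matrixP=> i j; rewrite !mxE hE.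
Defined.

Definition prod_functor (X Y : zfunctor) : zfunctor.
Proof.
refine (@ZFunctor (fun A => (X A * Y A)%type)
  (fun A B f z => (fmap f z.1, fmap f z.2)) _ _).
- by move=> A f [x y] f1 /=; rewrite !fmap_id.
- by move=> A B C f g h [x y] hE /=; rewrite !(fmap_comp _ hE).
Defined.

Definition snd_mor (X Y : zfunctor) : morphism (prod_functor X Y) Y.
Proof. by exists (fun A (z : prod_functor X Y A) => z.2). Defined.

Definition comp_mor (X Y Z : zfunctor) (g : morphism Y Z) (f : morphism X Y) :
  morphism X Z.
Proof.
by exists (fun A x => g A (f A x)) => A B phi x; rewrite !morE.
Defined.

Record subfunctor (X : zfunctor) := Subfunctor {
  in_sub :> forall A : comPzRingType, X A -> Prop;
  in_sub_fmap : forall (A B : comPzRingType) (f : {rmorphism A -> B}) (x : X A),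
    in_sub x -> in_sub (fmap f x) }.

Definition sub_functor (X : zfunctor) (U : subfunctor X) : zfunctor.
Proof.
refine (@ZFunctor (fun A => {x : X A | U A x})
  (fun A B f x => exist _ (fmap f (sval x)) (in_sub_fmap f (svalP x))) _ _).
- by move=> A f x f1; apply: eq_sig_hprop => /= [y|];
    [exact: proof_irrelevance | rewrite fmap_id].
- by move=> A B C f g h x hE; apply: eq_sig_hprop => /= [y|];
    [exact: proof_irrelevance | rewrite (fmap_comp _ hE)].
Defined.

Definition incl_mor (X : zfunctor) (U : subfunctor X) :
  morphism (sub_functor U) X.
Proof. by exists (fun A (x : sub_functor U A) => sval x). Defined.

(* Open subschemes: the pullback of U along any Spec A -> X is the complement  *)
(* D(J) of the closed subscheme cut out by some ideal J = <J> of A, that is,   *)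
(* phi : A -> B factors through D(J) iff phi(J) generates the unit ideal of B. *)
Definition is_open (X : zfunctor) (U : subfunctor X) : Prop :=
  forall (A : comPzRingType) (x : X A), exists J : A -> Prop,
  forall (B : comPzRingType) (phi : {rmorphism A -> B}),
    U B (fmap phi x) <-> ideal_gen (fun b => exists2 a, J a & b = phi a) 1.

(* Surjectivity on the underlying topological spaces: a point of |Y| is a      *)
(* class of field-valued points, two being identified when they agree over a   *)
(* common extension field.                                                     *)
Definition surjective_mor (X Y : zfunctor) (f : morphism X Y) : Prop :=
  forall (K : fieldType) (y : Y K),
  exists (K' : fieldType) (iota : {rmorphism K -> K'}) (x : X K'),
    f K' x = fmap iota y.

(* P holds on some cover of Spec A by basic open sets Spec A[d^-1]. *)
Definition zariski_locally (A : comPzRingType)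
    (P : forall B : comPzRingType, {rmorphism A -> B} -> Prop) : Prop :=
  exists D : A -> Prop, ideal_gen D 1 /\
  forall d, D d -> exists (B : comPzRingType) (phi : {rmorphism A -> B}),
    is_localization (eq d) phi /\ P B phi.

(* pi : X -> Y exhibits Y as the Zariski sheaf quotient of X by a group action *)
(* with the given orbit relation (when Y is itself a sheaf, e.g. a scheme).    *)
Definition is_sheaf_quotient (X Y : zfunctor)
    (same_orbit : forall A : comPzRingType, X A -> X A -> Prop)
    (pi : morphism X Y) : Prop :=
  (forall (A : comPzRingType) (x x' : X A), pi A x = pi A x' <->
     zariski_locally (fun B phi => same_orbit B (fmap phi x) (fmap phi x'))) /\
  (forall (A : comPzRingType) (y : Y A),
     zariski_locally (fun B phi => exists x : X B, pi B x = fmap phi y)).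

(* Flats always mean rank 2 flats; those of a simple matroid contain at least  *)
(* two elements.                                                               *)
Record rank3_matroid (T : finType) := Rank3Matroid {
  flats : {set {set T}};
  flat_card : forall F, F \in flats -> (2 <= #|F|)%N;
  flat_pair : forall x y : T, x != y ->
    exists! F : {set T}, [/\ F \in flats, x \in F & y \in F];
  flats_ge2 : (2 <= #|flats|)%N }.

(* The points are given by homogeneous coordinates: row i of V is a unimodular *)
(* vector representing the point of P^2 indexed by i.                          *)
Definition bracket (s : nat) (A : comPzRingType) (V : 'M[A]_(s, 3)) (p q r : 'I_s) : A :=
  \det (rowsub (tnth [tuple p; q; r]) V).

Definition is_realization (s : nat) (M : rank3_matroid 'I_s)
    (A : comPzRingType) (V : 'M[A]_(s, 3)) : Prop :=
  [/\ forall i, exists w : 'cV[A]_3, row i V *m w = 1%:M,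
      forall F, F \in flats M -> forall p q r,
        p \in F -> q \in F -> r \in F -> bracket V p q r = 0
    & forall p q r,
        (forall F, F \in flats M -> ~~ [&& p \in F, q \in F & r \in F]) ->
        is_unit (bracket V p q r)].

Lemma bracket_map (s : nat) (A B : comPzRingType) (f : {rmorphism A -> B})
    (V : 'M[A]_(s, 3)) p q r :
  bracket (map_mx f V) p q r = f (bracket V p q r).
Proof.
rewrite /bracket -det_map_mx; congr (\det _).
by apply/matrixP=> i j; rewrite !mxE.
Qed.

Lemma is_realization_map (s : nat) (M : rank3_matroid 'I_s)
    (A B : comPzRingType) (f : {rmorphism A -> B}) (V : 'M[A]_(s, 3)) :
  is_realization M V -> is_realization M (map_mx f V).
Proof.
case=> uV colV ncolV; split=> [i|F MF p q r Fp Fq Fr|p q r npqr].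
- have [w w1] := uV i; exists (map_mx f w).
  by rewrite -map_row -map_mxM w1 map_scalar_mx rmorph1.
- by rewrite bracket_map (colV F) ?rmorph0.
- have [y y1] := ncolV p q r npqr.
  by exists (f y); rewrite bracket_map -rmorphM y1 rmorph1.
Qed.

(* The preimage of the realization locus in (P^2)^s under the (G_m)^s-torsor   *)
(* (A^3 - 0)^s -> (P^2)^s.                                                     *)
Definition realizations (s : nat) (M : rank3_matroid 'I_s) : zfunctor.
Proof.
refine (@ZFunctor (fun A => {V : 'M[A]_(s, 3) | is_realization M V})
  (fun A B f V => exist _ (map_mx f (sval V)) (is_realization_map f (svalP V)))
  _ _).
- by move=> A f x f1; apply: eq_sig_hprop => /= [y|];
    [exact: proof_irrelevance | rewrite map_mx_id].
- move=> A B C f g h x hE; apply: eq_sig_hprop => /= [y|];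
    first exact: proof_irrelevance.
  by apply/matrixP=> i j; rewrite !mxE hE.
Defined.

(* GL_3 x (G_m)^s acts by coordinate changes and rescalings; the quotient of   *)
(* [realizations] by this group is the quotient by PGL_3 of the realization    *)
(* locus in (P^2)^s.                                                           *)
Definition same_orbit (s : nat) (M : rank3_matroid 'I_s)
    (A : comPzRingType) (V W : realizations M A) : Prop :=
  exists (g h : 'M[A]_3) (lambda : 'rV[A]_s),
    [/\ g *m h = 1%:M, h *m g = 1%:M, forall i, is_unit (lambda 0 i)
      & sval W = diag_mx lambda *m sval V *m g].

Definition acts_freely (s : nat) (M : rank3_matroid 'I_s) : Prop :=
  forall (A : comPzRingType) (V : realizations M A)
    (g h : 'M[A]_3) (lambda : 'rV[A]_s),
    g *m h = 1%:M -> h *m g = 1%:M -> (forall i, is_unit (lambda 0 i)) ->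
    sval V = diag_mx lambda *m sval V *m g -> exists c : A, g = c%:M.

Definition has_realization_space (s : nat) (M : rank3_matroid 'I_s)
    (Y : zfunctor) : Prop :=
  acts_freely M /\
  exists pi : morphism (realizations M) Y,
    is_sheaf_quotient (@same_orbit s M) pi.

Definition realizes_open_of (s : nat) (M : rank3_matroid 'I_s) (N : nat)
    (R : comPzRingType) : Prop :=
  exists U : subfunctor (prod_functor (affine_space N) (Spec R)),
    [/\ is_open U,
        surjective_mor (comp_mor (snd_mor _ _) (incl_mor U))
      & has_realization_space M (sub_functor U)].

Variant step := Add (k l : nat) | Mul (k l : nat) | Incr (k : nat).

Definition is_add (c : step) := if c is Add _ _ then true else false.
Definition is_mul (c : step) := if c is Mul _ _ then true else false.
Definition is_incr (c : step) := if c is Incr _ then true else false.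

(* [emr_steps] lists the operations defining x_j for n < j <= L, so that       *)
(* L = n + size emr_steps; [emr_var j] is only meaningful for j <= L.          *)
Record elementary_monic_data (n : nat) := ElementaryMonicData {
  emr_steps : seq step;
  emr_var : nat -> {poly {mpoly int[n]}};
  emr_eqs : {set 'I_(n + size emr_steps).+1 * 'I_(n + size emr_steps).+1};
  emr_ineqs : {set 'I_(n + size emr_steps).+1 * 'I_(n + size emr_steps).+1};
  emr_var0 : emr_var 0%N = 'X;
  emr_var_free : forall i : 'I_n, emr_var i.+1 = ('X_i)%:P + 'X;
  emr_var_step : forall j, (n < j <= n + size emr_steps)%N ->
    match nth (Incr 0%N) emr_steps (j - n.+1) with
    | Add k l => [/\ (k < j)%N, (l < j)%N & emr_var j = emr_var k + emr_var l]
    | Mul k l => [/\ (k < j)%N, (l < j)%N & emr_var j = emr_var k * emr_var l]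
    | Incr k => (k < j)%N /\ emr_var j = emr_var k + 1
    end;
  emr_monic : forall j, (n < j <= n + size emr_steps)%N -> emr_var j \is monic;
  emr_constant : forall jk, jk \in emr_eqs :|: emr_ineqs ->
    exists c : {mpoly int[n]}, emr_var jk.1 - emr_var jk.2 = c%:P }.

(* The elements x_j - x_k of S_n, for (j, k) in P. *)
Definition emr_differences (n : nat) (D : elementary_monic_data n)
    (P : {set 'I_(n + size (emr_steps D)).+1 * 'I_(n + size (emr_steps D)).+1})
    (c : {mpoly int[n]}) : Prop :=
  exists2 jk, jk \in P & emr_var D jk.1 - emr_var D jk.2 = c%:P.

Definition has_elementary_monic_representation (n : nat)
    (D : elementary_monic_data n) (R : comPzRingType) : Prop :=
  exists (B : comPzRingType)
    (f : {rmorphism {mpoly int[n]} -> B}) (g : {rmorphism B -> R}),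
    is_localization (emr_differences (emr_ineqs D)) f /\
    is_quotient_ring
      (fun b => exists2 c, emr_differences (emr_eqs D) c & b = f c) g.

(* Main.v *)
(* Every x_j is represented by a point of its own line through a fixed point f   *)
(* of the plane, on which f, a zero point and a unit point form a frame; the     *)
(* operations, equalities and inequalities become incidence gadgets between      *)
(* these lines.  The x_j are monic in t, so over a field K(t), where K is the    *)
(* residue field of a point of R, two coordinates in a gadget coincide only if   *)
(* they do so identically: for a generic choice of the lines the collinear       *)
(* triples are exactly those which are collinear for all values of the           *)
(* parameters.  This configuration defines M.  Conversely, in a realization of   *)
(* M over A one normalizes a frame, and then intersects lines to recover,        *)
(* gadget after gadget, the position of all points from t, from the lines and    *)
(* from the y_j; the equalities and inequalities say that the y_j define a       *)
(* morphism R -> A.  These parameters are unique, so the quotient is the locus   *)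
(* of A^N x Spec R where the brackets of the non-collinear triples are units.    *)
(* If R = 0, a matroid is needed which has no realization over nonzero rings,    *)
(* and the non-Pappus matroid will do.  Finally R is finitely presented over Z   *)
(* by Hilbert's basis theorem, and adding a large power of t to intermediate     *)
(* results makes them monic, which gives an elementary monic representation.     *)

Require Import Defs.
From HB Require Import structures.
From mathcomp Require Import all_boot all_order all_algebra.
From mathcomp Require Import mpoly ring_quotient ring zify.
From mathcomp Require classical_sets boolp.
From Stdlib Require Import ClassicalEpsilon ProofIrrelevance.

Set Implicit Arguments.
Unset Strict Implicit.
Unset Printing Implicit Defensive.

Import GRing.Theory.
Local Open Scope ring_scope.

(** The construction is von Staudt's geometric arithmetic, arranged so that no incidence happens by
    accident. Let w_0 be a vector of the common point of all lines and w_g a vector of the zero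
    point of line g, scaled so that the unit point is w_g + w_0; the point of coordinate s is then
    w_g + s w_0. Since (w_g + s w_0) - (w_k + s w_0) = w_g - w_k, projection from the center w_g -
    w_k copies coordinates from line k to line g. In the same way the center w_g - x_k w_l
    multiplies by x_k, and w_g - w_l + x_k w_0 adds x_k. A gate consists of such centers and of the
    points needed to construct them; an equality or inequality gadget compares two values on a line
    of its own.

    A triple is called [collinear] if its bracket vanishes for all vectors w_g and all values that
    satisfy the equalities. The core is [dichotomy]: at every field-valued point of R, with t
    transcendental, three elements are either collinear in this sense or linearly independent as
    forms in the w_g. If only one of them lies on the latest line g, the coefficient of w_g decides.
    Two elements on line g differ by a combination of w_k, w_l and w_0, and in a dependence the
    third element is a multiple of it: the common point, a point of line k or l, or a center between
    these lines. Its coordinates come from a short list of monic polynomials in t, and comparing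
    degrees shows that a coincidence is an identity. This is checked for each kind of gate and
    collected in [gate_goodP].

    Hence a generic choice of lines over K(t) has exactly the prescribed collinearities
    ([generic_configuration]). One such choice defines the matroid M. Which triples are collinear
    does not depend on the point of R, so every field-valued point of R lifts to a realization,
    which gives surjectivity.

    Conversely, a realization of M over any ring is recovered from its frame: all its points are
    successive intersections of two lines ([meet_lines]), so [reconstruction] writes it in terms of
    t, the y_j and the vectors w_g, and shows that equalities and inequalities hold. The universal
    property of R turns the y_j into a point of R. By [rigidity] these parameters are unique and
    stabilizers are scalar. Thus the orbits correspond to an open locus of A^N x Spec R
    ([realizes_open]).

    The degree argument needs a field-valued point, so R = 0 is treated apart by the non-Pappus
    matroid ([unrealizable_matroid]). A representation of an arbitrary R of finite type comes from
    Hilbert's basis theorem and [differenceP]: every polynomial in the y_j is a difference of two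
    values computed by monic steps. *)

(** * Units in possibly zero rings *)

Section Units.
Variable A : comPzRingType.
Implicit Types x y z : A.

Lemma is_unit1 : is_unit (1 : A).
Proof. by exists 1; rewrite mulr1. Qed.

Lemma is_unitM x y : is_unit x -> is_unit y -> is_unit (x * y).
Proof. by case=> x' xx' [y' yy']; exists (x' * y'); rewrite mulrACA xx' yy' mulr1. Qed.

Lemma is_unitMl x y : is_unit (x * y) -> is_unit x.
Proof. by case=> z xyz; exists (y * z); rewrite mulrA. Qed.

Lemma is_unitMr x y : is_unit (x * y) -> is_unit y.
Proof. by rewrite mulrC; apply: is_unitMl. Qed.

Lemma is_unit_inv x y : x * y = 1 -> is_unit y.
Proof. by move=> xy; exists x; rewrite mulrC. Qed.

Lemma is_unit_cancel x y z : is_unit x -> x * y = x * z -> y = z.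
Proof.
by case=> x' xx' /(congr1 ( *%R x')); rewrite !mulrA ![x' * x]mulrC xx' !mul1r.
Qed.

Lemma is_unit_eq0 x y : is_unit x -> x * y = 0 -> y = 0.
Proof. by move=> ux xy; apply: (is_unit_cancel ux); rewrite xy mulr0. Qed.

End Units.

Lemma is_unit_rmorph (A B : comPzRingType) (f : {rmorphism A -> B}) x :
  is_unit x -> is_unit (f x).
Proof. by case=> y xy; exists (f y); rewrite -rmorphM xy rmorph1. Qed.

Lemma is_unit_field (K : fieldType) (x : K) : is_unit x <-> x != 0.
Proof.
split=> [[y xy]|x0]; last by exists x^-1; rewrite mulfV.
by apply: contra_eq_neq xy => ->; rewrite mul0r eq_sym oner_eq0.
Qed.

(** * Determinants of triples of vectors *)

Section Det3.
Variable A : comPzRingType.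
Implicit Types a b c d u v w p z : 'rV[A]_3.

Definition i0 : 'I_3 := ord0.
Definition i1 : 'I_3 := lift ord0 ord0.
Definition i2 : 'I_3 := ord_max.

Definition det3 u v w : A :=
  u 0 i0 * (v 0 i1 * w 0 i2 - v 0 i2 * w 0 i1)
  - u 0 i1 * (v 0 i0 * w 0 i2 - v 0 i2 * w 0 i0)
  + u 0 i2 * (v 0 i0 * w 0 i1 - v 0 i1 * w 0 i0).

Lemma eq_rV3 u v : u 0 i0 = v 0 i0 -> u 0 i1 = v 0 i1 -> u 0 i2 = v 0 i2 -> u = v.
Proof.
move=> e0 e1 e2; apply/rowP=> -[[|[|[|//]]] ltj].
- by rewrite (_ : Ordinal ltj = i0) //; apply: val_inj.
- by rewrite (_ : Ordinal ltj = i1) //; apply: val_inj.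
- by rewrite (_ : Ordinal ltj = i2) //; apply: val_inj.
Qed.

Lemma sum_I3 (F : 'I_3 -> A) : \sum_i F i = F i0 + F i1 + F i2.
Proof.
rewrite !big_ord_recr big_ord0 /= add0r.
by congr (F _ + F _ + F _); apply: val_inj.
Qed.

Lemma det_mx33 (M : 'M[A]_3) : \det M = det3 (row i0 M) (row i1 M) (row i2 M).
Proof.
have det22 (N : 'M[A]_2) : \det N = N 0 0 * N 1 1 - N 0 1 * N 1 0.
  rewrite (expand_det_row _ 0) !big_ord_recl big_ord0 addr0 /cofactor !det_mx11 !mxE /=.
  rewrite expr0 expr1 mul1r mulN1r mulrN.
  by congr (_ * N _ _ - N _ _ * N _ _); apply: val_inj.
rewrite (expand_det_row _ i0) sum_I3 /cofactor !det22 /det3 !mxE /=.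
have l00 : lift i0 (0 : 'I_2) = i1 by apply: val_inj.
have l01 : lift i0 (1 : 'I_2) = i2 by apply: val_inj.
have l10 : lift i1 (0 : 'I_2) = i0 by apply: val_inj.
have l11 : lift i1 (1 : 'I_2) = i2 by apply: val_inj.
have l20 : lift i2 (0 : 'I_2) = i0 by apply: val_inj.
have l21 : lift i2 (1 : 'I_2) = i1 by apply: val_inj.
rewrite l00 l01 l10 l11 l20 l21; ring.
Qed.

Lemma bracketE s (V : 'M[A]_(s, 3)) (p q r : 'I_s) :
  bracket V p q r = det3 (row p V) (row q V) (row r V).
Proof.
rewrite /bracket det_mx33; congr (det3 _ _ _); apply/rowP=> j; rewrite !mxE;
  by congr (V _ _).
Qed.

Lemma det3_mulmx u v w (M : 'M[A]_3) :
  det3 (u *m M) (v *m M) (w *m M) = det3 u v w * \det M.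
Proof. rewrite det_mx33 /det3 !mxE !sum_I3; ring. Qed.

Ltac det3_ring := rewrite /det3 ?mxE; ring.

Lemma det3ZZZ (x y z : A) u v w :
  det3 (x *: u) (y *: v) (z *: w) = x * y * z * det3 u v w.
Proof. det3_ring. Qed.

Lemma det3_rot u v w : det3 u v w = det3 v w u. Proof. det3_ring. Qed.

Lemma det3_swap u v w : det3 u v w = - det3 v u w. Proof. det3_ring. Qed.

Lemma det3_xx u v : det3 u u v = 0. Proof. det3_ring. Qed.

Lemma det3_cramer u v w p :
  det3 u v w *: p = det3 p v w *: u + det3 u p w *: v + det3 u v p *: w.
Proof. by apply: eq_rV3; det3_ring. Qed.

Lemma det3_dual u v w : exists q : 'cV[A]_3, u *m q = (det3 u v w)%:M.
Proof.
exists (\col_j (if j == i0 then v 0 i1 * w 0 i2 - v 0 i2 * w 0 i1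
   else if j == i1 then v 0 i2 * w 0 i0 - v 0 i0 * w 0 i2
   else v 0 i0 * w 0 i1 - v 0 i1 * w 0 i0)).
apply/matrixP=> i j; rewrite !ord1 !mxE sum_I3 !mxE /= /det3; ring.
Qed.

Lemma unimodular_of_det3 u v w :
  is_unit (det3 u v w) -> exists q : 'cV[A]_3, u *m q = 1%:M.
Proof.
case=> y uy; have [q uq] := det3_dual u v w.
by exists (y *: q); rewrite -scalemxAr uq scale_scalar_mx mulrC uy.
Qed.

Lemma unimodular_scale (x : A) u (q : 'cV[A]_3) : (x *: u) *m q = 1%:M -> is_unit x.
Proof.
move=> /matrixP /(_ 0 0); rewrite -scalemxAl !mxE /= mulr1n => xq.
by exists ((u *m q) 0 0); rewrite mxE.
Qed.

(** Two lines over a ring meet in only one point if a point [b] of the first lies nowhere on the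
    second. Cramer's rule writes [p] in terms of [a] and [b], incidence with [c] and [d] fixes the
    ratio, and unimodularity makes the remaining factor a unit. *)
Lemma meet_lines (mu : A) a b c d z p :
  det3 (a + mu *: b) c d = 0 -> is_unit (det3 b c d) -> is_unit (det3 a b z) ->
  det3 p a b = 0 -> det3 p c d = 0 -> (exists q : 'cV_3, p *m q = 1%:M) ->
  exists2 la, is_unit la & p = la *: (a + mu *: b).
Proof.
move=> wcd ubcd [y abz] pab pcd [q pq].
have pE : p = (y * det3 p b z) *: a + (y * det3 a p z) *: b.
  rewrite -!scalerA -scalerDr -[LHS]scale1r -abz [_ * y]mulrC -scalerA; congr (_ *: _).
  rewrite det3_cramer [X in _ + X *: _ = _]det3_rot [det3 b p a]det3_rot pab.
  by rewrite scale0r addr0.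
move: (y * _) (y * _) pE => be al pE.
have be_al : be = al * mu.
  apply: (is_unit_cancel ubcd).
  have e1 : al * det3 a c d + be * det3 b c d = 0 by rewrite -pcd pE; det3_ring.
  have : det3 b c d * (be - al * mu)
       = (al * det3 a c d + be * det3 b c d) - al * det3 (a + mu *: b) c d by det3_ring.
  rewrite e1 wcd mulr0 subrr mulrBr => /eqP; rewrite subr_eq0 => /eqP.
  exact.
rewrite be_al -scalerA -scalerDr in pE.
by exists al => //; apply: (@unimodular_scale _ (a + mu *: b) q); rewrite -pE.
Qed.

End Det3.

(** * Localizations, quotients and points over fields *)

Lemma mk_rmorph (A B : comPzRingType) (f : A -> B) :
  {morph f : x y / x + y} -> {morph f : x y / x * y} -> f 1 = 1 ->
  exists g : {rmorphism A -> B}, g =1 f.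
Proof.
move=> fD fM f1.
have f0 : f 0 = 0 by apply: (addIr (f 0)); rewrite -fD !add0r.
have fB : {morph f : x y / x - y}.
  move=> x y; apply: (addIr (f y)); rewrite -fD !subrK //.
pose fz := GRing.isZmodMorphism.Build _ _ f fB.
pose fm := GRing.isMonoidMorphism.Build _ _ f (conj f1 fM).
by exists (HB.pack_for {rmorphism A -> B} f fz fm).
Qed.

Lemma trivial_ring (A : comPzRingType) (x y : A) : (1 : A) = 0 -> x = y.
Proof. by move=> A0; rewrite -[x]mulr1 -[y]mulr1 A0 !mulr0. Qed.

Lemma rmorph_trivial (A B : comPzRingType) (f : {rmorphism A -> B}) :
  (1 : A) = 0 -> (1 : B) = 0.
Proof. by move=> A0; rewrite -(rmorph1 f) A0 rmorph0. Qed.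

Lemma trivial_rmorph (A B : comPzRingType) : (1 : B) = 0 ->
  exists g : {rmorphism A -> B}, True.
Proof.
move=> B0; have e (x y : B) : x = y by apply: trivial_ring.
have [| | |g _] := @mk_rmorph A B (fun=> 0); try by move=> *; apply: e.
by exists g.
Qed.

Lemma nzRing_of_pzRing (A : comPzRingType) : (1 : A) != 0 ->
  exists A' : comNzRingType, (A' : comPzRingType) = A.
Proof.
destruct A as [T []] => A1; set A := GRing.ComPzRing.Pack _ in A1.
pose nz := GRing.PzSemiRing_isNonZero.Build A A1.
pose A' : comNzRingType := HB.pack T nz A.
by exists A'.
Qed.

(** * Evaluation of polynomials over Z, with values in possibly zero rings *)

Section Evaluation.
Variable n : nat.
Notation S := {mpoly int[n]}.

(** Z[y] is generated as a ring by its variables. The closure properties are those under which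
    polynomials will be shown to be values of straight-line programs. *)
Lemma mpoly_int_ind (P : S -> Prop) :
  (forall p q, P p -> P q -> P (p - q)) -> (forall p q, P p -> P q -> P (p * q)) ->
  P 1 -> (forall i, P 'X_i) -> forall p, P p.
Proof.
move=> PB PM P1 PX p.
have P0 : P 0 by rewrite -(subrr 1); apply: PB.
have PN q : P q -> P (- q) by move=> Pq; rewrite -sub0r; apply: PB.
have PD q r : P q -> P r -> P (q + r) by move=> Pq Pr; rewrite -[r]opprK; apply/PB/PN.
have Pn k : P (k%:R) by elim: k => [|k IHk] //; rewrite -addn1 natrD; apply: PD.
have PZ (z : int) : P z%:~R.
  by case: z => k; [rewrite -pmulrn | rewrite NegzE mulrNz -pmulrn; apply: PN].
rewrite [p]mpolyE; apply: big_ind => // m _.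
rewrite -mul_mpolyC; apply: (PM).
  by rewrite -[p@_m]intz rmorph_int.
rewrite mpolyXE_id; apply: big_ind => [//||i _]; [exact: PM|].
by elim: (m i) => [|k IHk]; rewrite ?expr0 // exprS; apply/PM.
Qed.

Lemma mpoly_rmorph_ext (A : comPzRingType) (f g : {rmorphism S -> A}) :
  (forall i, f 'X_i = g 'X_i) -> f =1 g.
Proof.
move=> fg; apply: mpoly_int_ind => // [p q|p q|]; first by rewrite !rmorphB => -> ->.
  by rewrite !rmorphM => -> ->.
by rewrite !rmorph1.
Qed.

Lemma mpoly_rmorph_exists (A : comPzRingType) (y : 'I_n -> A) :
  exists f : {rmorphism S -> A}, forall i, f 'X_i = y i.
Proof.
have [A0|A1] := eqVneq (1 : A) 0.
  have [f _] := @trivial_rmorph S A A0.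
  by exists f => i; apply: trivial_ring.
have [A' e] := nzRing_of_pzRing A1; subst A.
have cint (z : int) (w : A') : GRing.comm (intmul 1 z) w by apply: mulrC.
have [|||f fE] := @mk_rmorph S A' (mmap (intmul (1 : A')) y).
- by move=> p q; rewrite mmapD.
- by move=> p q; rewrite rmorphM.
- by rewrite rmorph1.
by exists f => i; rewrite fE mmapX mmap1U.
Qed.

(** An explicit sum makes sense over the zero ring as well. *)
Definition evp (A : comPzRingType) (f : {rmorphism S -> A}) (t : A) (p : {poly S}) : A := \sum_(i < size p) f p`_i * t ^+ i.

Lemma evp_rmorph (A : comPzRingType) (f : {rmorphism S -> A}) (t : A) :
  exists g : {rmorphism {poly S} -> A}, g =1 evp f t.
Proof.
have [A0|A1] := eqVneq (1 : A) 0.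
  have [g _] := @trivial_rmorph {poly S} A A0.
  by exists g => i; apply: trivial_ring.
have [A' e] := nzRing_of_pzRing A1; subst A; rename f into f', t into t'.
have ct : commr_rmorph f' t' by move=> x; apply: mulrC.
have [|||g gE] := @mk_rmorph {poly S} A' (horner_morph ct).
- by move=> p q; rewrite rmorphD.
- by move=> p q; rewrite rmorphM.
- by rewrite rmorph1.
exists g => p; rewrite gE /horner_morph (horner_coef_wide t' (size_poly _ _)) /evp.
by apply: eq_bigr => i _; rewrite coef_map.
Qed.

Variables (A : comPzRingType) (f : {rmorphism S -> A}) (t : A).
Local Notation ev := (evp f t).

Lemma evpX : ev 'X = t.
Proof.
by rewrite /evp size_polyX !big_ord_recl big_ord0 !coefX rmorph0 rmorph1 mul0r add0r mul1r addr0.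
Qed.

Lemma evpC c : ev c%:P = f c.
Proof.
rewrite /evp size_polyC; case: eqP => [->|_]; first by rewrite big_ord0 rmorph0.
by rewrite big_ord_recl big_ord0 coefC mulr1 addr0.
Qed.

Lemma evpD p q : ev (p + q) = ev p + ev q.
Proof. by have [g gE] := evp_rmorph f t; rewrite -!gE rmorphD. Qed.

End Evaluation.

Lemma evp_map n (A B : comPzRingType) (f : {rmorphism {mpoly int[n]} -> A}) t
    (h : {rmorphism A -> B}) p :
  evp (h \o f) (h t) p = h (evp f t p).
Proof.
by rewrite rmorph_sum; apply: eq_bigr => i _; rewrite rmorphM rmorphXn.
Qed.

(** * Universal property of a quotient of a localization *)

Section UniversalProperty.
Variables (S B R : comPzRingType) (DI DE : S -> Prop).
Variables (f : {rmorphism S -> B}) (g : {rmorphism B -> R}).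
Hypothesis f_loc : is_localization DI f.
Hypothesis g_quo : is_quotient_ring (fun b => exists2 c, DE c & b = f c) g.

Lemma mul_closure_unit (A : comPzRingType) (D : S -> Prop) (phi : {rmorphism S -> A}) s :
  (forall d, D d -> is_unit (phi d)) -> mul_closure D s -> is_unit (phi s).
Proof.
move=> Du; elim=> [|d x Dd _ IHx]; first by rewrite rmorph1; apply: is_unit1.
by rewrite rmorphM; apply: is_unitM => //; apply: Du.
Qed.

Lemma quotient_rmorph_unit d : DI d -> is_unit (g (f d)).
Proof. by case: f_loc => + _ _ => /[apply]; apply: is_unit_rmorph. Qed.

Lemma quotient_rmorph_eq0 c : DE c -> g (f c) = 0.
Proof.
case: g_quo => _ gI Dc; apply/gI; rewrite -[f c]mul1r -[1 * _]addr0.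
by apply: ideal_genMD; [exists c | apply: ideal_gen0].
Qed.

Lemma quotient_rmorph_ext (A : comPzRingType) (p q : {rmorphism R -> A}) :
  (forall s, p (g (f s)) = q (g (f s))) -> p =1 q.
Proof.
case: f_loc g_quo => fu fs _ [gs _] pq r.
have [b <-] := gs r; have [a [s [Ds bs]]] := fs b.
have us : is_unit (q (g (f s))).
  by do 2 apply: is_unit_rmorph; apply: mul_closure_unit Ds.
by apply: (is_unit_cancel us); rewrite -{1}pq -!rmorphM mulrC bs pq.
Qed.

Lemma ideal_gen_eq0 (A A' : comPzRingType) (D : A -> Prop) (phi : {rmorphism A -> A'}) x :
  (forall d, D d -> phi d = 0) -> ideal_gen D x -> phi x = 0.
Proof.
move=> D0; elim=> [|r d y Dd _ IHy]; first by rewrite rmorph0.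
by rewrite rmorphD rmorphM IHy (D0 _ Dd) mulr0 addr0.
Qed.

Lemma localization_rmorph (A : comPzRingType) (phi : {rmorphism S -> A}) :
  (forall d, DI d -> is_unit (phi d)) ->
  exists h : {rmorphism B -> A}, forall s, h (f s) = phi s.
Proof.
move=> phiu; case: f_loc => fu fs fi.
(* [z] is the value phi(a)/phi(s) of a fraction a/s representing [b]. Its independence of the
   fraction is proved before a value is chosen. *)
pose Q b z := exists a s, [/\ mul_closure DI s, b * f s = f a & z * phi s = phi a].
have Qex b : exists z, Q b z.
  have [a [s [Ds bs]]] := fs b; have [z sz] := mul_closure_unit phiu Ds.
  by exists (phi a * z); exists a, s; split=> //; rewrite -mulrA [z * _]mulrC sz mulr1.
have Qun b z z' : Q b z -> Q b z' -> z = z'.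
  move=> [a [s [Ds bs zs]]] [a' [s' [Ds' bs' zs']]].
  have us := mul_closure_unit phiu Ds; have us' := mul_closure_unit phiu Ds'.
  have : f (a * s') = f (a' * s) by rewrite !rmorphM -bs -bs' mulrAC.
  case/fi => w Dw /(congr1 phi); rewrite !rmorphM => /(is_unit_cancel (mul_closure_unit phiu Dw)).
  rewrite -zs -zs' => E; apply: (is_unit_cancel (is_unitM us us')).
  by rewrite mulrAC [RHS]mulrC [z' * _]mulrA [_ * z]mulrC E mulrAC.
have mulD s s' : mul_closure DI s -> mul_closure DI s' -> mul_closure DI (s * s').
  elim=> [|d x Dd _ IHx] Ds'; first by rewrite mul1r.
  by rewrite -mulrA; apply: mul_closureM => //; apply: IHx.
have [h hQ] := boolp.choice Qex.
have hE b z : Q b z -> h b = z by apply: Qun.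
have [|||h' h'E] := @mk_rmorph B A h.
- move=> b b'; apply: hE; have [a [s [Ds bs zs]]] := hQ b.
  have [a' [s' [Ds' bs' zs']]] := hQ b'.
  exists (a * s' + a' * s), (s * s'); split; first exact: mulD.
    by rewrite !rmorphD !rmorphM -bs -bs'; ring.
  by rewrite !rmorphD !rmorphM -zs -zs'; ring.
- move=> b b'; apply: hE; have [a [s [Ds bs zs]]] := hQ b.
  have [a' [s' [Ds' bs' zs']]] := hQ b'.
  exists (a * a'), (s * s'); split; first exact: mulD.
    by rewrite !rmorphM -bs -bs'; ring.
  by rewrite !rmorphM -zs -zs'; ring.
- by apply: hE; exists 1, 1; split; [apply: mul_closure1 | rewrite !mul1r..].
exists h' => s; rewrite h'E; apply: hE; exists s, 1.
by split; [apply: mul_closure1 | rewrite rmorph1 mulr1..].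
Qed.

(** Together with [quotient_rmorph_ext], this identifies the points of R with the tuples of y_j that
    satisfy the equalities and inequalities. *)
Lemma quotient_rmorph_exists (A : comPzRingType) (phi : {rmorphism S -> A}) :
  (forall d, DI d -> is_unit (phi d)) -> (forall c, DE c -> phi c = 0) ->
  exists h : {rmorphism R -> A}, forall s, h (g (f s)) = phi s.
Proof.
move=> phiu phi0; have [h hf] := localization_rmorph phiu.
case: g_quo => gs gI.
have h0 b : g b = 0 -> h b = 0.
  by move/gI; apply: ideal_gen_eq0 => _ [c Dc ->]; rewrite hf phi0.
have hg b b' : g b = g b' -> h b = h b'.
  move=> gb; apply/eqP; rewrite -subr_eq0 -rmorphB h0 //.
  by rewrite rmorphB gb subrr.
have [sec secE] := boolp.choice gs.
have [|||k kE] := @mk_rmorph R A (h \o sec).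
- by move=> r r' /=; rewrite -rmorphD; apply: hg; rewrite rmorphD !secE.
- by move=> r r' /=; rewrite -rmorphM; apply: hg; rewrite rmorphM !secE.
- by rewrite /= -(rmorph1 h); apply: hg; rewrite secE rmorph1.
by exists k => s; rewrite kE /= -hf; apply: hg; rewrite secE.
Qed.

End UniversalProperty.

(** * Maximal ideals and residue fields *)

Section IdealGen.
Variable A : comPzRingType.
Implicit Types (D : A -> Prop) (x y z r : A).

Lemma ideal_genD D x y : ideal_gen D x -> ideal_gen D y -> ideal_gen D (x + y).
Proof.
elim=> [|r d z Dd _ IHz] Dy; first by rewrite add0r.
by rewrite -addrA; apply: ideal_genMD => //; apply: IHz.
Qed.

Lemma ideal_genM D r x : ideal_gen D x -> ideal_gen D (r * x).
Proof.
elim=> [|s d z Dd _ IHz]; first by rewrite mulr0; apply: ideal_gen0.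
by rewrite mulrDr mulrA; apply: ideal_genMD.
Qed.

Lemma mem_ideal_gen D x : D x -> ideal_gen D x.
Proof. by move=> Dx; rewrite -[x]mul1r -[1 * x]addr0; apply/ideal_genMD/ideal_gen0. Qed.

Lemma ideal_gen_sub D D' x :
  (forall d, D d -> ideal_gen D' d) -> ideal_gen D x -> ideal_gen D' x.
Proof.
move=> DD'; elim=> [|r d y Dd _ IHy]; first exact: ideal_gen0.
by apply: ideal_genD => //; apply/ideal_genM/DD'.
Qed.

End IdealGen.

(** Zorn's lemma is applied to arbitrary subsets that do not generate the unit ideal; a maximal one
    is automatically an ideal. *)
Lemma maximal_ideal (A : comNzRingType) :
  exists I : A -> Prop, [/\ I 0, forall x y, I x -> I y -> I (x + y),
    forall r x, I x -> I (r * x), ~ I 1 &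
    forall x, ~ I x -> exists y, I (x * y - 1)].
Proof.
have [F FP Ftot|I [nI1 Imax]] :=
    @classical_sets.Zorn_bigcup A (fun D : A -> Prop => ~ ideal_gen D 1).
  (* A linear combination involves finitely many elements, so along a chain it already lies in the
     ideal of a single member. *)
  have one (X : A -> Prop) : F X -> forall x,
      ideal_gen (classical_sets.bigcup F id) x -> exists2 Y, F Y & ideal_gen Y x.
    move=> FX x; elim=> [|r d y [Y FY Yd] _ [Z FZ Zy]]; first by exists X => //; apply: ideal_gen0.
    have [YZ|ZY] := Ftot _ _ FY FZ.
      exists Z => //; apply: ideal_genD => //; apply/ideal_genM/mem_ideal_gen.
      exact: YZ.
    exists Y => //; apply: ideal_genD; first by apply/ideal_genM/mem_ideal_gen.
    by apply: ideal_gen_sub Zy => d' /ZY; apply: mem_ideal_gen.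
  move=> F1; have [[X FX]|nF] := excluded_middle_informative (exists X, F X).
    by have [Y FY] := one X FX 1 F1; apply: FP.
  (* The empty chain: its union generates the zero ideal, which is proper because the ring is
     nonzero. *)
  have : ideal_gen (fun _ : A => False) 1.
    by apply: ideal_gen_sub F1 => d [Y FY]; case: nF; exists Y.
  have e x : ideal_gen (fun _ : A => False) x -> x = 0 by case.
  by move/e/eqP; rewrite oner_eq0.
have Icl x : ideal_gen I x -> I x.
  move=> Ix; have [//|nIx] := excluded_middle_informative (I x).
  case: (Imax (fun y => I y \/ y = x)).
    by split=> [y|Ix']; [left | apply: nIx; apply: Ix'; right].
  move=> I1; apply: nI1; apply: ideal_gen_sub I1 => d [|->] //; exact: mem_ideal_gen.
exists I; split.
- exact/Icl/ideal_gen0.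
- by move=> x y /mem_ideal_gen Ix /mem_ideal_gen Iy; apply/Icl/ideal_genD.
- by move=> r x /mem_ideal_gen Ix; apply/Icl/ideal_genM.
- by move/mem_ideal_gen.
move=> x nIx.
have [|e] := excluded_middle_informative (ideal_gen (fun y => I y \/ y = x) 1).
  have aux z : ideal_gen (fun y => I y \/ y = x) z -> exists y, I (z - x * y).
    elim=> [|r d w Dd _ [y Iy]].
      by exists 0; rewrite mulr0 subr0; apply/Icl/ideal_gen0.
    case: Dd => [Id|->].
      exists y; rewrite -addrA; apply: Icl; apply: ideal_genD; last exact: mem_ideal_gen.
      exact/ideal_genM/mem_ideal_gen.
    exists (r + y); suff -> : r * x + w - x * (r + y) = w - x * y by [].
    by ring.
  by case/aux => y Iy; exists y; rewrite -opprB -mulN1r; apply/Icl/ideal_genM/mem_ideal_gen.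
case: (Imax _ _ e); split=> [y|Ix']; [by left | apply: nIx; apply: Ix'; by right].
Qed.

Section ResidueField.
Local Open Scope quotient_scope.

Lemma field_point_nz (A : comNzRingType) : exists (K : fieldType) (f : {rmorphism A -> K}), True.
Proof.
have [I [I0 ID IM I1 Iinv]] := maximal_ideal A.
pose J : {pred A} := fun x => if excluded_middle_informative (I x) then true else false.
have JP x : reflect (I x) (x \in J).
  by rewrite /J unfold_in; case: excluded_middle_informative => ?; constructor.
have J1 : (1 : A) \notin J by apply/negP => /JP.
have JM r : {in J, forall u, r * u \in J} by move=> u /JP Iu; apply/JP/IM.
have J0 : 0 \in J by apply/JP.
have JB : {in J &, forall u v, u - v \in J}.
  by move=> u v /JP Iu /JP Iv; apply/JP/ID => //; rewrite -mulN1r; apply: IM.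
have Jid : idealr_closed J.
  by split=> // a u v /JP Iu /JP Iv; apply/JP/ID => //; apply: IM.
pose id : idealr A := HB.pack J (isIdealr.Build A J Jid).
pose Q := {ideal_quot id}.
have piE x : (\pi_Q x == 0) = (x \in J) by rewrite piE /= Quotient.equivE subr0.
have Qinv (x : Q) : x != 0 -> exists y, y * x = 1.
  rewrite -[x]reprK piE => /negP nJ; have [|y Iy] := Iinv (repr x).
    by move=> ?; apply/nJ/JP.
  exists (\pi_Q y); apply/eqP; rewrite -subr_eq0.
  by rewrite -(rmorph1 (\pi_Q)) -rmorphM -rmorphB piE mulrC; apply/JP.
pose inv x := if excluded_middle_informative (x != 0) is left x0
  then proj1_sig (constructive_indefinite_description _ (Qinv x x0)) else 0.
have mulVf x : x != 0 -> inv x * x = 1.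
  by rewrite /inv; case: excluded_middle_informative => // x0; case: constructive_indefinite_description.
have inv0 : inv 0 = 0 by rewrite /inv; case: excluded_middle_informative => // nz; case: (negP nz).
pose fm := GRing.ComNzRing_isField.Build Q mulVf inv0.
pose K : fieldType := HB.pack Q fm.
have [x y|x y||f _] := @mk_rmorph A K (\pi_Q).
- exact: (rmorphD (\pi_Q)).
- exact: (rmorphM (\pi_Q)).
- exact: (rmorph1 (\pi_Q)).
by exists K, f.
Qed.

End ResidueField.

Lemma field_point (A : comPzRingType) : (1 : A) <> 0 ->
  exists (K : fieldType) (f : {rmorphism A -> K}), True.
Proof. by move=> /eqP /nzRing_of_pzRing [A' <-]; apply: field_point_nz. Qed.

Ltac intail := rewrite !inE; repeat case/orP; move=> /eqP ->; rewrite /=.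

Ltac dest := repeat match goal with
  | H : is_true (_ && _) |- _ => move/andP in H
  | H : _ /\ _ |- _ => destruct H
  | H : [/\ _, _ & _] |- _ => destruct H
  | H : [/\ _, _, _ & _] |- _ => destruct H
  | H : [/\ _, _, _, _ & _] |- _ => destruct H
  | H : _ \/ _ |- _ => destruct H end.

(** * Symmetric relations checked on the pairs and triples of a list *)

Section Pairs.
Variables (T : Type) (P : T -> T -> Prop).

Fixpoint forall_after (a : T) (s : seq T) : Prop :=
  if s is b :: s' then P a b /\ forall_after a s' else True.

Fixpoint forall_pairs (s : seq T) : Prop :=
  if s is a :: s' then forall_after a s' /\ forall_pairs s' else True.

End Pairs.

Lemma forall_afterP (T : eqType) (P : T -> T -> Prop) a s :
  forall_after P a s -> forall b, b \in s -> P a b.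
Proof.
elim: s => //= b s IHs [Pab Ps] e; rewrite inE => /orP[/eqP -> //|]; exact: IHs.
Qed.

Lemma forall_pairsP (T : eqType) (P : T -> T -> Prop) s :
  (forall a b, P a b -> P b a) -> forall_pairs P s ->
  forall a b, a \in s -> b \in s -> a <> b -> P a b.
Proof.
move=> Psym; elim: s => //= e s IHs [Pe Ps] a b.
rewrite !inE => /orP[/eqP ->|sa] /orP[/eqP ->|sb] // ab.
- exact: forall_afterP sb.
- by apply: Psym; apply: forall_afterP sa.
- exact: IHs.
Qed.

Section Triples.
Variables (T : Type) (P : T -> T -> T -> Prop).

Fixpoint forall_triples (s : seq T) : Prop :=
  if s is a :: s' then forall_pairs (P a) s' /\ forall_triples s' else True.

End Triples.

Lemma forall_triplesP (T : eqType) (P : T -> T -> T -> Prop) s :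
  (forall a b e, P a b e -> P b a e) -> (forall a b e, P a b e -> P b e a) ->
  forall_triples P s ->
  forall a b e, a \in s -> b \in s -> e \in s -> a <> b -> a <> e -> b <> e -> P a b e.
Proof.
move=> Psw Pro; have Psw' a b e : P a b e -> P a e b by move=> /Pro /Psw /Pro /Pro.
elim: s => //= o s IHs [Po Ps] a b e.
rewrite !inE => /orP[/eqP ->|sa] /orP[/eqP ->|sb] /orP[/eqP ->|se] // ab ae be.
- by apply: forall_pairsP Po _ _ _ _ _ => //; apply: Psw'.
- by apply/Psw; apply: forall_pairsP Po _ _ _ _ _ => //; apply: Psw'.
- by apply/Pro; apply: forall_pairsP Po _ _ _ _ _ => //; apply: Psw'.
- exact: IHs.
Qed.

(** * Generic choices over an infinite field *)

Definition infinite_field (F : fieldType) :=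
  forall k, exists2 s : seq F, uniq s & size s = k.

Lemma nonroot (F : fieldType) (p : {poly F}) : infinite_field F -> p != 0 ->
  exists z, p.[z] != 0.
Proof.
move=> Finf p0; have [s us ss] := Finf (size p).
have [/allP ps|/allPn [z _ pz]] := boolP (all (root p) s); last by exists z.
by have := max_poly_roots p0 (introT allP ps) us; rewrite ss ltnn.
Qed.

(* By induction on the number of determinants: interpolate linearly between a  *)
(* choice which is good for all of them but one and one good for the last.     *)
Section GenericChoice.
Variables (F : fieldType) (I T : Type) (D : T -> (I -> 'rV[F]_3) -> F).
Hypothesis Finf : infinite_field F.
Hypothesis D_poly : forall t w w', exists p : {poly F}, forall z,
  D t (fun i => w i + z *: (w' i - w i)) = p.[z].
Hypothesis D_ext : forall t w w', w =1 w' -> D t w = D t w'.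

Lemma generic_choice (s : seq T) :
  (forall t, exists w, D t w != 0) -> exists w, forall t, List.In t s -> D t w != 0.
Proof.
move=> W; elim: s => [|t s [w ws]]; first by exists (fun=> 0).
have [w' wt] := W t.
(* [p] is the product of the polynomials of the determinants indexed by [s] along the segment; each
   is nonzero because its value at 0, that is at [w], is nonzero. *)
have [p pE] : exists p : {poly F}, p != 0 /\ forall z, p.[z] != 0 ->
    forall u, List.In u s -> D u (fun i => w i + z *: (w' i - w i)) != 0.
  elim: s ws => [|u s IHs] ws; first by exists 1; rewrite oner_neq0.
  have [|p [p0 pE]] := IHs; first by move=> v vs; apply: ws; right.
  have [q qE] := D_poly u w w'.
  have q0 : q != 0.
    apply: contraTneq (ws u (or_introl erefl)) => q0.
    rewrite negbK (@D_ext u w (fun i => w i + 0 *: (w' i - w i))); last first.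
      by move=> i; rewrite scale0r addr0.
    by rewrite qE q0 horner0.
  exists (p * q); split=> [|z]; first by rewrite mulf_neq0.
  rewrite hornerM mulf_eq0 negb_or => /andP[pz qz] v [<-|vs]; first by rewrite qE.
  exact: pE.
case: pE => p0 pE; have [q qE] := D_poly t w w'.
have q0 : q != 0.
  apply: contraTneq wt => q0; rewrite negbK.
  rewrite (@D_ext t w' (fun i => w i + 1 *: (w' i - w i))); last first.
    by move=> i; rewrite scale1r addrC subrK.
  by rewrite qE q0 horner0.
have [z] := nonroot Finf (mulf_neq0 p0 q0).
rewrite hornerM mulf_eq0 negb_or => /andP[pz qz].
exists (fun i => w i + z *: (w' i - w i)) => u [<-|us]; first by rewrite qE.
exact: pE us.
Qed.

End GenericChoice.

Lemma det3_poly (F : fieldType) (u u' v v' r r' : 'rV[F]_3) : exists p : {poly F},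
  forall z, det3 (u + z *: u') (v + z *: v') (r + z *: r') = p.[z].
Proof.
pose l (u u' : 'rV[F]_3) i : {poly F} := (u 0 i)%:P + 'X * (u' 0 i)%:P.
have lE (a b : 'rV[F]_3) i z : (l a b i).[z] = (a + z *: b) 0 i.
  by rewrite /l !mxE !(hornerD, hornerM) hornerX !hornerC.
pose D := fun i j k : 'I_3 => l u u' i * (l v v' j * l r r' k).
exists (D i0 i1 i2 - D i0 i2 i1 - (D i1 i0 i2 - D i1 i2 i0) + (D i2 i0 i1 - D i2 i1 i0)) => z.
rewrite /det3 !(hornerD, hornerN) /D !hornerM !lE.
by ring.
Qed.

Lemma combination_inj (A : comPzRingType) (p q z : 'rV[A]_3) (a b a' b' : A) :
  is_unit (det3 p q z) -> a *: p + b *: q = a' *: p + b' *: q -> a = a' /\ b = b'.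
Proof.
move=> U E; split.
  have F1 t t' : det3 (t *: p + t' *: q) q z = det3 p q z * t by rewrite /det3 !mxE; ring.
  by apply: (is_unit_cancel U); rewrite -(F1 a b) E F1.
have F2 t t' : det3 p (t *: p + t' *: q) z = det3 p q z * t' by rewrite /det3 !mxE; ring.
by apply: (is_unit_cancel U); rewrite -(F2 a b) E F2.
Qed.

(** * Matroids given by a collinearity relation or by points over a field *)

Section MatroidOfLines.
Variables (T : finType) (col : T -> T -> T -> bool).
Hypothesis col_l : forall p q, col p q p.
Hypothesis col_r : forall p q, col p q q.
Hypothesis col_eq : forall p q x y z, p != q -> x != y -> col p q x -> col p q y ->
  col p q z = col x y z.
Hypothesis col_proper : exists p q r, p != q /\ ~~ col p q r.

Let line (p q : T) : {set T} := [set r | col p q r].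
Let lines : {set {set T}} := [set line pq.1 pq.2 | pq in [pred pq : T * T | pq.1 != pq.2]].

Let linesP X : reflect (exists p q, p != q /\ X = line p q) (X \in lines).
Proof.
apply: (iffP imsetP) => [[[p q]]|[p [q [pq ->]]]]; last by exists (p, q).
by rewrite inE /= => pq ->; exists p, q.
Qed.

Lemma matroid_of_lines : exists M : rank3_matroid T, forall p q r,
  (exists2 X, X \in flats M & [&& p \in X, q \in X & r \in X]) <-> (p == q) || col p q r.
Proof.
have [a [b [e [ab D]]]] := col_proper.
have ae : a != e by apply: contraNneq D => <-.
have card X : X \in lines -> (2 <= #|X|)%N.
  move=> /linesP [p [q [pq ->]]].
  have : [set p; q] \subset line p q.
    by apply/subsetP => z; rewrite in_set2 inE => /orP[] /eqP ->.
  by move/subset_leq_card; rewrite cards2 pq.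
have pair x y : x != y -> exists! X : {set T}, [/\ X \in lines, x \in X & y \in X].
  move=> xy; exists (line x y); split; first by rewrite !inE; split=> //; apply/linesP; exists x, y.
  move=> _ [/linesP [p [q [pq ->]]]]; rewrite !inE => xp yp.
  by apply/setP => z; rewrite !inE (col_eq z pq xy).
have ge2 : (2 <= #|lines|)%N.
  have : [set line a b; line a e] \subset lines.
    by apply/subsetP => z; rewrite in_set2 => /orP[] /eqP ->; apply/linesP; [exists a, b | exists a, e].
  move/subset_leq_card; rewrite cards2; suff -> : line a b != line a e by [].
  by apply: contraNneq D => /setP /(_ e); rewrite !inE col_r.
exists (Rank3Matroid card pair ge2) => p q r /=; split.
  case=> _ /linesP [x [y [xy ->]]]; rewrite !inE => /and3P [px qx rx].
  by have [//|pq] := eqVneq p q; rewrite -(col_eq r xy pq).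
have [<-|pq] /= := eqVneq p q; last first.
  by move=> pqr; exists (line p q); rewrite ?inE ?col_l ?col_r //; apply/linesP; exists p, q.
have [<-|pr] := eqVneq p r; last first.
  by move=> _; exists (line p r); rewrite ?inE ?col_l ?col_r //; apply/linesP; exists p, r.
have [z pz] : exists z, p != z.
  by have [->|pa] := eqVneq p a; [exists b | exists a].
by move=> _; exists (line p z); rewrite ?inE ?col_l //; apply/linesP; exists p, z.
Qed.

End MatroidOfLines.

Section MatroidOfConfiguration.
Variables (T : finType) (F : fieldType) (V : T -> 'rV[F]_3).
Notation det p q r := (det3 (V p) (V q) (V r)).
Hypothesis V_pair : forall p q, p != q -> exists r, det p q r != 0.
Hypothesis V_triple : exists p q r, det p q r != 0.

(** All brackets det x y t are a fixed multiple of det p q t, and the factor is nonzero because x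
    and y are not proportional. *)
Lemma line_det p q x y r : p != q -> x != y -> det p q x = 0 -> det p q y = 0 ->
  (det p q r == 0) = (det x y r == 0).
Proof.
move=> pq xy px py; have [z z0] := V_pair pq; have [z' z0'] := V_pair xy.
have comb t : det p q t = 0 -> exists a b, V t = a *: V p + b *: V q.
  move=> t0; exists (det t q z / det p q z), (det p t z / det p q z).
  apply: (scalerI z0); rewrite det3_cramer t0 scale0r addr0 scalerDr !scalerA.
  by rewrite ![det p q z * _]mulrC !divfK.
have [a [b xE]] := comb x px; have [a' [b' yE]] := comb y py.
have D t : det x y t = (a * b' - a' * b) * det p q t.
  by rewrite xE yE /det3 !mxE; ring.
by move: z0'; rewrite !D !mulf_eq0 negb_or => /andP[/negPf -> _].
Qed.

Lemma matroid_of_configuration : exists M : rank3_matroid T, forall p q r,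
  (exists2 X, X \in flats M & [&& p \in X, q \in X & r \in X]) <-> det p q r = 0.
Proof.
have [||p q x y z pq xy /eqP px /eqP py||M MP] := @matroid_of_lines T (fun p q r => det p q r == 0).
- by move=> p q; rewrite det3_rot det3_rot det3_xx.
- by move=> p q; rewrite det3_rot det3_xx.
- exact: line_det.
- have [p [q [r D]]] := V_triple; exists p, q, r; split=> //.
  by apply: contraNneq D => ->; rewrite det3_xx.
exists M => p q r; rewrite MP; have [->|_] := eqVneq p q; last by split=> /eqP.
by rewrite det3_xx.
Qed.

End MatroidOfConfiguration.

(** * Basic open covers *)

Lemma ideal_gen1 (A : comPzRingType) : ideal_gen (eq (1 : A)) 1.
Proof.
by rewrite -[X in ideal_gen _ X]addr0 -[X in X + _]mulr1; do 2 constructor.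
Qed.

Lemma is_localization_id (A : comPzRingType) :
  is_localization (eq (1 : A)) (idfun : {rmorphism A -> A}).
Proof.
split=> [d <-|b|a a' /= aa].
- exact: is_unit1.
- by exists b, 1; split; [constructor | rewrite /= mulr1].
- by exists 1; [constructor | rewrite aa].
Qed.

Lemma zariski_globally (A : comPzRingType)
    (P : forall B : comPzRingType, {rmorphism A -> B} -> Prop) :
  P A idfun -> zariski_locally P.
Proof.
move=> PA; exists (eq 1); split; first exact: ideal_gen1.
by move=> _ <-; exists A, idfun; split=> //; apply: is_localization_id.
Qed.

Lemma mul_closure_exp (A : comPzRingType) (d s : A) :
  mul_closure (eq d) s -> exists n, s = d ^+ n.
Proof.
elim=> [|_ y <- _ [n ->]]; first by exists 0%N.
by exists n.+1; rewrite exprS.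
Qed.

(** In each term of the expanded power either [d] occurs [k] times or [z] occurs [n] times. The
    induction peels off one factor at a time and so avoids binomial coefficients. *)
Lemma nilpotent_action (A : comPzRingType) (d z r : A) k n b :
  d ^+ k * b = 0 -> z ^+ n * b = 0 -> (r * d + z) ^+ (k + n) * b = 0.
Proof.
move eN : (k + n)%N => N; elim: N k n b eN => [|N IHN] k n b eN dk zn.
  have k0 : k = 0%N by lia.
  by rewrite -[b]mul1r -[1](expr0 d) -[in X in d ^+ X]k0 dk mulr0.
case: k eN dk => [|k] eN dk; first by rewrite -[b]mul1r -[1](expr0 d) dk mulr0.
case: n eN zn => [|n] eN zn; first by rewrite -[b]mul1r -[1](expr0 z) zn mulr0.
have dk' : d ^+ k * (d * b) = 0 by rewrite mulrA -exprSr.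
have zn' : z ^+ n * (z * b) = 0 by rewrite mulrA -exprSr.
rewrite exprSr -mulrA mulrDl mulrDr.
rewrite -[r * d * b]mulrA mulrCA (IHN k n.+1 (d * b)) ?mulr0 ?add0r; last first.
- by rewrite mulrCA zn mulr0.
- exact: dk'.
- by lia.
rewrite (IHN k.+1 n (z * b)) //; first by lia.
by rewrite mulrCA dk mulr0.
Qed.

(** Some power of each [d] kills the difference; by [nilpotent_action] this passes to every element
    of the generated ideal, hence to 1. *)
Lemma zariski_separated (A : comPzRingType) (a a' : A) :
  zariski_locally (fun (B : comPzRingType) (f : {rmorphism A -> B}) => f a = f a') -> a = a'.
Proof.
case=> D [D1 aD]; suff N y : ideal_gen D y -> exists n, y ^+ n * (a - a') = 0.
  have [n] := N 1 D1; rewrite expr1n mul1r => /eqP; rewrite subr_eq0 => /eqP; exact.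
elim=> [|r d z Dd _ [n zn]]; first by exists 1%N; rewrite expr1 mul0r.
have [B [f [[_ _ inj] fa]]] := aD d Dd.
have [_ /mul_closure_exp [k ->] dk] := inj _ _ fa.
by exists (k + n)%N; apply: nilpotent_action => //; rewrite mulrBr dk subrr.
Qed.

Lemma ideal_gen_eq1 (A : comPzRingType) (a : A) : ideal_gen (eq a) 1 <-> is_unit a.
Proof.
split=> [|[y ay]]; last by rewrite -ay mulrC -[y * a]addr0; do 2 constructor.
suff H x : ideal_gen (eq a) x -> exists y, a * y = x by move=> /H [y ay]; exists y.
elim=> [|r _ y <- _ [z <-]]; first by exists 0; rewrite mulr0.
by exists (r + z); rewrite mulrDr mulrC.
Qed.

Lemma prod_unit (A : comPzRingType) (I : eqType) (s : seq I) (F : I -> A) :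
  is_unit (\prod_(i <- s) F i) <-> forall i, i \in s -> is_unit (F i).
Proof.
elim: s => [|i s IHs]; first by rewrite big_nil; split=> // _; apply: is_unit1.
rewrite big_cons; split=> [U j|U].
  rewrite inE => /orP[/eqP ->|js]; first exact: is_unitMl U.
  by apply: (proj1 IHs) => //; apply: is_unitMr U.
apply: is_unitM; first by apply: U; rewrite inE eqxx.
by apply/IHs => j js; apply: U; rewrite inE js orbT.
Qed.

Lemma scaler_unit_inj (A : comPzRingType) (a : A) (k : nat) (u v : 'rV[A]_k) :
  is_unit a -> a *: u = a *: v -> u = v.
Proof.
by case=> b ab E; rewrite -[u]scale1r -[v]scale1r -ab mulrC -!scalerA E.
Qed.

Lemma fraction_infinite (K : fieldType) : infinite_field {fraction {poly K}}.
Proof.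
move=> k; exists [seq (tofrac ('X^i : {poly K})) | i <- iota 0 k]; last by rewrite size_map size_iota.
rewrite map_inj_uniq ?iota_uniq // => i j /eqP; rewrite tofrac_eq => /eqP e.
by have := congr1 (fun p : {poly K} => size p) e; rewrite !size_polyXn => -[].
Qed.

Lemma tofrac_inj (K : fieldType) : injective (@tofrac {poly K}).
Proof. by move=> p q /eqP; rewrite tofrac_eq => /eqP. Qed.

(** * Configurations of lines through a point *)

(* The value x_j is a point of the line of index j + 2 through the common point *)
(* 0 of all lines; line 1 carries the constant 1, and line 0 is degenerate.     *)
(* [GAdd'] replaces [GAdd] when the gate of the line of k already contains the  *)
(* perspectivity with the line of l ([uses]): the additional points of [GAdd]   *)
(* would then be collinear with a point of that gate.                           *)
Variant gate :=
  | GInf | GUnit | GVar | GMul (k l : nat) | GSqr (k : nat) | GAdd (k l : nat)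
  | GAdd' (k l : nat) | GEq (k l : nat) | GNeq (k l : nat).

Definition gate_lines (G : gate) : nat * nat :=
  match G with
  | GMul k l | GAdd k l | GAdd' k l | GEq k l | GNeq k l => (k, l)
  | GSqr k => (k, 1)
  | _ => (0, 0)
  end%N.

Definition uses (G : gate) (l : nat) : bool :=
  match G with
  | GMul k _ | GSqr k => k == l
  | GAdd _ l' | GAdd' _ l' => l' == l
  | _ => false
  end.

Section Configuration.

Variables (L : comNzRingType) (x : nat -> L) (G : nat -> gate).
Variables (m nv : nat) (d : nat -> nat).

Definition gline1 g := (gate_lines (G g)).1.
Definition gline2 g := (gate_lines (G g)).2.

Notation elt := (nat * (L * L * L))%type.

(* The element (g, (a, b, s)) is the point w_g + a w_k + b w_l + s w_0, where    *)
(* k and l are the lines used by the gate of g.                                 *)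
Definition tails (g : nat) : seq (L * L * L) :=
  match G g with
  | GInf => [:: (0, 0, 0)]
  | GUnit => [:: (0, 0, 0); (0, 0, 1)]
  | GVar => [:: (0, 0, 0); (0, 0, 1); (0, 0, x g)]
  | GMul k l => [:: (0, 0, 0); (0, 0, 1); (0, 0, x k); (0, 0, x g);
                    (-1, 0, 0); (0, - x k, 0)]
  | GSqr k => [:: (0, 0, 0); (0, 0, 1); (0, 0, x k); (0, 0, x g);
                  (-1, 0, 0); (- x k, 0, 0)]
  | GAdd k l => [:: (0, 0, 0); (0, 0, 1); (0, 0, x g);
                    (-1, 0, 0); (0, -1, 0); (-1, -1, 0); (0, -1, x k)]
  | GAdd' k l => [:: (0, 0, 0); (0, 0, 1); (0, 0, x g);
                     (0, -1, 0); (0, -1, x k); (1, -1, 1); (1, -1, x k)]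
  | GEq k l => [:: (0, 0, 0); (0, 0, 1); (0, 0, x k); (-1, 0, 0); (0, -1, 0)]
  | GNeq k l => [:: (0, 0, 0); (0, 0, 1); (0, 0, x k); (0, 0, x l);
                    (-1, 0, 0); (0, -1, 0)]
  end.

Definition is_elt (e : elt) := (e.1 < m)%N /\ e.2 \in tails e.1.

Definition vec (A : comPzRingType) (c : L -> A) (w : nat -> 'rV[A]_3) (e : elt) :=
  w e.1 + c e.2.1.1 *: w (gline1 e.1) + c e.2.1.2 *: w (gline2 e.1) + c e.2.2 *: w 0%N.

(** Additions require a strict inequality of degrees, with the summand of larger degree on line [k].
    Squares have a gate of their own because the two lines used by a gate with centers must be
    distinct. *)
Definition gate_ok g :=
  match G g with
  | GInf => g = 0%N
  | GUnit => g = 1%N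
  | GVar => (2 <= g < nv)%N
  | GMul k l => [/\ (2 <= g < nv)%N, (2 <= k < g)%N, (2 <= l < g)%N, k <> l
                   & x g = x k * x l]
  | GSqr k => [/\ (2 <= g < nv)%N, (2 <= k < g)%N & x g = x k * x k]
  | GAdd k l => [/\ (2 <= g < nv)%N, (2 <= k < g)%N, (1 <= l < g)%N,
                    (d l < d k)%N & x g = x k + x l /\ ~~ uses (G k) l]
  | GAdd' k l => [/\ (2 <= g < nv)%N, (2 <= k < g)%N, (1 <= l < g)%N,
                    (d l < d k)%N & x g = x k + x l /\ uses (G k) l]
  | GEq k l => [/\ (nv <= g)%N, (2 <= k < nv)%N, (1 <= l < nv)%N & k <> l]
  | GNeq k l => [/\ (nv <= g)%N, (2 <= k < nv)%N, (2 <= l < nv)%N, k <> l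
                    & d k = d l]
  end.

(* The lines g < nv carry the values x g, of degree d g in t; the other ones     *)
(* are the equality and inequality gadgets.                                     *)
Record config_ok : Prop := ConfigOk {
  config_gate0 : G 0 = GInf;
  config_gate1 : G 1 = GUnit;
  config_gate2 : G 2 = GVar;
  config_nv : (2 < nv <= m)%N;
  config_gate : forall g, (g < m)%N -> gate_ok g;
  config_x1 : x 1%N = 1;
  config_d1 : d 1%N = 0%N;
  config_d : forall g, (2 <= g < nv)%N -> (0 < d g)%N }.

(* An equality with l = 1 stands for a pair (j, j), which is no condition.       *)
Definition admissible (A : comPzRingType) (c : L -> A) :=
  forall g k l, (g < m)%N -> G g = GEq k l -> l = 1%N \/ c (x k) = c (x l).

(** Universal collinearity. This relation mentions no field, and the matroid will have exactly these
    dependent triples. *)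
Definition collinear (p q r : elt) :=
  forall (A : comPzRingType) (c : {rmorphism L -> A}), admissible c ->
  forall w, det3 (vec c w p) (vec c w q) (vec c w r) = 0.

Lemma collinear_rot p q r : collinear p q r -> collinear q r p.
Proof. by move=> C A c ac w; rewrite -det3_rot; apply: C. Qed.

Lemma collinear_swap p q r : collinear p q r -> collinear q p r.
Proof. by move=> C A c ac w; rewrite det3_swap C // oppr0. Qed.

Lemma collinear_xx p q : collinear p p q.
Proof. by move=> A c _ w; apply: det3_xx. Qed.

Lemma collinear_diff p q r :
  (forall (A : comPzRingType) (c : {rmorphism L -> A}), admissible c ->
   forall w, exists z, vec c w p - vec c w q = z *: vec c w r) -> collinear p q r.
Proof.
move=> D A c ac w; have [z /eqP] := D A c ac w.
rewrite subr_eq => /eqP ->; move: (vec c w q) (vec c w r) => u v.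
by rewrite /det3 !mxE; ring.
Qed.

Hypothesis ok : config_ok.

Lemma elt_gt0 (e : elt) : is_elt e -> e.1 = 0%N -> e = (0%N, (0, 0, 0)).
Proof.
case: e => g t [/= _ +] g0; rewrite g0 /tails (config_gate0 ok) inE => /eqP -> //.
Qed.

Lemma gline0 : (gline1 0 = 0%N) * (gline2 0 = 0%N).
Proof. by rewrite /gline1 /gline2 (config_gate0 ok). Qed.

Lemma gline_lt g : (0 < g < m)%N -> (gline1 g < g)%N && (gline2 g < g)%N.
Proof.
case/andP=> g0 gm; have := config_gate ok gm; have := config_nv ok.
rewrite /gate_ok /gline1 /gline2; case: (G g) => //= *; try lia;
  repeat match goal with H : [/\ _, _ & _] |- _ => case: H => *
  | H : [/\ _, _, _ & _] |- _ => case: H => *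
  | H : [/\ _, _, _, _ & _] |- _ => case: H => * end; lia.
Qed.

Lemma gline_spec g : (0 < g < m)%N ->
  (forall t, t \in tails g -> t.1 = (0, 0)) \/
  [/\ (0 < gline1 g)%N, (0 < gline2 g)%N & gline1 g <> gline2 g].
Proof.
case/andP=> g0 gm; have := config_gate ok gm; have := config_nv ok.
rewrite /gate_ok /gline1 /gline2 /tails; case: (G g) => /=;
  try by move=> *; left => t; rewrite !inE; repeat case/orP; move=> /eqP ->.
all: move=> *; right;
  repeat match goal with H : [/\ _, _ & _] |- _ => case: H => *
  | H : [/\ _, _, _ & _] |- _ => case: H => *
  | H : [/\ _, _, _, _ & _] |- _ => case: H => * end; split; try done;
  (lia || (move=> e; subst; lia)).
Qed.

(* [pts_spec k s] holds for the points (k, (0, 0, s)) of the line of k, and     *)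
(* [centers_spec g l b s] for the points w_g + b w_l + s w_0: these are the     *)
(* centers of the perspectivities from the line of l to the line of g.         *)
Definition pts_spec k s :=
  s = 0 \/ exists j, [/\ s = x j, (1 <= j < nv)%N &
    [\/ j = 1%N, j = k | (0 < d j < d k)%N]].

Definition centers_spec g l b s :=
  match G g with
  | GMul k l' => [/\ l = k, b = -1 & s = 0] \/ [/\ l = l', b = - x k & s = 0]
  | GSqr k => [/\ l = k, b = -1 \/ b = - x k & s = 0]
  | GAdd k l' => [/\ l = k, b = -1 & s = 0] \/
                 [/\ l = l', b = -1 & s = 0 \/ s = x k]
  | GAdd' k l' => [/\ l = l', b = -1 & s = 0 \/ s = x k]
  | _ => False
  end.

Definition all_elts : seq elt := [seq (g, t) | g <- iota 0 m, t <- tails g].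

Lemma mem_all_elts e : reflect (is_elt e) (e \in all_elts).
Proof.
apply: (iffP allpairsPdep) => [[g [t [gm tg ->]]]|[em te]].
  by split=> //=; move: gm; rewrite mem_iota.
by exists e.1, e.2; rewrite mem_iota em; case: e em te.
Qed.

Lemma vec_linear (A : comPzRingType) (c : L -> A) (w w' : nat -> 'rV[A]_3) z e :
  vec c (fun i => w i + z *: w' i) e = vec c w e + z *: vec c w' e.
Proof. by apply/rowP=> i; rewrite /vec !mxE; ring. Qed.

Lemma vec_ext (A : comPzRingType) (c : L -> A) (w w' : nat -> 'rV[A]_3) e :
  is_elt e -> (forall i, (i < m)%N -> w i = w' i) -> vec c w e = vec c w' e.
Proof.
case: e => g t [/= gm _] E; rewrite /vec /= !E //; first by lia.
  have [->|g0] := posnP g; first by rewrite !gline0; lia.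
  by have := gline_lt (g := g); rewrite g0 gm => /(_ isT); lia.
have [->|g0] := posnP g; first by rewrite !gline0; lia.
by have := gline_lt (g := g); rewrite g0 gm => /(_ isT); lia.
Qed.

Lemma vec_mulmx (A : comPzRingType) (c : L -> A) (w : nat -> 'rV[A]_3) (M : 'M[A]_3) e :
  vec c (fun i => w i *m M) e = vec c w e *m M.
Proof. by rewrite /vec !mulmxDl -!scalemxAl. Qed.

Lemma is_elt0 g : (g < m)%N -> is_elt (g, (0, 0, 0)).
Proof. by split=> //; rewrite /= /tails; case: (G g) => *; rewrite inE eqxx. Qed.

Lemma is_elt1 g : (0 < g < m)%N -> is_elt (g, (0, 0, 1)).
Proof.
case/andP=> g0 gm; split=> //; have := config_gate ok gm; rewrite /= /gate_ok /tails.
by case: (G g) => *; rewrite !inE ?eqxx ?orbT //; lia.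
Qed.

Lemma is_eltx g : (0 < g < nv)%N -> is_elt (g, (0, 0, x g)).
Proof.
move=> gn; have := config_nv ok => nvm; have gm : (g < m)%N by lia.
split=> //; have := config_gate ok gm; rewrite /= /gate_ok /tails.
case: (G g).
- lia.
- by move=> ->; rewrite (config_x1 ok) !inE eqxx orbT.
all: move=> *; rewrite !inE ?eqxx ?orbT //.
all: by exfalso; match goal with H : [/\ _, _, _ & _] |- _ => case: H => *
  | H : [/\ _, _, _, _ & _] |- _ => case: H => * end; lia.
Qed.

(** * Dependences between elements over a field-valued point of R *)

Section FieldPoint.

Variables (K : fieldType) (c : {rmorphism L -> {poly K}}).
Hypothesis c_size : forall g, (1 <= g < nv)%N -> size (c (x g)) = (d g).+1.
Hypothesis c_adm : admissible c.
Hypothesis c_neq : forall g k l, (g < m)%N -> G g = GNeq k l -> c (x k) <> c (x l).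

Variables (F : fieldType) (emb : {rmorphism {poly K} -> F}).
Hypothesis emb_inj : injective emb.

Definition cF (a : L) : F := emb (c a).

(** One coordinate of the point of [e], viewed as a linear form in the corresponding coordinates of
    the vectors w_j. *)
Definition phi (w : nat -> F) (e : elt) : F :=
  w e.1 + cF e.2.1.1 * w (gline1 e.1) + cF e.2.1.2 * w (gline2 e.1) + cF e.2.2 * w 0%N.

Definition indep (p q r : elt) := forall la mu nu,
  (forall w, la * phi w p + mu * phi w q + nu * phi w r = 0) ->
  [/\ la = 0, mu = 0 & nu = 0].

Lemma indep_rot p q r : indep p q r -> indep q r p.
Proof.
move=> I la mu nu H; case: (I nu la mu) => // w.
by rewrite -(H w); ring.
Qed.

Lemma indep_swap p q r : indep p q r -> indep q p r.
Proof.
move=> I la mu nu H; case: (I mu la nu) => // w.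
by rewrite -(H w); ring.
Qed.

Lemma c_eq_d i j : (1 <= i < nv)%N -> (1 <= j < nv)%N -> c (x i) = c (x j) -> d i = d j.
Proof. by move=> /c_size si /c_size sj e; move: si; rewrite e sj => -[]. Qed.

Lemma cF_inj a b : cF a = cF b -> c a = c b.
Proof. exact: emb_inj. Qed.

Lemma cF_eq0 a : (cF a == 0) = (c a == 0).
Proof. by rewrite /cF -(inj_eq emb_inj (c a)) rmorph0. Qed.

Lemma cF0 : cF 0 = 0. Proof. by rewrite /cF !rmorph0. Qed.

(** Evaluating a form at [delta i] reads off its coefficient of w_i. *)
Definition delta (i j : nat) : F := (j == i)%:R.

Lemma delta_id i : delta i i = 1. Proof. by rewrite /delta eqxx. Qed.

Lemma delta_neq i j : i <> j -> delta i j = 0.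
Proof. by move=> ij; rewrite /delta; case: eqP => // ji; case: ij. Qed.

Lemma phi_delta_top e : is_elt e -> (0 < e.1)%N -> phi (delta e.1) e = 1.
Proof.
case: e => g t [/= gm _] g0; have := @gline_lt g; rewrite g0 gm => /(_ isT) /andP[k l].
by rewrite /phi /= delta_id !delta_neq ?mulr0 ?addr0 //; lia.
Qed.

Lemma phi_delta_gt e i : is_elt e -> (e.1 < i)%N -> phi (delta i) e = 0.
Proof.
case: e => g t [/= gm _] gi; rewrite /phi /=.
have [k l] : (gline1 g < i)%N /\ (gline2 g < i)%N.
  have [->|g0] := posnP g; first by rewrite !gline0; lia.
  have := @gline_lt g; rewrite g0 gm => /(_ isT) /andP[k l]; lia.
by rewrite !delta_neq ?mulr0 ?addr0 //; lia.
Qed.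

Definition dform (k l : nat) (a b s : F) (w : nat -> F) := a * w k + b * w l + s * w 0%N.

(** The coefficient of w_g must cancel, so the dependence involves only the displacement between the
    two points of line g and the third element. *)
Lemma rel_diff g t t' r la mu nu : is_elt (g, t) -> is_elt (g, t') -> is_elt r ->
  (r.1 < g)%N ->
  (forall w, la * phi w (g, t) + mu * phi w (g, t') + nu * phi w r = 0) ->
  mu = - la /\ forall w, la * dform (gline1 g) (gline2 g) (cF t.1.1 - cF t'.1.1)
      (cF t.1.2 - cF t'.1.2) (cF t.2 - cF t'.2) w + nu * phi w r = 0.
Proof.
move=> pe qe re rg H.
have la_mu : mu = - la.
  have := H (delta g); rewrite !(phi_delta_top (e := (g, _))) //= ?(leq_ltn_trans _ rg) //.
  rewrite phi_delta_gt // mulr0 addr0 !mulr1 addrC => /eqP.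
  by rewrite addr_eq0 => /eqP.
split=> // w; rewrite -[RHS](H w) la_mu /phi /dform /=; ring.
Qed.

Ltac kill_delta := rewrite ?delta_id;
  repeat match goal with |- context [delta ?i ?j] =>
    rewrite (@delta_neq i j); [|by lia] end;
  rewrite ?(mul0r, mulr0, addr0, add0r, mulr1).

Section Match.
Variables (k l : nat) (a b s la nu : F) (r : elt).
Hypotheses (re : is_elt r) (la0 : la != 0) (nu0 : nu != 0).
Hypothesis H : forall w, la * dform k l a b s w + nu * phi w r = 0.

(** A displacement along w_0 alone points to the common point of the lines. *)
Lemma match_point : a = 0 -> b = 0 -> r = (0%N, (0, 0, 0)).
Proof.
move=> a0 b0; apply: elt_gt0 => //; have [//|r0] := posnP r.1.
have := H (delta r.1); rewrite phi_delta_top // /dform a0 b0; kill_delta.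
by move/eqP; rewrite (negPf nu0).
Qed.

(** A displacement along w_k and w_0 can only be matched on line k, by the point of coordinate s /
    a. *)
Lemma match_center : a != 0 -> b = 0 -> (0 < k)%N ->
  [/\ r.1 = k, cF r.2.1.1 = 0, cF r.2.1.2 = 0 & a * cF r.2.2 = s].
Proof.
move=> a0 b0 k0.
have rk : r.1 = k.
  have [r0|r0] := posnP r.1.
    have := H (delta k); rewrite (elt_gt0 re r0) /phi /dform !gline0 /= b0; kill_delta.
    by move/eqP; rewrite mulf_eq0 (negPf la0) (negPf a0).
  have [//|/eqP rk] := eqVneq r.1 k.
  have := H (delta r.1); rewrite phi_delta_top // /dform b0; kill_delta.
  by move=> /eqP; rewrite (negPf nu0).
have nuE : nu = - (la * a).
  have dk : phi (delta k) r = 1 by rewrite -rk phi_delta_top ?rk.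
  have := H (delta k); rewrite dk /dform b0; kill_delta.
  by rewrite addrC => /eqP; rewrite addr_eq0 => /eqP.
have rm : (0 < r.1 < m)%N by rewrite rk k0 -rk; case: re.
have [r1 r2] : cF r.2.1.1 = 0 /\ cF r.2.1.2 = 0.
  have [|[l1 l2 l12]] := gline_spec rm.
    by case: re => _ + /(_ r.2) => /[swap] /[apply] ->; rewrite !cF0.
  have /andP[l1k l2k] := gline_lt rm; rewrite rk in l1k l2k l1 l2 l12.
  split.
    have := H (delta (gline1 k)); rewrite /phi /dform b0 rk; kill_delta.
    by move/eqP; rewrite mulf_eq0 (negPf nu0) => /eqP.
  have := H (delta (gline2 k)); rewrite /phi /dform b0 rk; kill_delta.
  by move/eqP; rewrite mulf_eq0 (negPf nu0) => /eqP.
split=> //; have := H (delta 0); rewrite /phi /dform b0 rk r1 r2; kill_delta.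
rewrite nuE mulNr -mulrA -mulrBr => /eqP.
by rewrite mulf_eq0 (negPf la0) subr_eq0 => /eqP.
Qed.

(** A displacement involving both lines can only be matched on the later one, by a center over the
    earlier one; [r] has to be this center, with ratio b / a and shift s / a. *)
Lemma match_double : a != 0 -> b != 0 -> (0 < l < k)%N ->
  r.1 = k /\ a * cF r.2.2 = s /\
  ([/\ gline1 k = l, a * cF r.2.1.1 = b & cF r.2.1.2 = 0] \/
   [/\ gline2 k = l, a * cF r.2.1.2 = b & cF r.2.1.1 = 0]).
Proof.
move=> a0 b0 /andP[l0 lk].
have rk : r.1 = k.
  have [r0|r0] := posnP r.1.
    have := H (delta k); rewrite (elt_gt0 re r0) /phi /dform !gline0 /=; kill_delta.
    by move/eqP; rewrite mulf_eq0 (negPf la0) (negPf a0).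
  have [//|/eqP rk] := eqVneq r.1 k.
  have [rl|/eqP rl] := eqVneq r.1 l.
    have := H (delta k); rewrite phi_delta_gt ?rl // /dform; kill_delta.
    by move/eqP; rewrite mulf_eq0 (negPf la0) (negPf a0).
  have := H (delta r.1); rewrite phi_delta_top // /dform; kill_delta.
  by move=> /eqP; rewrite (negPf nu0).
have k0 : (0 < k)%N by lia.
have nuE : nu = - (la * a).
  have dk : phi (delta k) r = 1 by rewrite -rk phi_delta_top ?rk.
  have := H (delta k); rewrite dk /dform; kill_delta.
  by rewrite addrC => /eqP; rewrite addr_eq0 => /eqP.
have cancel u v : la * u + nu * v = 0 -> a * v = u.
  rewrite nuE mulNr -mulrA -mulrBr => /eqP.
  by rewrite mulf_eq0 (negPf la0) subr_eq0 => /eqP /esym.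
have rm : (0 < r.1 < m)%N by rewrite rk k0 -rk; case: re.
split=> //; have [|[l1 l2 l12]] := gline_spec rm.
  case: re => _ + /(_ r.2) => /[swap] /[apply] r0.
  have := H (delta l); rewrite /phi /dform rk r0 /= cF0; kill_delta.
  by move/eqP; rewrite mulf_eq0 (negPf la0) (negPf b0).
have /andP[l1k l2k] := gline_lt rm; rewrite rk in l1k l2k l1 l2 l12.
split.
  by have := H (delta 0); rewrite /phi /dform rk; kill_delta => /cancel.
have F1 : a * cF r.2.1.1 = b * delta (gline1 k) l.
  by have := H (delta (gline1 k)); rewrite /phi /dform rk; kill_delta => /cancel.
have F2 : a * cF r.2.1.2 = b * delta (gline2 k) l.
  by have := H (delta (gline2 k)); rewrite /phi /dform rk; kill_delta => /cancel.
have [l1E|/eqP l1E] := eqVneq (gline1 k) l.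
  left; split=> //; first by rewrite F1 -l1E delta_id mulr1.
  move: F2; kill_delta.
  by move=> /eqP; rewrite mulf_eq0 (negPf a0) => /eqP.
have [l2E|/eqP l2E] := eqVneq (gline2 k) l.
  right; split=> //; first by rewrite F2 -l2E delta_id mulr1.
  move: F1; kill_delta.
  by move=> /eqP; rewrite mulf_eq0 (negPf a0) => /eqP.
have := H (delta l); rewrite /phi /dform rk; kill_delta.
by move/eqP; rewrite mulf_eq0 (negPf la0) (negPf b0).
Qed.

End Match.

(** * Separation of coordinates by their degrees in t *)

(** Identity of two coordinates modulo the equalities of the configuration; this is what a
    coincidence over K[t] has to be upgraded to. *)
Definition ueq (a b : L) := forall (A : comPzRingType) (c' : {rmorphism L -> A}),
  admissible c' -> c' a = c' b.

Lemma ueq_refl a b : a = b -> ueq a b. Proof. by move=> ->. Qed.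

Lemma nv_m g : (g < nv)%N -> (g < m)%N.
Proof. by have := config_nv ok; lia. Qed.

Lemma c_nz g : (1 <= g < nv)%N -> (c (x g) == 0) = false.
Proof. by move=> /c_size s; apply: negbTE; rewrite -size_poly_gt0 s. Qed.

Lemma c_n1 g : (1 <= g < nv)%N -> (0 < d g)%N -> (c (x g) == 1) = false.
Proof. by move=> /c_size s dg; apply/eqP => e; move: s; rewrite e size_poly1; lia. Qed.

Lemma dpos g : (1 <= g < nv)%N -> (0 < d g)%N \/ g = 1%N.
Proof.
move=> gr; have [->|g1] := eqVneq g 1%N; [by right | left].
by apply: (config_d ok); lia.
Qed.

Lemma mul_d k l g : (1 <= g < nv)%N -> (1 <= k < nv)%N -> (1 <= l < nv)%N ->
  x g = x k * x l -> d g = (d k + d l)%N.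
Proof.
move=> gr kr lr e; have := c_size gr; rewrite e rmorphM size_mul.
- by rewrite (c_size kr) (c_size lr); lia.
- by rewrite c_nz.
- by rewrite c_nz.
Qed.

Lemma add_d k l g : (1 <= g < nv)%N -> (1 <= k < nv)%N -> (1 <= l < nv)%N ->
  (d l < d k)%N -> x g = x k + x l -> d g = d k.
Proof.
move=> gr kr lr lk e; have := c_size gr; rewrite e rmorphD size_polyDl.
  by rewrite (c_size kr) => -[].
by rewrite (c_size kr) (c_size lr).
Qed.

(** In characteristic 2 the left side is 0, and otherwise it has positive degree. *)
Lemma twice_neq1 g : (1 <= g < nv)%N -> (0 < d g)%N -> c (x g) + c (x g) <> 1.
Proof.
move=> gr dg e; have : c (x g) * 2%:R = 1 by rewrite mulr_natr mulr2n.
move=> e2; have := congr1 (fun p : {poly K} => size p) e2; rewrite size_poly1.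
have [z|z] := eqVneq (2%:R : {poly K}) 0.
  by move: e2; rewrite z mulr0 => /eqP; rewrite eq_sym oner_eq0.
rewrite size_mul ?c_nz // c_size //.
by move: z; rewrite -size_poly_gt0; move: (size _) => s s0 /=; lia.
Qed.

Lemma pts_size k s : (1 <= k < nv)%N -> pts_spec k s -> (size (c s) <= (d k).+1)%N.
Proof.
move=> kr [->|[j [-> jr H]]]; first by rewrite rmorph0 size_poly0.
rewrite c_size //; case: H => [->|->|]; rewrite ?(config_d1 ok); lia.
Qed.

(** This and the next lemmas express that degrees separate the coordinates on a line: a value equal
    over K[t] to 0, to 1, or of the full degree of x_k comes from exactly that coordinate. *)
Lemma pts_eq0 k s : pts_spec k s -> c s = 0 -> s = 0.
Proof. by case=> [//|[j [-> jr _]] /eqP]; rewrite c_nz. Qed.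

Lemma pts_eq1 k s : pts_spec k s -> c s = 1 -> s = 1.
Proof.
case=> [->|[j [-> jr _]] e]; first by rewrite rmorph0 => /eqP; rewrite eq_sym oner_eq0.
have [dj|->] := dpos jr; last exact: (config_x1 ok).
by move/eqP: e; rewrite c_n1.
Qed.

Lemma pts_eqk k s : (1 <= k < nv)%N -> pts_spec k s -> size (c s) = (d k).+1 -> s = x k.
Proof.
move=> kr [->|[j [-> jr H]]]; first by rewrite rmorph0 size_poly0.
rewrite c_size // => -[djk]; case: H => [j1|-> //|]; last lia.
by have [|k1] := dpos kr; [rewrite -djk j1 (config_d1 ok) | rewrite k1 j1].
Qed.

Lemma pts_gt k s : (1 <= k < nv)%N -> pts_spec k s -> ((d k).+1 < size (c s))%N -> False.
Proof. by move=> kr /(pts_size kr); lia. Qed.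

Lemma cN1 : c (-1) <> 0.
Proof. by rewrite rmorphN rmorph1 => /eqP; rewrite oppr_eq0 oner_eq0. Qed.

Lemma cNx k : (1 <= k < nv)%N -> c (- x k) <> 0.
Proof. by move=> kr; rewrite rmorphN => /eqP; rewrite oppr_eq0 c_nz. Qed.

Lemma pts0 k : pts_spec k 0. Proof. by left. Qed.

Lemma pts1 k : pts_spec k 1.
Proof.
right; exists 1%N; split; [by rewrite (config_x1 ok) | | by constructor 1].
by have := config_nv ok; lia.
Qed.

Lemma ptsk k : (1 <= k < nv)%N -> pts_spec k (x k).
Proof. by move=> kr; right; exists k; split => //; constructor 2. Qed.

Lemma pts_lt k j : (1 <= j < nv)%N -> (0 < d j < d k)%N -> pts_spec k (x j).
Proof. by move=> jr jk; right; exists j; split => //; constructor 3. Qed.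

(** In a product or square gate, the copied factor also lies on line k. Its degree is positive and
    strictly smaller than that of the product, which is the third alternative of [pts_spec]. *)
Lemma tail_pts k t : (1 <= k < nv)%N -> t \in tails k -> c t.1.1 = 0 -> c t.1.2 = 0 ->
  t = (0, 0, t.2) /\ pts_spec k t.2.
Proof.
move=> kr; have km := nv_m (proj2 (andP kr)); have := config_gate ok km.
rewrite /gate_ok /tails.
have p0 := pts0 k; have p1 := pts1 k; have pk := ptsk kr.
have n1 := cN1; have n2 : c 1 <> 0 by rewrite rmorph1 => /eqP; rewrite oner_eq0.
case: (G k) => [|||k' l'|k'|k' l'|k' l'|k' l'|k' l'] /= okg; dest; intail; try by [];
  try lia; try by move=> _ /cNx [] //; lia.
- have kr : (1 <= k < nv)%N by lia.
  have kr' : (1 <= k' < nv)%N by lia.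
  have lr' : (1 <= l' < nv)%N by lia.
  have e := mul_d kr kr' lr' ltac:(eassumption).
  split=> //; apply: pts_lt => //.
  have := config_d ok (g := k'); have := config_d ok (g := l'); lia.
- have kr : (1 <= k < nv)%N by lia.
  have kr' : (1 <= k' < nv)%N by lia.
  have e := mul_d kr kr' kr' ltac:(eassumption).
  split=> //; apply: pts_lt => //.
  have := config_d ok (g := k'); lia.
by move=> /cNx []; lia.
Qed.

Lemma tail_center1 k l t : (1 <= k < nv)%N -> t \in tails k ->
  gline1 k = l -> c t.1.1 <> 0 -> c t.1.2 = 0 ->
  t = (t.1.1, 0, t.2) /\ centers_spec k l t.1.1 t.2.
Proof.
move=> kr; have km := nv_m (proj2 (andP kr)); have := config_gate ok km.
rewrite /gate_ok /tails /gline1 /centers_spec.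
have n1 := cN1; have c0 := rmorph0 c.
case: (G k) => [|||k' l'|k'|k' l'|k' l'|k' l'|k' l'] /= okg; dest; intail; try by []; try lia.
- by move=> <- _ _; split=> //; left.
- by move=> <- _ _; split=> //; split=> //; left.
- by move=> <- _ _; split=> //; split=> //; right.
- by move=> <- _ _; split=> //; left.
Qed.

Lemma tail_center2 k l t : (1 <= k < nv)%N -> t \in tails k ->
  gline2 k = l -> c t.1.1 = 0 -> c t.1.2 <> 0 ->
  t = (0, t.1.2, t.2) /\ centers_spec k l t.1.2 t.2.
Proof.
move=> kr; have km := nv_m (proj2 (andP kr)); have := config_gate ok km.
rewrite /gate_ok /tails /gline2 /centers_spec.
have n1 := cN1; have c0 := rmorph0 c.
have n2 : c 1 <> 0 by rewrite rmorph1 => /eqP; rewrite oner_eq0.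
case: (G k) => [|||k' l'|k'|k' l'|k' l'|k' l'|k' l'] /= okg; dest; intail; try by []; try lia.
- by move=> <- _ _; split=> //; right.
- by move=> <- _ _; split=> //; right; split=> //; left.
- by move=> <- _ _; split=> //; right; split=> //; right.
- by move=> <- _ _; split=> //; split=> //; left.
- by move=> <- _ _; split=> //; split=> //; right.
Qed.

(** Sums and products have at least the degree of each line they use, so no gate has a center over a
    line of larger degree. *)
Lemma centers_d k l b s : (1 <= k < nv)%N -> centers_spec k l b s -> (d l <= d k)%N.
Proof.
move=> kr; have km := nv_m (proj2 (andP kr)); have := config_gate ok km.
rewrite /gate_ok /centers_spec.
case: (G k) => [|||k' l'|k'|k' l'|k' l'|k' l'|k' l'] //.
- case=> [_ k'r l'r _ e]; have := mul_d kr (k := k') (l := l').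
  by move=> /(_ _ _ e) D [[-> _ _]|[-> _ _]]; rewrite D; lia.
- case=> [_ k'r e]; have := mul_d kr (k := k') (l := k').
  by move=> /(_ _ _ e) D [-> _ _]; rewrite D; lia.
- case=> [_ k'r l'r dd [e _]]; have := add_d kr (k := k') (l := l').
  by move=> /(_ _ _ dd e) D [[-> _ _]|[-> _ _]]; rewrite D; lia.
- case=> [_ k'r l'r dd [e _]]; have := add_d kr (k := k') (l := l').
  by move=> /(_ _ _ dd e) D [-> _ _]; rewrite D; lia.
Qed.

(** * Two elements on one line and a third on an earlier line *)

(** The situation left by [rel_diff], with both coefficients nonzero: every dependence with an
    earlier element must be universal. *)
Definition good_pair g (t t' : L * L * L) := forall (r : elt) (la nu : F),
  (r.1 < g)%N -> is_elt r -> la != 0 -> nu != 0 ->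
  (forall w, la * dform (gline1 g) (gline2 g) (cF t.1.1 - cF t'.1.1)
      (cF t.1.2 - cF t'.1.2) (cF t.2 - cF t'.2) w + nu * phi w r = 0) ->
  collinear (g, t) (g, t') r.

Lemma good_pair_sym g t t' : good_pair g t t' -> good_pair g t' t.
Proof.
move=> gp r la nu rg re la0 nu0 H; suff C : collinear (g, t) (g, t') r by have := collinear_swap C.
have la0' : - la != 0.
  by rewrite oppr_eq0.
refine (gp r (- la) nu rg re la0' nu0 _).
by move=> w; rewrite -[RHS](H w) /dform; ring.
Qed.

Lemma vecB (A : comPzRingType) (c' : {rmorphism L -> A}) w g t t' :
  vec c' w (g, t) - vec c' w (g, t') = c' (t.1.1 - t'.1.1) *: w (gline1 g)
    + c' (t.1.2 - t'.1.2) *: w (gline2 g) + c' (t.2 - t'.2) *: w 0%N.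
Proof. by apply/rowP=> i; rewrite /vec !rmorphB !mxE /=; ring. Qed.

Lemma good_pair_point g t t' : t.1 = t'.1 -> good_pair g t t'.
Proof.
move=> e r la nu rg re la0 nu0; rewrite e !subrr => H.
have -> := match_point re la0 nu0 H erefl erefl.
apply: collinear_diff => A c' ac w; exists (c' (t.2 - t'.2)).
rewrite vecB e !subrr !rmorph0 !scale0r !add0r /vec /= !gline0 rmorph0.
by rewrite !scale0r !addr0.
Qed.

Lemma good_pair_center1 g t t' : (0 < g < m)%N -> (1 <= gline1 g < nv)%N ->
  t.1.2 = t'.1.2 -> c (t.1.1 - t'.1.1) <> 0 ->
  (forall s, pts_spec (gline1 g) s -> c ((t.1.1 - t'.1.1) * s) = c (t.2 - t'.2) ->
     ueq ((t.1.1 - t'.1.1) * s) (t.2 - t'.2)) ->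
  good_pair g t t'.
Proof.
move=> gr kr e a0 S r la nu rg re la0 nu0; rewrite e subrr -!rmorphB => H.
have := match_center re la0 nu0 H _ erefl; case=> [||rk r1 r2 rs].
- by rewrite cF_eq0 //; apply/eqP.
- by case/andP: kr.
have [] := tail_pts kr (t := r.2).
- by rewrite -rk; case: re.
- by apply/eqP; rewrite -cF_eq0 r1.
- by apply/eqP; rewrite -cF_eq0 r2.
move=> r2E rpts; have {}S := S _ rpts.
apply: collinear_diff => A c' ac w; exists (c' (t.1.1 - t'.1.1)).
rewrite vecB e subrr rmorph0 scale0r addr0 /vec rk r2E /= rmorph0 !scale0r !addr0.
rewrite scalerDr scalerA -rmorphM S //; apply: cF_inj.
by rewrite /cF !rmorphM.
Qed.

Lemma good_pair_center2 g t t' : (0 < g < m)%N -> (1 <= gline2 g < nv)%N ->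
  t.1.1 = t'.1.1 -> c (t.1.2 - t'.1.2) <> 0 ->
  (forall s, pts_spec (gline2 g) s -> c ((t.1.2 - t'.1.2) * s) = c (t.2 - t'.2) ->
     ueq ((t.1.2 - t'.1.2) * s) (t.2 - t'.2)) ->
  good_pair g t t'.
Proof.
move=> gr kr e a0 S r la nu rg re la0 nu0; rewrite e subrr -!rmorphB => H.
have H' w : la * dform (gline2 g) (gline1 g) (cF (t.1.2 - t'.1.2)) 0
    (cF (t.2 - t'.2)) w + nu * phi w r = 0.
  by rewrite -[RHS](H w) /dform; ring.
have := match_center re la0 nu0 H' _ erefl; case=> [||rk r1 r2 rs].
- by rewrite cF_eq0 //; apply/eqP.
- by case/andP: kr.
have [] := tail_pts kr (t := r.2).
- by rewrite -rk; case: re.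
- by apply/eqP; rewrite -cF_eq0 r1.
- by apply/eqP; rewrite -cF_eq0 r2.
move=> r2E rpts; have {}S := S _ rpts.
apply: collinear_diff => A c' ac w; exists (c' (t.1.2 - t'.1.2)).
rewrite vecB e subrr rmorph0 scale0r add0r /vec rk r2E /= rmorph0 !scale0r !addr0.
rewrite scalerDr scalerA -rmorphM S //; apply: cF_inj.
by rewrite /cF !rmorphM.
Qed.

(** The third element is a center between the two lines, located on the later one; the last two
    hypotheses treat the two possible orders. *)
Lemma good_pair_double g t t' : (0 < g < m)%N ->
  (1 <= gline1 g < nv)%N -> (1 <= gline2 g < nv)%N -> gline1 g <> gline2 g ->
  c (t.1.1 - t'.1.1) <> 0 -> c (t.1.2 - t'.1.2) <> 0 ->
  (forall b s, centers_spec (gline1 g) (gline2 g) b s ->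
     c ((t.1.1 - t'.1.1) * b) = c (t.1.2 - t'.1.2) ->
     c ((t.1.1 - t'.1.1) * s) = c (t.2 - t'.2) ->
     ueq ((t.1.1 - t'.1.1) * b) (t.1.2 - t'.1.2) /\
     ueq ((t.1.1 - t'.1.1) * s) (t.2 - t'.2)) ->
  (forall b s, centers_spec (gline2 g) (gline1 g) b s ->
     c ((t.1.2 - t'.1.2) * b) = c (t.1.1 - t'.1.1) ->
     c ((t.1.2 - t'.1.2) * s) = c (t.2 - t'.2) ->
     ueq ((t.1.2 - t'.1.2) * b) (t.1.1 - t'.1.1) /\
     ueq ((t.1.2 - t'.1.2) * s) (t.2 - t'.2)) ->
  good_pair g t t'.
Proof.
move=> gr kr lr kl a0 b0 S1 S2 r la nu rg re la0 nu0.
have cFM u v w : cF u * cF v = cF w -> c (u * v) = c w.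
  by move=> e; apply: cF_inj; rewrite /cF !rmorphM.
have cF0' u : cF u = 0 -> c u = 0 by move=> e; apply/eqP; rewrite -cF_eq0 e.
rewrite -!rmorphB => H.
have [lk|] := ltnP (gline2 g) (gline1 g).
  have [|||rk [rs rab]] := match_double re la0 nu0 H.
  - by rewrite cF_eq0 //; apply/eqP.
  - by rewrite cF_eq0 //; apply/eqP.
  - lia.
  apply: collinear_diff => A c' ac w; exists (c' (t.1.1 - t'.1.1)).
  have rt : r.2 \in tails (gline1 g) by rewrite -rk; case: re.
  rewrite vecB /vec rk; case: rab => [] [kE /[dup] ra /cFM ra' /cF0' rb].
    have [] := tail_center1 kr rt kE _ rb.
      by move=> z; apply: b0; rewrite -ra' rmorphM z mulr0.
    move=> rE /S1 /(_ ra' (cFM _ _ _ rs)) [U1 U2].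
    rewrite rE /= rmorph0 scale0r addr0 !scalerDr !scalerA kE -!rmorphM.
    by rewrite (U1 _ _ ac) (U2 _ _ ac).
  have [] := tail_center2 kr rt kE rb.
    by move=> z; apply: b0; rewrite -ra' rmorphM z mulr0.
  move=> rE /S1 /(_ ra' (cFM _ _ _ rs)) [U1 U2].
  rewrite rE /= rmorph0 scale0r addr0 !scalerDr !scalerA kE -!rmorphM.
  by rewrite (U1 _ _ ac) (U2 _ _ ac).
rewrite leq_eqVlt => /orP[/eqP //|lk].
have H' w : la * dform (gline2 g) (gline1 g) (cF (t.1.2 - t'.1.2))
    (cF (t.1.1 - t'.1.1)) (cF (t.2 - t'.2)) w + nu * phi w r = 0.
  by rewrite -[RHS](H w) /dform; ring.
have [|||rk [rs rab]] := match_double re la0 nu0 H'.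
- by rewrite cF_eq0 //; apply/eqP.
- by rewrite cF_eq0 //; apply/eqP.
- lia.
apply: collinear_diff => A c' ac w; exists (c' (t.1.2 - t'.1.2)).
have rt : r.2 \in tails (gline2 g) by rewrite -rk; case: re.
rewrite vecB /vec rk [X in X + _]addrC; case: rab => [] [kE /[dup] ra /cFM ra' /cF0' rb].
  have [] := tail_center1 lr rt kE _ rb.
    by move=> z; apply: a0; rewrite -ra' rmorphM z mulr0.
  move=> rE /S2 /(_ ra' (cFM _ _ _ rs)) [U1 U2].
  rewrite rE /= rmorph0 scale0r addr0 !scalerDr !scalerA kE -!rmorphM.
  by rewrite (U1 _ _ ac) (U2 _ _ ac).
have [] := tail_center2 lr rt kE rb.
  by move=> z; apply: a0; rewrite -ra' rmorphM z mulr0.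
move=> rE /S2 /(_ ra' (cFM _ _ _ rs)) [U1 U2].
rewrite rE /= rmorph0 scale0r addr0 !scalerDr !scalerA kE -!rmorphM.
by rewrite (U1 _ _ ac) (U2 _ _ ac).
Qed.

Ltac simp_disp := rewrite ?(subr0, sub0r, addr0, add0r, opprK, mul1r, mulN1r, oppr0, subrr, mulNr, mul0r, mulr0).
Ltac disp g1E g2E := first
 [ solve [eapply good_pair_point; reflexivity]
 | eapply good_pair_center1; rewrite ?g1E ?g2E; [by []|by []|reflexivity| cbn [fst snd] | cbn [fst snd]; move=> s ps]; simp_disp
 | eapply good_pair_center2; rewrite ?g1E ?g2E; [by []|by []|reflexivity| cbn [fst snd] | cbn [fst snd]; move=> s ps]; simp_disp
 | eapply good_pair_double; rewrite ?g1E ?g2E; [by []|by []|by []|by []|cbn [fst snd] |cbn [fst snd] | cbn [fst snd]; move=> b s cs | cbn [fst snd]; move=> b s cs]; simp_disp ].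

Lemma ueq0 k s : pts_spec k s -> c s = c 0 -> ueq s 0.
Proof. by rewrite rmorph0 => /pts_eq0 /[apply] ->. Qed.

Lemma ueq1 k s : pts_spec k s -> c s = c 1 -> ueq s 1.
Proof. by rewrite rmorph1 => /pts_eq1 /[apply] ->. Qed.

Lemma ueqk k s : (1 <= k < nv)%N -> pts_spec k s -> c s = c (x k) -> ueq s (x k).
Proof. by move=> kr ps e; rewrite (pts_eqk kr ps) // e c_size. Qed.

Lemma ueq_big k s a (b : Prop) : (1 <= k < nv)%N -> pts_spec k s -> ((d k).+1 < size (c a))%N ->
  c s = c a -> b.
Proof. by move=> kr ps big e; case: (pts_gt kr ps); rewrite e. Qed.

Lemma ueqN a b : ueq a b -> ueq (- a) (- b).
Proof. by move=> ab A c' /ab; rewrite !rmorphN => ->. Qed.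

Lemma cN_inj a b : c (- a) = c (- b) -> c a = c b.
Proof. by rewrite !rmorphN => /oppr_inj. Qed.

Lemma c1_neq0 : c 1 <> 0.
Proof. by rewrite rmorph1 => /eqP; rewrite oner_eq0. Qed.

Lemma size_c1B k : (1 <= k < nv)%N -> (0 < d k)%N -> size (c (1 - x k)) = (d k).+1.
Proof.
move=> kr dk; rewrite rmorphB rmorph1 addrC size_polyDl ?size_polyN ?c_size //.
by rewrite size_poly1.
Qed.

Lemma cx_neq_unit k : (1 <= k < nv)%N -> (0 < d k)%N ->
  [/\ c (x k) <> 0, c (x k) <> 1 & c (x k) <> -1].
Proof.
move=> kr dk; split.
- by move/eqP; rewrite c_nz.
- by move/eqP; rewrite c_n1.
- by move=> e; have := c_size kr; rewrite e size_polyN size_poly1; lia.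
Qed.

(** Without the plain perspectivity w_k - w_l, only a multiplying center w_k - x_k' w_l can remain.
    The other line of an addition is excluded because it has the degree of the sum. *)
Lemma centers_nuses k l b s : (1 <= k < nv)%N -> centers_spec k l b s -> ~~ uses (G k) l ->
  (d l < d k)%N -> exists k', [/\ (1 <= k' < nv)%N, (0 < d k')%N & b = - x k'].
Proof.
move=> kr; have km := nv_m (proj2 (andP kr)); have := config_gate ok km.
rewrite /gate_ok /centers_spec; case: (G k) => //= [k' l'|k'|k' l'|k' l'].
- case=> [_ k'r l'r _ e] [[-> _ _]|[_ -> _] _ _]; first by rewrite eqxx.
  by exists k'; split=> //; [lia | apply: (config_d ok); lia].
- by case=> _ _ _ [->]; rewrite eqxx.
- case=> [_ k'r l'r dd [e _]]; have := add_d kr (k := k') (l := l').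
  move=> /(_ _ _ dd e) D [[-> _ _]|[-> _ _]]; last by rewrite eqxx.
  by rewrite D; lia.
- by move=> _ [-> _ _]; rewrite eqxx.
Qed.

(** Besides multiplying centers there are now w_k - w_l and, if k is itself an addition with second
    summand l, the shifted center w_k - w_l + x_k' w_0. *)
Lemma centers_uses k l b s : (1 <= k < nv)%N -> centers_spec k l b s -> uses (G k) l ->
  (d l < d k)%N ->
  (exists k', [/\ (1 <= k' < nv)%N, (0 < d k')%N & b = - x k']) \/
  b = -1 /\ (s = 0 \/ exists k', [/\ (1 <= k' < nv)%N, d k' = d k, s = x k' &
                                     x k = x k' + x l]).
Proof.
move=> kr; have km := nv_m (proj2 (andP kr)); have := config_gate ok km.
rewrite /gate_ok /centers_spec; case: (G k) => //= [k' l'|k'|k' l'|k' l'].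
- case=> [_ k'r l'r _ e] [[_ -> ->]|[_ -> _] _ _]; first by right; split=> //; left.
  by left; exists k'; split=> //; [lia | apply: (config_d ok); lia].
- case=> _ k'r _ [_ [->|->] ->] _ _; first by right; split=> //; left.
  by left; exists k'; split=> //; [lia | apply: (config_d ok); lia].
- case=> [_ k'r l'r dd [e _]]; have := add_d kr (k := k') (l := l').
  move=> /(_ _ _ dd e) D [[-> -> ->]|[-> -> ss]] _ _; first by right; split=> //; left.
  right; split=> //; case: ss => ss; [by left | right; exists k'].
  by split; rewrite -?D //; lia.
- case=> [_ k'r l'r dd [e _]]; have := add_d kr (k := k') (l := l').
  move=> /(_ _ _ dd e) D [-> -> ss] _ _.
  right; split=> //; case: ss => ss; [by left | right; exists k'].
  by split; rewrite -?D //; lia.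
Qed.

Lemma centers_ratio k l b s : (1 <= k < nv)%N -> centers_spec k l b s ->
  [\/ b = -1 /\ s = 0, b = -1 /\ (exists k', [/\ (1 <= k' < nv)%N, (0 < d k')%N & s = x k'])
    | exists k', [/\ (1 <= k' < nv)%N, (0 < d k')%N, b = - x k' & (d k' < d k)%N]].
Proof.
move=> kr; have km := nv_m (proj2 (andP kr)); have := config_gate ok km.
rewrite /gate_ok /centers_spec; case: (G k) => //= [k' l'|k'|k' l'|k' l'].
- case=> [_ k'r l'r _ e] [[_ -> ->]|[_ -> _]]; first by constructor 1.
  have := mul_d kr (k := k') (l := l').
  move=> /(_ _ _ e) D; constructor 3; exists k'.
  have := config_d ok (g := k'); have := config_d ok (g := l').
  by split=> //; lia.
- case=> _ k'r e [_ [->|->] ->]; first by constructor 1.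
  have := mul_d kr (k := k') (l := k').
  move=> /(_ _ _ e) D; constructor 3; exists k'.
  have := config_d ok (g := k').
  by split=> //; lia.
- case=> [_ k'r l'r dd [e _]] [[_ -> ->]|[_ -> [->|->]]]; [by constructor 1..|].
  by constructor 2; split=> //; exists k'; split=> //; lia.
- case=> [_ k'r l'r dd [e _]] [_ -> [->|->]]; first by constructor 1.
  by constructor 2; split=> //; exists k'; split=> //; lia.
Qed.

Lemma centers_unit k l b s : (1 <= k < nv)%N -> centers_spec k l b s ->
  c (- b) = c 1 -> c s = 0 -> b = -1 /\ s = 0.
Proof.
move=> kr cs; case: (centers_ratio kr cs) => // [[-> [j [jr _ ->]]] _ /eqP|[j [jr jd ->]]].
  by rewrite c_nz.
by have [_ + _] := cx_neq_unit jr jd; rewrite opprK rmorph1.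
Qed.

Lemma ueq_mul0 k b s : (1 <= k < nv)%N -> pts_spec b s -> c (x k * s) = c 0 ->
  ueq (x k * s) 0.
Proof.
move=> kr ps; rewrite rmorphM rmorph0 => /eqP; rewrite mulf_eq0 (c_nz kr) => /eqP h.
by rewrite (pts_eq0 ps h) mulr0.
Qed.

Lemma c_mul_neq1 k s : (1 <= k < nv)%N -> (0 < d k)%N -> c (x k * s) <> c 1.
Proof.
move=> kr dk; rewrite rmorphM rmorph1 => /(congr1 (fun p : {poly K} => size p)).
have [->|s0] := eqVneq (c s) 0; first by rewrite mulr0 size_poly0 size_poly1.
rewrite size_mul ?(c_nz kr) // c_size // size_poly1.
by move: s0; rewrite -size_poly_gt0; move: (size _) => z /=; lia.
Qed.

Lemma c_mulI k s y : (1 <= k < nv)%N -> c (x k * s) = c (x k * y) -> c s = c y.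
Proof. by move=> kr; rewrite !rmorphM => /mulfI; apply; rewrite c_nz. Qed.

Ltac simpR := rewrite ?(subr0, sub0r, addr0, add0r, opprK, mul1r, mulr1,
  mulN1r, mulrN1, oppr0, subrr, addNr, mulNr, mulrN, mul0r, mulr0, opprB, addrK,
  addKr, addNKr).

Ltac simpR' := do 4 simpR.

(** * Three elements on one line *)

Lemma cramer3 (l1 l2 l3 a1 a2 a3 b1 b2 b3 : F) :
  l1 + l2 + l3 = 0 -> l1 * a1 + l2 * a2 + l3 * a3 = 0 ->
  l1 * b1 + l2 * b2 + l3 * b3 = 0 ->
  (a2 - a1) * (b3 - b1) - (a3 - a1) * (b2 - b1) != 0 -> [/\ l1 = 0, l2 = 0 & l3 = 0].
Proof.
move=> e1 ea eb D0; set D := (X in X != 0) in D0.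
have l2D : l2 * D = 0.
  have -> : l2 * D = (l1 * a1 + l2 * a2 + l3 * a3) * (b3 - b1)
     - (l1 * b1 + l2 * b2 + l3 * b3) * (a3 - a1)
     - (l1 + l2 + l3) * (a1 * (b3 - b1) - b1 * (a3 - a1)) by rewrite /D; ring.
  by rewrite e1 ea eb !mul0r !subr0.
have l3D : l3 * D = 0.
  have -> : l3 * D = (l1 * b1 + l2 * b2 + l3 * b3) * (a2 - a1)
     - (l1 * a1 + l2 * a2 + l3 * a3) * (b2 - b1)
     - (l1 + l2 + l3) * (b1 * (a2 - a1) - a1 * (b2 - b1)) by rewrite /D; ring.
  by rewrite e1 ea eb !mul0r !subr0.
move/eqP: l2D; rewrite mulf_eq0 (negPf D0) orbF => /eqP l20.
move/eqP: l3D; rewrite mulf_eq0 (negPf D0) orbF => /eqP l30.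
by move: e1; rewrite l20 l30 !addr0 => ->.
Qed.

Definition good_triple g (t1 t2 t3 : L * L * L) :=
  collinear (g, t1) (g, t2) (g, t3) \/ indep (g, t1) (g, t2) (g, t3).

(** The determinant with columns 1, a, b: all three elements have coefficient 1 at w_g, so one
    nonzero minor of this form proves independence. *)
Definition minor (a1 a2 a3 b1 b2 b3 : L) := (a2 - a1) * (b3 - b1) - (a3 - a1) * (b2 - b1).

Lemma cF_minor a1 a2 a3 b1 b2 b3 : c (minor a1 a2 a3 b1 b2 b3) <> 0 ->
  (cF a2 - cF a1) * (cF b3 - cF b1) - (cF a3 - cF a1) * (cF b2 - cF b1) != 0.
Proof.
move=> D; rewrite /cF -!rmorphB -!rmorphM -!rmorphB.
by rewrite -(rmorph0 emb) (inj_eq emb_inj); apply/eqP.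
Qed.

Lemma triple_eqs g t1 t2 t3 la mu nu : (0 < g < m)%N ->
  (0 < gline1 g)%N -> (0 < gline2 g)%N -> gline1 g <> gline2 g ->
  (forall w, la * phi w (g, t1) + mu * phi w (g, t2) + nu * phi w (g, t3) = 0) ->
  [/\ la + mu + nu = 0,
      la * cF t1.1.1 + mu * cF t2.1.1 + nu * cF t3.1.1 = 0,
      la * cF t1.1.2 + mu * cF t2.1.2 + nu * cF t3.1.2 = 0
    & la * cF t1.2 + mu * cF t2.2 + nu * cF t3.2 = 0].
Proof.
move=> gr k0 l0 kl H; have /andP[kg lg] := gline_lt gr.
have dk i j : i <> j -> delta i j = 0 by apply: delta_neq.
have D i := H (delta i).
split.
- move: (D g); rewrite /phi /= delta_id !dk ?mulr0 ?addr0 ?mulr1 //; lia.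
- by move: (D (gline1 g)); rewrite /phi /= delta_id !dk ?mulr0 ?addr0 ?add0r ?mulr1 //; lia.
- by move: (D (gline2 g)); rewrite /phi /= delta_id !dk ?mulr0 ?addr0 ?add0r ?mulr1 //; lia.
- by move: (D 0%N); rewrite /phi /= delta_id !dk ?mulr0 ?addr0 ?add0r ?mulr1 //; lia.
Qed.

Lemma good_triple_line g t1 t2 t3 : t1.1 = t2.1 -> t1.1 = t3.1 -> good_triple g t1 t2 t3.
Proof.
case: t1 t2 t3 => [ab1 s1] [ab2 s2] [ab3 s3] /= <- <-; left=> A c' ac w.
rewrite /vec /=; move: (_ + _ + c' ab1.2 *: _) (w 0%N) => u v.
by rewrite /det3 !mxE; ring.
Qed.

Lemma good_triple_line' g t1 t2 t3 : t1.1.2 = t2.1.2 -> t1.1.2 = t3.1.2 ->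
  t1.2 = t2.2 -> t1.2 = t3.2 -> good_triple g t1 t2 t3.
Proof.
case: t1 t2 t3 => [[a1 b1] s1] [[a2 b2] s2] [[a3 b3] s3] /= <- <- <- <-; left=> A c' ac w.
rewrite /vec /=; move: (w g) (w (gline1 g)) (c' b1 *: _) (c' s1 *: _) => u v p q.
by rewrite /det3 !mxE; ring.
Qed.

Lemma good_triple_rot g t1 t2 t3 : good_triple g t2 t3 t1 -> good_triple g t1 t2 t3.
Proof.
by case=> H; [left; do 2 apply: collinear_rot | right; do 2 apply: indep_rot].
Qed.

Lemma good_triple_swap g t1 t2 t3 : good_triple g t2 t1 t3 -> good_triple g t1 t2 t3.
Proof. by case=> H; [left; apply: collinear_swap | right; apply: indep_swap]. Qed.

Section Minors.
Variables (g : nat) (t1 t2 t3 : L * L * L).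
Hypothesis (gr : (0 < g < m)%N).
Hypotheses (k0 : (0 < gline1 g)%N) (l0 : (0 < gline2 g)%N).
Hypothesis (kl : gline1 g <> gline2 g).

Lemma good_triple_ab :
  c (minor t1.1.1 t2.1.1 t3.1.1 t1.1.2 t2.1.2 t3.1.2) <> 0 -> good_triple g t1 t2 t3.
Proof.
move/cF_minor => D; right=> la mu nu H.
by have [e1 ea eb _] := triple_eqs gr k0 l0 kl H; apply: cramer3 e1 ea eb D.
Qed.

Lemma good_triple_as :
  c (minor t1.1.1 t2.1.1 t3.1.1 t1.2 t2.2 t3.2) <> 0 -> good_triple g t1 t2 t3.
Proof.
move/cF_minor => D; right=> la mu nu H.
by have [e1 ea _ es] := triple_eqs gr k0 l0 kl H; apply: cramer3 e1 ea es D.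
Qed.

Lemma good_triple_bs :
  c (minor t1.1.2 t2.1.2 t3.1.2 t1.2 t2.2 t3.2) <> 0 -> good_triple g t1 t2 t3.
Proof.
move/cF_minor => D; right=> la mu nu H.
by have [e1 _ eb es] := triple_eqs gr k0 l0 kl H; apply: cramer3 e1 eb es D.
Qed.

End Minors.

(** * Verification of the gates, one kind at a time *)

Definition distinct_tails (t t' : L * L * L) :=
  [\/ c (t.1.1 - t'.1.1) <> 0, c (t.1.2 - t'.1.2) <> 0 | c (t.2 - t'.2) <> 0].

Ltac nz ff := solve [ simpR'; by
  rewrite ?(rmorphM, rmorphB, rmorphN, rmorphD, rmorph1, rmorph0);
  apply/eqP; rewrite ?(mulf_eq0, oppr_eq0, subr_eq0, addr_eq0, opprK, eqr_opp, oner_eq0) ?ff ].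

Ltac trip_minor L g1E g2E ff :=
  eapply L; rewrite ?g1E ?g2E; [by []|by []|by []|by []|unfold minor; cbn [fst snd]; nz ff].

Ltac trip1 g1E g2E ff := first
 [ trip_minor good_triple_ab g1E g2E ff | trip_minor good_triple_as g1E g2E ff
 | trip_minor good_triple_bs g1E g2E ff ].

Ltac trip g1E g2E ff := first
 [ solve [eapply good_triple_line; reflexivity]
 | solve [eapply good_triple_line'; reflexivity]
 | trip1 g1E g2E ff
 | eapply good_triple_rot; trip1 g1E g2E ff
 | do 2 eapply good_triple_rot; trip1 g1E g2E ff ].

Ltac dist ff := first
 [ constructor 1; cbn [fst snd]; nz ff | constructor 2; cbn [fst snd]; nz ff | constructor 3; cbn [fst snd]; nz ff ].

Definition gate_good g := [/\ forall_pairs distinct_tails (tails g),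
  forall_pairs (good_pair g) (tails g) & forall_triples (good_triple g) (tails g)].

Lemma c_n1' g : (1 <= g < nv)%N -> (0 < d g)%N -> (1 == c (x g)) = false.
Proof. by rewrite eq_sym; apply: c_n1. Qed.

Lemma c_neqb i j : c (x i) <> c (x j) -> (c (x i) == c (x j)) = false.
Proof. by move/eqP/negbTE. Qed.

Lemma c_neq_d i j : (1 <= i < nv)%N -> (1 <= j < nv)%N -> d i <> d j -> c (x i) <> c (x j).
Proof. by move=> ir jr dij /(c_eq_d ir jr). Qed.

Ltac line_facts g k l E :=
  assert (g1E : gline1 g = k) by (rewrite /gline1 E //);
  assert (g2E : gline2 g = l) by (rewrite /gline2 E //);
  assert (nvm := config_nv ok);
  assert (kr' : (1 <= k < nv)%N) by lia; assert (lr' : (1 <= l < nv)%N) by lia;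
  assert (gr' : (0 < g < m)%N) by lia; assert (k0 : (0 < k)%N) by lia;
  assert (l0 : (0 < l)%N) by lia.

Lemma gate_good_add g k l : (g < m)%N -> G g = GAdd k l -> gate_good g.
Proof.
move=> gm E; have := config_gate ok gm; rewrite /gate_ok E => -[gr kr lr dd [e nu]].
line_facts g k l E.
have gr2 : (1 <= g < nv)%N by lia.
have kl : k <> l by move=> z; rewrite z ltnn in dd.
have dg := add_d gr2 kr' lr' dd e.
have dk : (0 < d k)%N by lia.
have dg' : (0 < d g)%N by lia.
(* As gate k does not use line l, its centers over l have a ratio of positive degree, never 1 or -1.
   The opposite order is excluded by the degrees. *)
have bad_kl b s (Q : Prop) : centers_spec k l b s -> c b = c 1 \/ c b = c (-1) -> Q.
  move=> cs eb; have [k' [k'r k'd bE]] := centers_nuses kr' cs nu dd.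
  have [_ n1 n2] := cx_neq_unit k'r k'd; move: eb; rewrite bE !rmorphN rmorph1.
  by case=> [/eqP|/oppr_inj //]; rewrite eqr_oppLR => /eqP.
have bad_lk b s (Q : Prop) : centers_spec l k b s -> Q.
  by move/(centers_d lr'); lia.
have c1 := c1_neq0; have cm1 : c (-1) <> 0 by exact: cN1.
have szk := c_size kr'; have szg := c_size gr2.
pose ff := (c_n1' kr' dk, c_n1' gr2 dg', c_nz kr', c_nz gr2, c_n1 kr' dk, c_n1 gr2 dg').
rewrite /gate_good /tails E /=; split; [by do ![split]; dist ff | | by do ![split] => //; trip g1E g2E ff].
do ![split] => //; disp g1E g2E => //;
  try (exact: (bad_lk _ _ _ cs)); try (exact: ueq0 ps); try (exact: ueq1 ps).
- by move=> h _; apply: (bad_kl _ _ _ cs); left.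
- apply: (@ueq_big l s _ _ lr' ps); rewrite rmorphN size_polyN szk; lia.
- by move=> h _; apply: (bad_kl _ _ _ cs); left.
- apply: (@ueq_big l s _ _ lr' ps); rewrite size_c1B //; lia.
- have [big|sz] := ltnP (d k).+1 (size (c s)).
    by have := pts_gt kr' ps.
  move=> es; have := pts_eqk kr' ps; rewrite es szg dg => /(_ erefl) sk.
  move: es; rewrite sk e rmorphD => /eqP; rewrite eq_sym addrC -subr_eq0 addrK.
  by rewrite c_nz.
- apply: (@ueq_big l s _ _ lr' ps); rewrite szg; lia.
- by move=> h _; apply: (bad_kl _ _ _ cs); left.
- by rewrite e addrAC subrr add0r; apply: ueqk ps.
- by move=> h _; apply: (bad_kl _ _ _ cs); right; rewrite rmorphN -h -rmorphN opprK.
- by move=> h _; apply: (bad_kl _ _ _ cs); right; rewrite rmorphN -h -rmorphN opprK.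
- by move/cN_inj => h; apply/ueqN/(ueqk kr' ps).
Qed.

(** Here gate k contains w_k - w_l. Some displacements between points of gate g are multiples of it
    or of the shifted center, and these collinearities are shown to be universal. *)
Lemma gate_good_add' g k l : (g < m)%N -> G g = GAdd' k l -> gate_good g.
Proof.
move=> gm E; have := config_gate ok gm; rewrite /gate_ok E => -[gr kr lr dd [e us]].
line_facts g k l E.
have gr2 : (1 <= g < nv)%N by lia.
have kl : k <> l by move=> z; rewrite z ltnn in dd.
have dg := add_d gr2 kr' lr' dd e.
have dk : (0 < d k)%N by lia.
have dg' : (0 < d g)%N by lia.
have bad_lk b s (Q : Prop) : centers_spec l k b s -> Q.
  by move/(centers_d lr'); lia.
have [xk0 xk1 xkN1] := cx_neq_unit kr' (leq_ltn_trans (leq0n _) dd).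
have dg0 : (0 < d g)%N by lia.
have [xg0 xg1 xgN1] := cx_neq_unit gr2 dg0.
have xl0 : c (x l) <> 0 by move/eqP; rewrite c_nz.
have tail b s : centers_spec k l b s -> c (- b) = c 1 -> b = -1 /\
   (s = 0 \/ exists k', [/\ (1 <= k' < nv)%N, d k' = d k, s = x k' & x k = x k' + x l]).
  move=> cs; case: (centers_uses kr' cs us dd) => // -[k' [k'r k'd ->]].
  by have [_ + _] := cx_neq_unit k'r k'd; rewrite opprK rmorph1.
have c1 := c1_neq0; have cm1 : c (-1) <> 0 by exact: cN1.
have c0 := rmorph0 c.
have szk := c_size kr'; have szg := c_size gr2.
pose ff := (c_n1' kr' dk, c_n1' gr2 dg', c_nz kr', c_nz gr2, c_n1 kr' dk, c_n1 gr2 dg').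
rewrite /gate_good /tails E /=; split; [by do ![split]; dist ff | | by do ![split] => //; trip g1E g2E ff].
do ![split] => //; disp g1E g2E => //;
  try (exact: (bad_lk _ _ _ cs)); try (exact: ueq0 ps); try (exact: ueq1 ps).
- by apply: (@ueq_big l s _ _ lr' ps); rewrite rmorphN size_polyN szk; lia.
- move=> /(tail _ _ cs) [-> [->|[k' [k'r k'd -> ek]]]] /cN_inj.
    by rewrite c0 => /esym.
  have dk' : (0 < d k')%N by lia.
  by rewrite rmorph1; have [] := cx_neq_unit k'r dk'.
- move=> /(tail _ _ cs) [-> [->|[k' [k'r k'd -> ek]]]] /cN_inj.
    by rewrite c0 => /esym.
  rewrite ek rmorphD => /eqP; rewrite eq_sym addrC -subr_eq0 addrK.
  by rewrite c_nz.
- by apply: (@ueq_big l s _ _ lr' ps); rewrite size_c1B //; lia.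
- move=> /(tail _ _ cs) [-> [->|[k' [k'r k'd -> ek]]]].
    by move=> _; split; apply: ueq_refl; rewrite ?opprK ?oppr0.
  rewrite -{1}oppr0 => /cN_inj.
  have dk' : (0 < d k')%N by lia.
  by rewrite c0; have [] := cx_neq_unit k'r dk'.
- move=> /(tail _ _ cs) [-> [->|[k' [k'r k'd -> ek]]]].
    by rewrite oppr0 c0 rmorphB rmorph1 => /esym/eqP; rewrite subr_eq0 => /eqP /esym.
  (* For l = 1 the collinearity is genuine, since 1 - x_k = - x_k'. Otherwise it would force x_l =
     1, against its positive degree. *)
  have [dl|l1] := dpos lr'; last first.
    move=> _; rewrite ek l1 (config_x1 ok).
    by split; apply: ueq_refl; ring.
  have [_ xl1 _] := cx_neq_unit lr' dl; move=> h; case: xl1.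
  have -> : 1 = c (1 - x k) + c (x k) by rewrite -rmorphD subrK rmorph1.
  by rewrite -h ek -rmorphD; congr (c _); ring.
- by apply: (@ueq_big l s _ _ lr' ps); rewrite szg; lia.
- by rewrite e addrAC subrr add0r; apply: ueqk ps.
- move=> /(tail _ _ cs) [-> [->|[k' [k'r k'd -> ek]]]].
    by rewrite oppr0 c0 rmorphB rmorph1 => /esym/eqP; rewrite subr_eq0 => /eqP.
  (* The relation x_g + x_k' = 1 amounts to 2 x_k = 1, because x_g = x_k + x_l and x_k = x_k' +
     x_l. *)
  move=> h; case: (twice_neq1 kr' (leq_ltn_trans (leq0n _) dd)).
  have -> : 1 = c (x g) - c (x g - 1) by rewrite rmorphB rmorph1; ring.
  by rewrite -h e {2}ek rmorphN !rmorphD; ring.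
- rewrite e addrAC subrr add0r.
  move=> /(tail _ _ cs) [-> [->|[k' [k'r k'd -> ek]]]].
    by rewrite oppr0 c0 => /esym.
  move/(congr1 (fun p : {poly K} => size p)).
  by rewrite rmorphN size_polyN !c_size // k'd; lia.
- by move/cN_inj => h; apply/ueqN/(ueq1 ps).
- by move/cN_inj => h; apply/ueqN/(ueqk kr' ps).
- move=> h; have sk := pts_eqk kr' ps.
  case: (twice_neq1 kr' (leq_ltn_trans (leq0n _) dd)).
  have es : c s = c (1 - x k) by apply: cN_inj; rewrite h opprB.
  move: (es); rewrite {1}sk; last by rewrite es size_c1B.
  by move=> {1}->; rewrite rmorphB rmorph1; ring.
- by rewrite -{1}oppr0 => /cN_inj h; rewrite -[X in ueq _ X]oppr0; apply/ueqN/(ueq0 ps).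
Qed.

Lemma gate_good_mul g k l : (g < m)%N -> G g = GMul k l -> gate_good g.
Proof.
move=> gm E; have := config_gate ok gm; rewrite /gate_ok E => -[gr kr lr kl e].
line_facts g k l E.
have gr2 : (1 <= g < nv)%N by lia.
have dg := mul_d gr2 kr' lr' e.
have dk : (0 < d k)%N by apply: (config_d ok); lia.
have dl : (0 < d l)%N by apply: (config_d ok); lia.
have dg' : (0 < d g)%N by lia.
have [xk0 xk1 xkN1] := cx_neq_unit kr' dk.
have mulk0 b s ps := @ueq_mul0 k b s kr' ps; have mulk1 s := @c_mul_neq1 k s kr' dk.
have mulkx s y := @c_mulI k s y kr'.
have c1 := c1_neq0; have cm1 : c (-1) <> 0 by exact: cN1.
have szk := c_size kr'; have szg := c_size gr2.
have kg : c (x k) <> c (x g) by apply: c_neq_d => //; lia.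
have gk : c (x g) <> c (x k) by apply: c_neq_d => //; lia.
pose ff := (c_n1' kr' dk, c_n1' gr2 dg', c_nz kr', c_nz gr2, c_n1 kr' dk, c_n1 gr2 dg',
  c_neqb kg, c_neqb gk).
rewrite /gate_good /tails E /=; split; [by do ![split]; dist ff | | by do ![split] => //; trip g1E g2E ff].
do ![split] => //; disp g1E g2E => //;
   try (exact: ueq0 ps); try (exact: ueq1 ps).
- exact: mulk0 ps.
- by move/mulk1.
- exact: ueqk ps.
- rewrite -{2}[x k]mulr1 => /mulkx /(ueq1 ps) h A c' ac.
  by rewrite rmorphM (h _ _ ac) rmorph1 mulr1.
- by apply: (@ueq_big k s _ _ kr' ps); rewrite szg; lia.
- rewrite e => /mulkx h A c' ac.
  by rewrite !rmorphM (ueqk lr' ps h ac).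
- rewrite rmorphN; case: (centers_ratio kr' cs) => [[-> _]|[-> _]|[k' [k'r _ -> k'd]]].
  + by rewrite rmorphN rmorph1 opprK => /esym.
  + by rewrite rmorphN rmorph1 opprK => /esym.
  rewrite rmorphN opprK => /(congr1 (fun p : {poly K} => size p)).
  by rewrite !c_size //; lia.
- rewrite rmorphM; case: (centers_ratio lr' cs) => [[-> _]|[-> _]|[k' [k'r k'd -> _]]].
  + by rewrite !rmorphN rmorph1 [c _ * -1]mulrN1 => /oppr_inj.
  + by rewrite !rmorphN rmorph1 [c _ * -1]mulrN1 => /oppr_inj.
  rewrite !rmorphN rmorph1 [c _ * - _]mulrN => /oppr_inj /(congr1 (fun p : {poly K} => size p)).
  by rewrite size_mul ?c_nz // !c_size // size_poly1; lia.
Qed.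

Lemma gate_good_sqr g k : (g < m)%N -> G g = GSqr k -> gate_good g.
Proof.
move=> gm E; have := config_gate ok gm; rewrite /gate_ok E => -[gr kr e].
line_facts g k 1%N E.
have gr2 : (1 <= g < nv)%N by lia.
have dg := mul_d gr2 kr' kr' e.
have dk : (0 < d k)%N by apply: (config_d ok); lia.
have dg' : (0 < d g)%N by lia.
have k1 : k <> 1%N by lia.
have [xk0 xk1 xkN1] := cx_neq_unit kr' dk.
have mulk0 b s ps := @ueq_mul0 k b s kr' ps; have mulk1 s := @c_mul_neq1 k s kr' dk.
have mulkx s y := @c_mulI k s y kr'.
have c1 := c1_neq0; have cm1 : c (-1) <> 0 by exact: cN1.
have szk := c_size kr'; have szg := c_size gr2.
have kg : c (x k) <> c (x g) by apply: c_neq_d => //; lia.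
have gk : c (x g) <> c (x k) by apply: c_neq_d => //; lia.
pose ff := (c_n1' kr' dk, c_n1' gr2 dg', c_nz kr', c_nz gr2, c_n1 kr' dk, c_n1 gr2 dg',
  c_neqb kg, c_neqb gk).
rewrite /gate_good /tails E /=; split; [by do ![split]; dist ff | | by do ![split] => //; trip g1E g2E ff].
do ![split] => //; disp g1E g2E => //;
   try (exact: ueq0 ps); try (exact: ueq1 ps).
- exact: mulk0 ps.
- by move/mulk1.
- exact: ueqk ps.
- rewrite -{2}[x k]mulr1 => /mulkx /(ueq1 ps) h A c' ac.
  by rewrite rmorphM (h _ _ ac) rmorph1 mulr1.
- by apply: (@ueq_big k s _ _ kr' ps); rewrite szg; lia.
- rewrite e => /mulkx h A c' ac.
  by rewrite !rmorphM (ueqk kr' ps h ac).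
- by rewrite rmorphD rmorphN rmorph1 addrC => /eqP; rewrite subr_eq0 => /eqP.
- rewrite rmorphM rmorph0 => /eqP; rewrite mulf_eq0 => /orP[|/eqP h].
    by rewrite rmorphD rmorphN rmorph1 addrC subr_eq0 => /eqP.
  by rewrite (pts_eq0 ps h) mulr0; apply: ueq_refl.
Qed.

Lemma gate_good_eq g k l : (g < m)%N -> G g = GEq k l -> gate_good g.
Proof.
move=> gm E; have := config_gate ok gm; rewrite /gate_ok E => -[gr kr lr kl].
line_facts g k l E.
have dk : (0 < d k)%N by apply: (config_d ok); lia.
have c1 := c1_neq0; have cm1 : c (-1) <> 0 by exact: cN1.
pose ff := (c_n1' kr' dk, c_nz kr', c_n1 kr' dk).
rewrite /gate_good /tails E /=; split; [by do ![split]; dist ff | | by do ![split] => //; trip g1E g2E ff].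
do ![split] => //; disp g1E g2E => //;
   try (exact: ueq0 ps); try (exact: ueq1 ps).
- exact: ueqk ps.
- move=> h A c' ac; have [l1|kl'] := ac _ _ _ gm E.
    have := pts_size lr' ps; rewrite h c_size // l1 (config_d1 ok).
    by lia.
  have [l1|ckl] := c_adm gm E.
    have := pts_size lr' ps; rewrite h c_size // l1 (config_d1 ok).
    by lia.
  by rewrite kl' (ueqk lr' ps _ ac) // h.
- move=> hb; rewrite rmorphN rmorph0 => /eqP; rewrite oppr_eq0 => /eqP hs.
  have [-> ->] := centers_unit kr' cs hb hs.
  by split; apply: ueq_refl; rewrite ?opprK ?oppr0.
- rewrite rmorph0 => hb hs; have {}hb : c (- b) = c 1 by rewrite rmorphN hb -rmorphN opprK.
  have [-> ->] := centers_unit lr' cs hb hs.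
  by split; apply: ueq_refl.
Qed.

Lemma gate_good_neq g k l : (g < m)%N -> G g = GNeq k l -> gate_good g.
Proof.
move=> gm E; have := config_gate ok gm; rewrite /gate_ok E => -[gr kr lr kl dd].
line_facts g k l E.
have dk : (0 < d k)%N by apply: (config_d ok); lia.
have dl : (0 < d l)%N by apply: (config_d ok); lia.
have c1 := c1_neq0; have cm1 : c (-1) <> 0 by exact: cN1.
have kg := c_neq gm E.
have gk : c (x l) <> c (x k) by move/esym.
pose ff := (c_n1' kr' dk, c_n1' lr' dl, c_nz kr', c_nz lr', c_n1 kr' dk, c_n1 lr' dl,
  c_neqb kg, c_neqb gk).
rewrite /gate_good /tails E /=; split; [by do ![split]; dist ff | | by do ![split] => //; trip g1E g2E ff].
do ![split] => //; disp g1E g2E => //;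
   try (exact: ueq0 ps); try (exact: ueq1 ps).
- exact: ueqk ps.
- move=> h; have sl := pts_eqk lr' ps.
  by case: (kg); rewrite -h sl // h c_size // dd.
- move=> h; have sk := pts_eqk kr' ps.
  by case: (kg); rewrite -h sk // h c_size // dd.
- exact: ueqk ps.
- move=> hb; rewrite rmorphN rmorph0 => /eqP; rewrite oppr_eq0 => /eqP hs.
  have [-> ->] := centers_unit kr' cs hb hs.
  by split; apply: ueq_refl; rewrite ?opprK ?oppr0.
- rewrite rmorph0 => hb hs; have {}hb : c (- b) = c 1 by rewrite rmorphN hb -rmorphN opprK.
  have [-> ->] := centers_unit lr' cs hb hs.
  by split; apply: ueq_refl.
Qed.

Lemma gate_good_var g : (g < m)%N -> (forall t, t \in tails g -> t.1 = (0, 0)) ->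
  forall_pairs distinct_tails (tails g) -> gate_good g.
Proof.
move=> gm t0 D; split=> //.
- move: t0; elim: (tails g) => //= t s IHs t0; split; last first.
    by apply: IHs => u us; apply: t0; rewrite inE us orbT.
  have {}t0 u : u \in s -> t.1 = u.1.
    by move=> us; rewrite !t0 // inE ?eqxx // us orbT.
  elim: s t0 {IHs} => //= u s IHs t0; split.
    by apply: good_pair_point; apply: t0; rewrite inE eqxx.
  by apply: IHs => v vs; apply: t0; rewrite inE vs orbT.
- have P t u v : t.1 = (0, 0) -> u.1 = (0, 0) -> v.1 = (0, 0) -> good_triple g t u v.
    by move=> t1 u1 v1; apply: good_triple_line; rewrite t1.
  have Q t s : t.1 = (0, 0) -> (forall u, u \in s -> u.1 = (0, 0)) ->
      forall_pairs (good_triple g t) s.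
    move=> tE; elim: s => //= u s IHs s0; split; last first.
      by apply: IHs => v vs; apply: s0; rewrite inE vs orbT.
    have uE : u.1 = (0, 0) by apply: s0; rewrite inE eqxx.
    have {}s0 v : v \in s -> v.1 = (0, 0) by move=> vs; apply: s0; rewrite inE vs orbT.
    elim: s s0 {IHs} => //= v s IHs s0; split.
      by apply: P => //; apply: s0; rewrite inE eqxx.
    by apply: IHs => z zs; apply: s0; rewrite inE zs orbT.
  move: t0; elim: (tails g) => //= t s IHs t0; split.
    by apply: Q => [|u us]; apply: t0; rewrite inE ?eqxx // us orbT.
  by apply: IHs => u us; apply: t0; rewrite inE us orbT.
Qed.

Lemma gate_goodP g : (g < m)%N -> gate_good g.
Proof.
move=> gm; have := config_gate ok gm; rewrite /gate_ok; case E: (G g) => //.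
- move=> _; apply: gate_good_var => //; rewrite /tails E; last by [].
  by move=> t; rewrite inE => /eqP ->.
- move=> _; apply: gate_good_var => //; rewrite /tails E.
    by move=> t; rewrite !inE => /orP[] /eqP ->.
  by split=> //; split=> //; constructor 3; rewrite /= sub0r rmorphN rmorph1; apply/eqP; rewrite oppr_eq0 oner_eq0.
- move=> gr; have gr2 : (1 <= g < nv)%N by lia.
  have dg : (0 < d g)%N by apply: (config_d ok).
  pose ff := (c_n1' gr2 dg, c_nz gr2, c_n1 gr2 dg).
  apply: gate_good_var => //; rewrite /tails E.
    by move=> t; rewrite !inE => /or3P[] /eqP ->.
  by rewrite /=; do ![split] => //; dist ff.
- by move=> _; eapply gate_good_mul; eassumption.
- by move=> _; eapply gate_good_sqr; eassumption.
- by move=> _; eapply gate_good_add; eassumption.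
- by move=> _; eapply gate_good_add'; eassumption.
- by move=> _; eapply gate_good_eq; eassumption.
- by move=> _; eapply gate_good_neq; eassumption.
Qed.

(** * The dichotomy between universal collinearity and independence *)

Lemma phi_neq0 e : is_elt e -> exists w, phi w e != 0.
Proof.
move=> ee; have [e0|e0] := posnP e.1.
  exists (delta 0); rewrite (elt_gt0 ee e0) /phi /= !(cF0) !mul0r !addr0 delta_id.
  exact: oner_neq0.
by exists (delta e.1); rewrite (phi_delta_top) // oner_neq0.
Qed.

Lemma dform_neq0 g t t' : (g < m)%N -> t \in tails g -> t' \in tails g -> t <> t' ->
  exists w, dform (gline1 g) (gline2 g) (cF t.1.1 - cF t'.1.1)
      (cF t.1.2 - cF t'.1.2) (cF t.2 - cF t'.2) w != 0.
Proof.
move=> gm tg tg' tt'.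
have g0 : (0 < g)%N.
  rewrite lt0n; apply/eqP => z; move: tg tg'; rewrite z /tails (config_gate0 ok).
  by rewrite !inE => /eqP tE /eqP tE'; case: tt'; rewrite tE tE'.
have gr : (0 < g < m)%N by rewrite g0.
have /andP[kg lg] := gline_lt gr.
have [D _ _] := gate_goodP gm.
have sym a b : distinct_tails a b -> distinct_tails b a.
  have N u v : c (u - v) <> 0 -> c (v - u) <> 0.
    by rewrite -(opprB u v) rmorphN => h /eqP; rewrite oppr_eq0 => /eqP.
  by case=> h; [constructor 1 | constructor 2 | constructor 3]; apply: N.
have {D} := forall_pairsP sym D tg tg' tt'.
have nz u v : c (u - v) <> 0 -> cF u - cF v != 0.
  by rewrite /cF -!rmorphB -(rmorph0 emb) (inj_eq emb_inj) => /eqP.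
have dk i j : i <> j -> delta i j = 0 by apply: delta_neq.
have [T0|[k0 l0 kl]] := gline_spec gr.
  case=> /nz h; [by move: h; rewrite (T0 t) // (T0 t') // subrr eqxx..|].
  exists (delta 0); rewrite /dform (T0 t) // (T0 t') // !subrr !mul0r !add0r.
  by rewrite delta_id mulr1.
case=> /nz h.
- exists (delta (gline1 g)); rewrite /dform delta_id !dk; try lia.
  by rewrite !mulr0 !addr0 mulr1.
- exists (delta (gline2 g)); rewrite /dform delta_id !dk; try lia.
  by rewrite !mulr0 !addr0 add0r mulr1.
- exists (delta 0); rewrite /dform delta_id !dk; try lia.
  by rewrite !mulr0 !add0r mulr1.
Qed.

Lemma pair_indep p q mu nu : is_elt p -> is_elt q -> p <> q ->
  (forall w, mu * phi w p + nu * phi w q = 0) -> mu = 0 /\ nu = 0.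
Proof.
wlog: p q mu nu / (q.1 <= p.1)%N => [W|qp] pe qe pq H.
  have [/W|/ltnW/W] := leqP q.1 p.1; first exact.
  move=> /(_ nu mu qe pe (nesym pq)); case=> [w|-> -> //].
  by rewrite addrC.
have nu_case : mu = 0 -> nu = 0.
  move=> m0; have [w w0] := phi_neq0 qe; have := H w; rewrite m0 mul0r add0r => /eqP.
  by rewrite mulf_eq0 (negPf w0) orbF => /eqP.
suff m0 : mu = 0 by split=> //; apply: nu_case.
have [p0|p0] := posnP p.1.
  case: pq; rewrite (elt_gt0 pe p0) (elt_gt0 qe) //; lia.
have := H (delta p.1); rewrite (phi_delta_top) // mulr1.
move: qp; rewrite leq_eqVlt => /orP[/eqP qp|qp]; last first.
  by rewrite (phi_delta_gt) // mulr0 addr0.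
case: p q pe qe qp pq H p0 {nu_case} => [g t] [g' t'] [/= gm tg] [/= _ tg'] e.
rewrite e in tg' *; move=> tt' H g0.
rewrite (_ : delta g = delta (g, t').1) // (phi_delta_top) // mulr1 => /eqP.
rewrite addr_eq0 => /eqP mn; have {}mn : nu = - mu by rewrite mn opprK.
have tt : t <> t' by move=> z; apply: tt'; rewrite z.
have [w w0] := dform_neq0 gm tg tg' tt.
have : mu * dform (gline1 g) (gline2 g) (cF t.1.1 - cF t'.1.1)
      (cF t.1.2 - cF t'.1.2) (cF t.2 - cF t'.2) w = 0.
  by rewrite -[RHS](H w) mn /phi /dform /=; ring.
by move/eqP; rewrite mulf_eq0 (negPf w0) orbF => /eqP.
Qed.

Lemma indep_top p q r : is_elt p -> is_elt q -> is_elt r -> q <> r ->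
  (q.1 < p.1)%N -> (r.1 < p.1)%N -> indep p q r.
Proof.
move=> pe qe re qr qp rp la mu nu H.
have la0 : la = 0.
  have := H (delta p.1); rewrite (phi_delta_top) //; last lia.
  by rewrite !(phi_delta_gt) // !mulr0 !addr0 mulr1.
have [|-> ->] := pair_indep qe re qr (mu := mu) (nu := nu); last by split.
by move=> w; rewrite -[RHS](H w) la0 mul0r add0r.
Qed.

(** The number of elements on the latest line decides: for one, the coefficient of w_g; for two,
    [good_pair]; for three, [good_triple]. *)
Lemma dichotomy_sorted p q r : is_elt p -> is_elt q -> is_elt r ->
  p <> q -> p <> r -> q <> r -> (r.1 <= q.1 <= p.1)%N ->
  collinear p q r \/ indep p q r.
Proof.
move=> pe qe re pq pr qr /andP[rq qp].
have [pq1|pq1] := ltnP q.1 p.1; first by right; apply: indep_top => //; lia.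
have {pq1 qp}qp : q.1 = p.1 by lia.
have [rp|rp] := ltnP r.1 p.1; last first.
  have rp' : r.1 = p.1 by lia.
  case: p q r pe qe re qp rp' pq pr qr {rq rp}
    => [g t] [g' t'] [g'' t''] [/= gm tg] [/= _ tg'] [/= _ tg''] e e'.
  rewrite e in tg' *; rewrite e' in tg'' * => tt tt' tt''.
  have [_ _ T] := gate_goodP gm.
  have sw a b o : good_triple g a b o -> good_triple g b a o by exact: good_triple_swap.
  have ro a b o : good_triple g a b o -> good_triple g b o a.
    by move=> h; apply good_triple_rot, good_triple_rot, h.
  apply: (forall_triplesP sw ro T tg tg' tg'') => z.
  - by apply: tt; rewrite z.
  - by apply: tt'; rewrite z.
  - by apply: tt''; rewrite z.
have [I|nI] := excluded_middle_informative (indep p q r); first by right.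
left; apply: Classical_Prop.NNPP => nC; apply: nI => la mu nu H.
case: p q pe qe qp pq pr qr nC H rp {rq}
    => [g t] [g' t'] [/= gm tg] [/= _ tg'] e.
rewrite e in tg' *; move=> tt pr qr nC H rg.
have ttt : t <> t' by move=> z; apply: tt; rewrite z.
have [mn H'] := rel_diff (conj gm tg : is_elt (g, t)) (conj gm tg' : is_elt (g, t')) re rg H.
have nu_case : la = 0 -> [/\ la = 0, mu = 0 & nu = 0].
  move=> l0; have [w w0] := phi_neq0 re; have := H' w; rewrite l0 mul0r add0r => /eqP.
  rewrite mulf_eq0 (negPf w0) orbF => /eqP n0; split=> //.
  by rewrite mn l0 oppr0.
have [l0|la0] := eqVneq la 0; first exact: nu_case.
have [nu0|nu0] := eqVneq nu 0.
  apply: nu_case; have [w w0] := dform_neq0 gm tg tg' ttt.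
  by move: (H' w) => /eqP; rewrite nu0 mul0r addr0 mulf_eq0 (negPf w0) orbF => /eqP.
have [_ P _] := gate_goodP gm; case: nC.
have sym a b : good_pair g a b -> good_pair g b a by apply: good_pair_sym.
exact: (forall_pairsP sym P tg tg' ttt r la nu).
Qed.

Lemma dichotomy p q r : is_elt p -> is_elt q -> is_elt r ->
  collinear p q r \/ indep p q r.
Proof.
move=> pe qe re.
have [<-|/eqP pq] := eqVneq p q; first by left; apply: collinear_xx.
have [<-|/eqP pr] := eqVneq p r.
  by left; apply: collinear_rot; apply: collinear_xx.
have [<-|/eqP qr] := eqVneq q r; first by left; do 2 apply: collinear_rot; apply: collinear_xx.
have sw a b o : (collinear a b o \/ indep a b o) -> collinear b a o \/ indep b a o.
  by case=> h; [left; apply: collinear_swap | right; apply: indep_swap].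
have ro a b o : (collinear a b o \/ indep a b o) -> collinear b o a \/ indep b o a.
  by case=> h; [left; apply: collinear_rot | right; apply: indep_rot].
have S a b o : is_elt a -> is_elt b -> is_elt o -> a <> b -> a <> o -> b <> o ->
  (o.1 <= b.1 <= a.1)%N -> collinear a b o \/ indep a b o by apply: dichotomy_sorted.
have [h1|h1] := leqP q.1 p.1; have [h2|h2] := leqP r.1 q.1; have [h3|h3] := leqP r.1 p.1; try lia.
- by apply: S => //; lia.
- by apply/ro/sw/S => //; [exact/nesym | lia].
- by apply/ro/S => //; [exact/nesym| exact/nesym | lia].
- by apply/sw/S => //; [exact/nesym | lia].
- by apply/ro/ro/S => //; [exact/nesym|exact/nesym| lia].
- by apply/sw/ro/S => //; [exact/nesym| exact/nesym| exact/nesym|lia].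
Qed.

(** * Generic vectors realize exactly the universal collinearities *)

Lemma sum_delta (w : nat -> 'rV[F]_3) i : (i < m)%N ->
  \sum_(j < m) delta j i *: w j = w i.
Proof.
move=> im; rewrite (bigD1 (Ordinal im)) //= delta_id scale1r big1 ?addr0 // => j ji.
rewrite delta_neq ?scale0r // => ij; case/eqP: ji; exact: val_inj.
Qed.

Lemma vecE (w : nat -> 'rV[F]_3) e : is_elt e ->
  vec cF w e = \sum_(j < m) phi (delta j) e *: w j.
Proof.
case: e => g t [/= gm _]; have [k l] : (gline1 g < m)%N /\ (gline2 g < m)%N.
  have [->|g0] := posnP g; first by rewrite !gline0; lia.
  by have := gline_lt (g := g); rewrite g0 gm => /(_ isT); lia.
rewrite /vec /= -{1}(sum_delta w gm) -{1}(sum_delta w k) -{1}(sum_delta w l).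
rewrite -(sum_delta w (leq_ltn_trans (leq0n g) gm)) !scaler_sumr -!big_split /=.
by apply: eq_bigr => j _; rewrite /phi /= !scalerDl !scalerA.
Qed.

(** The 3 x m matrix of coefficients has full row rank; the rows of a right inverse, taken as the
    vectors w_j, send the three elements to the standard basis. *)
Lemma indep_witness p q r : is_elt p -> is_elt q -> is_elt r -> indep p q r ->
  exists w : nat -> 'rV[F]_3, det3 (vec cF w p) (vec cF w q) (vec cF w r) != 0.
Proof.
move=> pe qe re I.
pose e (i : 'I_3) := if i == i0 then p else if i == i1 then q else r.
have ee i : is_elt (e i) by rewrite /e; case: ifP => _ //; case: ifP.
pose C := \matrix_(i < 3, j < m) phi (delta j) (e i).
have phiE w y : is_elt y -> phi w y = \sum_(j < m) phi (delta j) y * w j.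
  move=> ye; have := vecE (fun i => const_mx (w i)) ye => /rowP /(_ 0).
  rewrite summxE /vec !mxE => H; rewrite /phi H.
  by apply: eq_bigr => j _; rewrite !mxE.
have Cfree : row_free C.
  apply: inj_row_free => v vC.
  have [|v0 v1 v2] := I (v 0 i0) (v 0 i1) (v 0 i2).
    move=> w; have -> : 0 = (v *m C *m (\col_(j < m) w j)) 0 0 by rewrite vC mul0mx mxE.
    rewrite -mulmxA mxE sum_I3.
    have E i : (C *m (\col_(j < m) w j)) i 0 = phi w (e i).
      by rewrite phiE // mxE; apply: eq_bigr => j _; rewrite !mxE.
    by rewrite !E.
  by apply: eq_rV3; rewrite mxE.
have /row_freeP [B CB] := Cfree.
pose w (i : nat) := oapp (fun j => row j B) 0 (insub i : option 'I_m).
have wE i : vec cF w (e i) = row i (1%:M : 'M[F]_3).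
  rewrite vecE // -CB row_mul; apply/rowP => k; rewrite !mxE summxE.
  by apply: eq_bigr => j _; rewrite /w valK /= !mxE.
exists w; have := wE i0; have := wE i1; have := wE i2; rewrite /e /= => -> -> ->.
by rewrite -det_mx33 det1 oner_neq0.
Qed.

Lemma is_elt_basis : [/\ is_elt (0%N, (0, 0, 0)), is_elt (1%N, (0, 0, 0))
  & is_elt (2%N, (0, 0, 0))].
Proof.
have := config_nv ok; rewrite /is_elt /tails (config_gate0 ok) (config_gate1 ok).
by rewrite (config_gate2 ok) /= !inE !eqxx; split; split=> //; lia.
Qed.

Lemma basis_indep : indep (2%N, (0, 0, 0)) (1%N, (0, 0, 0)) (0%N, (0, 0, 0)).
Proof.
have [e0 e1 e2] := is_elt_basis.
by eapply indep_top; eauto.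
Qed.

Lemma indep_noncollinear p q r : is_elt p -> is_elt q -> is_elt r ->
  indep p q r -> ~ collinear p q r.
Proof.
move=> pe qe re I C; have [w] := indep_witness pe qe re I.
rewrite (C F (emb \o c : {rmorphism L -> F}) _ w) ?eqxx // => g k l gm E.
by have [|e] := c_adm gm E; [left | right; rewrite /= e].
Qed.

Lemma noncollinear_top p q r : is_elt p -> is_elt q -> is_elt r -> q <> r ->
  (q.1 < p.1)%N -> (r.1 < p.1)%N -> ~ collinear p q r.
Proof.
move=> pe qe re qr qp rp; apply: indep_noncollinear => //.
by eapply indep_top; eauto.
Qed.

Lemma noncollinear_neq g k l : (g < m)%N -> G g = GNeq k l ->
  ~ collinear (g, (0, 0, x k)) (g, (0, 0, x l)) (k, (0, 0, 0)).
Proof.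
move=> gm E; have := config_gate ok gm; rewrite /gate_ok E => -[nvg kn ln kl _].
have := config_nv ok => nvm.
have ee s : s = x k \/ s = x l -> is_elt (g, (0, 0, s)).
  by move=> sE; split=> //; rewrite /tails E !inE; case: sE => ->; rewrite eqxx ?orbT.
have ke : is_elt (k, (0, 0, 0)).
  by split=> /=; [lia | rewrite /tails; case: (G k) => *; rewrite !inE eqxx].
apply: indep_noncollinear => //; [by apply: ee; left | by apply: ee; right | ].
move=> la mu nu H.
have kg : (k < g)%N by lia.
have e1 : is_elt (g, (0, 0, x k)) by apply: ee; left.
have e2 : is_elt (g, (0, 0, x l)) by apply: ee; right.
have [mE H'] := rel_diff e1 e2 ke kg H.
have k0 : (0 < k)%N by lia.
have n0 : nu = 0.
  have := H' (delta k); rewrite (phi_delta_top ke k0) /dform /= !subrr !mul0r !add0r.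
  by rewrite delta_neq ?mulr0 ?add0r ?mulr1 //; lia.
have l0 : la = 0.
  have := H' (delta 0); rewrite n0 mul0r addr0 /dform /= !subrr !mul0r !add0r delta_id mulr1.
  move/eqP; rewrite mulf_eq0 subr_eq0 => /orP[/eqP //|/eqP /emb_inj e].
  by case: (c_neq gm E).
by split=> //; rewrite mE l0 oppr0.
Qed.

Lemma third_point p q : is_elt p -> is_elt q -> p <> q ->
  exists2 r, is_elt r & ~ collinear p q r.
Proof.
have [e0 e1 e2] := is_elt_basis.
wlog: p q / (q.1 <= p.1)%N => [W|qp] pe qe pq.
  have [/W|/ltnW/W] := leqP q.1 p.1; first exact.
  move=> /(_ qe pe (nesym pq)) [r re nC]; exists r => // C; apply: nC.
  exact: collinear_swap.
have [p1|p1] := leqP p.1 1.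
  exists (2%N, (0, 0, 0)) => // C.
  by apply: (@noncollinear_top (2%N, (0, 0, 0)) p q) => //=; [lia | do 2 apply: collinear_rot].
have [{}qp|pq'] := ltnP q.1 p.1.
  have [q0|q0] := posnP q.1.
    exists (1%N, (0, 0, 0)) => //; apply: noncollinear_top => //.
    by rewrite (elt_gt0 qe q0).
  exists (0%N, (0, 0, 0)) => //; apply: noncollinear_top => //; last by rewrite (leq_trans _ p1).
  by move=> qE; rewrite qE in q0.
apply: Classical_Prop.NNPP => N.
(* If no third point existed, the displacement from q to p would be a multiple of both w_0 and w_1,
   hence 0. *)
have D r : is_elt r -> (r.1 < p.1)%N -> exists k, forall w,
    dform (gline1 p.1) (gline2 p.1) (cF p.2.1.1 - cF q.2.1.1)
      (cF p.2.1.2 - cF q.2.1.2) (cF p.2.2 - cF q.2.2) w = k * phi w r.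
  move=> re rp; apply: Classical_Prop.NNPP => N'; apply: N; exists r => //.
  apply: indep_noncollinear => // la mu nu H.
  have qE : q.1 = p.1 by lia.
  case: p q pe qe qE pq H rp N' {qp p1 pq'} => [g t] [g' t'] /= pe qe e.
  rewrite e in qe * => tt H rg N'.
  have [mE H'] := rel_diff pe qe re rg H.
  have [l0|l0] := eqVneq la 0; last first.
    case: N'; exists (- (la^-1 * nu)) => w; apply: (mulfI l0).
    rewrite mulrA mulrN mulVKf // mulNr; apply/eqP; rewrite -addr_eq0; apply/eqP.
    exact: H'.
  split=> //; first by rewrite mE l0 oppr0.
  have [w w0] := phi_neq0 re; have := H' w; rewrite l0 mul0r add0r => /eqP.
  by rewrite mulf_eq0 (negPf w0) orbF => /eqP.
have [k kE] := D _ e0 (ltnW p1).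
have [l lE] := D _ e1 p1.
have qE : q.1 = p.1 by lia.
have k0 : k = 0.
  have := kE (delta 0); rewrite lE /phi /= !(cF0) !mul0r !addr0 delta_id mulr1 => <-.
  by rewrite delta_neq ?mulr0.
have tt : p.2 <> q.2 by move=> z; apply: pq; case: p q z qE {N D qp pe qe p1 pq' kE lE} => [? ?] [? ?] /= -> ->.
have [] := dform_neq0 pe.1 pe.2 _ tt; first by rewrite -qE; exact: qe.2.
by move=> w; rewrite kE k0 mul0r eqxx.
Qed.

Hypothesis Finf : infinite_field F.

Lemma generic_configuration : exists w : nat -> 'rV[F]_3,
  [/\ w 0%N = delta_mx 0 i0, w 1%N = delta_mx 0 i1, w 2%N = delta_mx 0 i2
    & forall p q r, is_elt p -> is_elt q -> is_elt r -> ~ collinear p q r ->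
      det3 (vec cF w p) (vec cF w q) (vec cF w r) != 0].
Proof.
pose T := (elt * elt * elt)%type.
pose good (t : T) := [/\ is_elt t.1.1, is_elt t.1.2, is_elt t.2 &
   indep t.1.1 t.1.2 t.2].
(* The value 1 imposes no condition on the remaining triples. *)
pose D (t : T) (w : nat -> 'rV[F]_3) :=
  if excluded_middle_informative (good t)
  then det3 (vec cF w t.1.1) (vec cF w t.1.2) (vec cF w t.2) else 1.
pose s : seq T := [seq (p, q) | p <- [seq (p, q) | p <- all_elts, q <- all_elts], q <- all_elts].
have sP p q r : is_elt p -> is_elt q -> is_elt r -> List.In (p, q, r) s.
  move=> /mem_all_elts pe /mem_all_elts qe /mem_all_elts re.
  have : (p, q, r) \in s by do 2 ?[apply: allpairs_f] => //.
  elim: s => //= t s' IHs; rewrite inE => /orP[/eqP ->|/IHs]; by [left | right].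
have [w ws] : exists w, forall t, List.In t s -> D t w != 0.
  apply: (generic_choice Finf) => [t w w'|t w w'|t].
  - rewrite /D; case: excluded_middle_informative => [gt|gt] /=; last first.
    by exists 1 => z; rewrite hornerC.
  have [P PE] := det3_poly (vec cF w t.1.1) (vec cF (fun i => w' i - w i) t.1.1)
    (vec cF w t.1.2) (vec cF (fun i => w' i - w i) t.1.2)
    (vec cF w t.2) (vec cF (fun i => w' i - w i) t.2).
  by exists P => z; rewrite -PE !vec_linear.
  - move=> E; rewrite /D; case: excluded_middle_informative => //= gt.
  by rewrite /vec !E.
  - rewrite /D; case: excluded_middle_informative => [gt|gt] /=; last first.
    by exists (fun=> 0); rewrite oner_neq0.
  by case: gt => e1 e2 e3; apply: indep_witness.
have [b0 b1 b2] := is_elt_basis.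
have wgood p q r : is_elt p -> is_elt q -> is_elt r -> indep p q r ->
    det3 (vec cF w p) (vec cF w q) (vec cF w r) != 0.
  move=> pe qe re I; have := ws _ (sP _ _ _ pe qe re); rewrite /D.
  case: excluded_middle_informative => [gt|ng] //=.
  by case: ng; split.
have wb i : vec cF w (i, (0, 0, 0)) = w i.
  by rewrite /vec /= !(cF0) !scale0r !addr0.
(* A change of basis normalizes w_0, w_1, w_2 and multiplies every bracket by the same nonzero
   factor. *)
pose B := \matrix_(i < 3) w i : 'M[F]_3.
have detB : \det B = det3 (w 0%N) (w 1%N) (w 2%N) by rewrite det_mx33 !rowK.
have Bu : B \in unitmx.
  rewrite unitmxE unitfE detB; have := wgood _ _ _ b2 b1 b0 basis_indep.
  by rewrite !wb => h; rewrite det3_swap oppr_eq0 -det3_rot.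
have wB (i : 'I_3) : w i *m invmx B = delta_mx 0 i.
  have -> : w i = row i B by rewrite rowK.
  by rewrite -row_mul mulmxV // row1.
exists (fun i => w i *m invmx B); split.
- by rewrite -(wB i0).
- by rewrite -(wB i1).
- by rewrite -(wB i2).
move=> p q r pe qe re nC; rewrite !vec_mulmx det3_mulmx mulf_eq0 negb_or.
have dB : \det B != 0 by rewrite -unitfE -unitmxE.
rewrite det_inv invr_eq0 dB andbT; apply: wgood => //.
by have [/nC|] := dichotomy pe qe re.
Qed.

Lemma tails_uniq g : (g < m)%N -> uniq (tails g).
Proof.
move=> gm; have [D _ _] := gate_goodP gm.
elim: (tails g) D => //= t s IHs [ts D]; rewrite IHs // andbT.
elim: s ts {IHs D} => //= u s IHs [tu ts]; rewrite inE negb_or IHs // andbT.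
by apply/eqP => e; rewrite e in tu; case: tu; rewrite subrr rmorph0.
Qed.

Lemma all_elts_uniq : uniq (all_elts).
Proof.
apply: allpairs_uniq_dep => [|g|]; first exact: iota_uniq.
  by rewrite mem_iota => gm; apply: tails_uniq.
by move=> [g t] [g' t'] _ _ /= [-> ->].
Qed.

End FieldPoint.

(** * Coordinates of a realization *)

Section Reconstruction.

Hypothesis nc_top : forall p q r : elt, is_elt p -> is_elt q -> is_elt r -> q <> r ->
  (q.1 < p.1)%N -> (r.1 < p.1)%N -> ~ collinear p q r.
Hypothesis nc_neq : forall g k l, (g < m)%N -> G g = GNeq k l ->
  ~ collinear (g, (0, 0, x k)) (g, (0, 0, x l)) (k, (0, 0, 0)).
Hypothesis nc_pair : forall p q : elt, is_elt p -> is_elt q -> p <> q ->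
  exists2 r, is_elt r & ~ collinear p q r.

Variables (A : comPzRingType) (v : elt -> 'rV[A]_3).
Hypothesis v_unim : forall e, is_elt e -> exists q : 'cV[A]_3, v e *m q = 1%:M.
Hypothesis v_col : forall p q r, is_elt p -> is_elt q -> is_elt r ->
  collinear p q r -> det3 (v p) (v q) (v r) = 0.
Hypothesis v_ncol : forall p q r, is_elt p -> is_elt q -> is_elt r ->
  ~ collinear p q r -> is_unit (det3 (v p) (v q) (v r)).

Notation f := ((0%N, (0, 0, 0)) : elt).

Lemma f_elt : is_elt f.
Proof. by apply: is_elt0; have := config_nv ok; lia. Qed.

(** The coefficient of [a] is a unit because p and b stay independent over A: by [nc_pair] some
    bracket containing both is a unit. *)
Lemma on_line p a b : is_elt p -> is_elt a -> is_elt b -> a <> b -> p <> b ->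
  collinear p a b -> exists al be, is_unit al /\ v p = al *: v a + be *: v b.
Proof.
move=> pe ae be ab pb C.
have [r re /(v_ncol ae be re) [y ry]] := nc_pair ae be ab.
have vE : v p = (y * det3 (v p) (v b) (v r)) *: v a + (y * det3 (v a) (v p) (v r)) *: v b.
  rewrite -!scalerA -scalerDr -[LHS]scale1r -ry [_ * y]mulrC -scalerA; congr (_ *: _).
  rewrite det3_cramer [X in _ + X *: _ = _]det3_rot [X in _ + X *: _ = _]det3_rot.
  rewrite (v_col pe ae be C).
  by rewrite scale0r addr0.
move: (y * _) (y * _) vE => be' al vE; exists al, be'; split=> //.
have [r' re' /(v_ncol pe be re')] := nc_pair pe be pb.
rewrite vE (_ : det3 _ _ _ = al * det3 (v a) (v b) (v r')).
  exact: is_unitMl.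
by rewrite /det3 !mxE; ring.
Qed.

(** The three points 0, 1 and f of a line are pairwise independent, so the zero point can be
    rescaled to turn the unit point into a multiple of w + v f. *)
Lemma line_frame g : (0 < g < m)%N -> exists w : 'rV[A]_3,
  (exists2 la, is_unit la & v (g, (0, 0, 0)) = la *: w) /\
  (exists2 la, is_unit la & v (g, (0, 0, 1)) = la *: (w + v f)).
Proof.
move=> gm; have g0 : (0 < g)%N by lia.
have P0 : is_elt (g, (0, 0, 0)) by apply: is_elt0; lia.
have P1 : is_elt (g, (0, 0, 1)) by apply: (is_elt1).
have nf t : (g, t) <> f by move=> [g0']; rewrite g0' in g0.
have n01 : (g, (0, 0, 0)) <> (g, (0, 0, 1)) :> elt.
  by case=> /eqP; rewrite eq_sym oner_eq0.
have C : collinear (g, (0, 0, 1)) (g, (0, 0, 0)) f.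
  apply: collinear_diff => B c _ w; exists 1.
  by rewrite /vec /= rmorph0 rmorph1 !gline0 !scale0r !addr0 addrAC subrr add0r.
have [al [be [alu vE]]] := on_line P1 P0 f_elt (@nf _) (@nf _) C.
have beu : is_unit be.
  have [r re /(v_ncol P0 P1 re)] := nc_pair P0 P1 n01.
  rewrite vE (_ : det3 _ _ _ = be * det3 (v (g, (0, 0, 0))) (v f) (v r)).
    exact: is_unitMl.
  by rewrite /det3 !mxE; ring.
case: alu => al' alE; case: beu => be' beE.
exists ((al * be') *: v (g, (0, 0, 0))); split.
  exists (be * al'); first by exists (be' * al); rewrite mulrACA beE mul1r mulrC.
  rewrite scalerA (_ : _ * _ = (al * al') * (be * be')); last by ring.
  by rewrite alE beE mul1r scale1r.
exists be; first by exists be'.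
by rewrite scalerDr scalerA mulrCA beE mulr1.
Qed.

Lemma var_coord g (w : 'rV[A]_3) la : (0 < g < m)%N -> G g = GVar -> is_unit la ->
  v (g, (0, 0, 0)) = la *: w ->
  exists y, exists2 mu, is_unit mu & v (g, (0, 0, x g)) = mu *: (w + y *: v f).
Proof.
move=> gm E [la' laE] vE.
have P0 : is_elt (g, (0, 0, 0)) by apply: is_elt0; lia.
have Px : is_elt (g, (0, 0, x g)).
  by split; rewrite /= ?/tails ?E ?inE ?eqxx ?orbT //; lia.
have nf t : (g, t) <> f by case=> g0; lia.
have C : collinear (g, (0, 0, x g)) (g, (0, 0, 0)) f.
  apply: collinear_diff => B c _ u; exists (c (x g)).
  by rewrite /vec /= rmorph0 !gline0 !scale0r !addr0 addrAC subrr add0r.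
have [al [be [[al' alE] ->]]] := on_line Px P0 f_elt (@nf _) (@nf _) C.
exists (al' * la' * be), (al * la).
  by exists (al' * la'); rewrite mulrACA alE laE mulr1.
rewrite vE scalerDr !scalerA; congr (_ + _ *: _).
by rewrite (_ : _ * _ = (al * al') * (la * la') * be); [rewrite alE laE !mul1r | ring].
Qed.

(** This holds for polynomials in t and the y_j: the values of t and of all y_j + t can be
    prescribed independently. *)
Hypothesis L_free : forall y : nat -> A, exists c : {rmorphism L -> A},
  forall g, (g < m)%N -> G g = GVar -> c (x g) = y g.

Section Placed.
Variables (c : {rmorphism L -> A}) (w : nat -> 'rV[A]_3).
Definition placed e := exists2 la, is_unit la & v e = la *: vec c w e.

Lemma placed_ncol p q r : is_elt p -> is_elt q -> is_elt r ->
  placed p -> placed q -> placed r -> ~ collinear p q r ->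
  is_unit (det3 (vec c w p) (vec c w q) (vec c w r)).
Proof.
move=> pe qe re [a _ pE] [b _ qE] [e _ rE] /(v_ncol pe qe re).
rewrite pE qE rE det3ZZZ mulrC; exact: is_unitMl.
Qed.

Lemma placed_col p q r : is_elt p -> is_elt q -> is_elt r ->
  placed p -> placed q -> placed r -> collinear p q r ->
  det3 (vec c w p) (vec c w q) (vec c w r) = 0.
Proof.
move=> pe qe re [a au pE] [b bu qE] [e eu rE] /(v_col pe qe re).
rewrite pE qE rE det3ZZZ => H.
apply: (@is_unit_cancel _ (a * b * e)); last by rewrite mulr0.
by do 2 ?apply: is_unitM.
Qed.

(** The inductive step of the reconstruction: [p] is the intersection of the lines ab and eh, both
    formally and in the given realization, so its position is forced up to a unit. *)
Lemma place p a b e h z (mu al be : L) :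
  is_elt p -> is_elt a -> is_elt b -> is_elt e -> is_elt h -> is_elt z ->
  placed a -> placed b -> placed e -> placed h -> placed z ->
  ~ collinear b e h -> ~ collinear a b z ->
  (forall (B : comPzRingType) (c' : {rmorphism L -> B}) w',
     vec c' w' p = vec c' w' a + c' mu *: vec c' w' b) ->
  (forall (B : comPzRingType) (c' : {rmorphism L -> B}) w',
     vec c' w' p = c' al *: vec c' w' e + c' be *: vec c' w' h) ->
  placed p.
Proof.
move=> pE aE bE eE hE zE pa pb pe ph pz nbeh nabz E1 E2.
have C1 : collinear p a b.
  by move=> B c' _ w'; rewrite E1 /det3 !mxE; ring.
have C2 : collinear p e h.
  by move=> B c' _ w'; rewrite E2 /det3 !mxE; ring.
have D1 := v_col pE aE bE C1; have D2 := v_col pE eE hE C2.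
have [||||||la lau vpE] := @meet_lines A (c mu) (vec c w a) (vec c w b) (vec c w e)
   (vec c w h) (vec c w z) (v p); last by exists la; rewrite // E1.
- by rewrite -E1 E2 /det3 !mxE; ring.
- exact: placed_ncol.
- exact: placed_ncol.
- have [ua uau aE'] := pa; have [ub ubu bE'] := pb.
  apply: (@is_unit_cancel _ (ua * ub)); first exact: is_unitM.
  by rewrite mulr0 -[RHS]D1 aE' bE' /det3 !mxE; ring.
- have [ua uau aE'] := pe; have [ub ubu bE'] := ph.
  apply: (@is_unit_cancel _ (ua * ub)); first exact: is_unitM.
  by rewrite mulr0 -[RHS]D2 aE' bE' /det3 !mxE; ring.
- exact: v_unim.
Qed.

Hypothesis w0 : w 0%N = v f.
Hypothesis w_frame : forall g, (0 < g < m)%N ->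
  (exists2 la, is_unit la & v (g, (0, 0, 0)) = la *: w g) /\
  (exists2 la, is_unit la & v (g, (0, 0, 1)) = la *: (w g + v f)).
Hypothesis c_var : forall g, (g < m)%N -> G g = GVar ->
  exists2 mu, is_unit mu & v (g, (0, 0, x g)) = mu *: (w g + c (x g) *: v f).

Lemma vec_point g s : vec c w (g, (0, 0, s)) = w g + c s *: v f.
Proof. by rewrite /vec /= w0 !rmorph0 !scale0r !addr0. Qed.

Lemma placed_f : placed f.
Proof.
by exists 1; [apply: is_unit1 | rewrite vec_point w0 rmorph0 scale0r addr0 scale1r].
Qed.

Lemma placed0 g : (0 < g < m)%N -> placed (g, (0, 0, 0)).
Proof.
by move=> /w_frame [[la lau E] _]; exists la; rewrite // vec_point rmorph0 scale0r addr0.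
Qed.

Lemma placed1 g : (0 < g < m)%N -> placed (g, (0, 0, 1)).
Proof.
by move=> /w_frame [_ [la lau E]]; exists la; rewrite // vec_point rmorph1 scale1r.
Qed.

Lemma placed_var g : (g < m)%N -> G g = GVar -> placed (g, (0, 0, x g)).
Proof. by move=> gm /(c_var gm) [mu muu E]; exists mu; rewrite // vec_point. Qed.

Ltac tail_neq := solve [ by case=> *; lia
  | let H := fresh in move=> H; case: H; (let e := fresh in move=> e; subst; lia)
  | case=> /eqP; rewrite ?[0 == _]eq_sym ?oppr_eq0 ?oner_eq0; done ].
Ltac comb := let j := fresh in
  intros; rewrite /vec /=; rewrite ?(rmorph0, rmorph1, rmorphN, rmorphM, rmorphD, rmorphB);
  apply/rowP => j; rewrite !mxE; ring.

Section Gate.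
Variable g : nat.
Hypotheses (gm : (1 < g < m)%N)
  (IH : forall k t, (k < g)%N -> is_elt (k, t) -> placed (k, t)).

Lemma place_top a b e h (mu al be : L) p : p.1 = g ->
  is_elt p -> is_elt a -> is_elt b -> is_elt e -> is_elt h ->
  placed a -> placed b -> placed e -> placed h ->
  ~ collinear b e h -> a.1 = g -> (0 < b.1 < g)%N ->
  (forall (B : comPzRingType) (c' : {rmorphism L -> B}) w',
     vec c' w' p = vec c' w' a + c' mu *: vec c' w' b) ->
  (forall (B : comPzRingType) (c' : {rmorphism L -> B}) w',
     vec c' w' p = c' al *: vec c' w' e + c' be *: vec c' w' h) ->
  placed p.
Proof.
move=> pg pE aE bE eE hE pa pb pe ph nbeh ag bg E1 E2.
have fe := f_elt.
apply: (place (z := f) pE aE bE eE hE fe pa pb pe ph placed_f nbeh _ E1 E2).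
apply: nc_top => //=; rewrite ?ag; try lia.
by move=> bf; rewrite bf in bg.
Qed.

(* The center w_g - w_k of the perspectivity between the lines of k and g is    *)
(* the intersection of the line of the two zeros and that of the two units.    *)
Lemma placed_center k t : (0 < k < g)%N -> is_elt (g, t) ->
  (forall (B : comPzRingType) (c' : {rmorphism L -> B}) w',
     vec c' w' (g, t) = w' g - w' k) -> placed (g, t).
Proof.
move=> kg te tE.
have k0 : is_elt (k, (0, 0, 0)) by apply: is_elt0; lia.
have k1 : is_elt (k, (0, 0, 1)) by apply: (is_elt1); lia.
have g0 : is_elt (g, (0, 0, 0)) by apply: is_elt0; lia.
have g1 : is_elt (g, (0, 0, 1)) by apply: (is_elt1); lia.
apply: (@place_top (g, (0, 0, 0)) (k, (0, 0, 0)) (g, (0, 0, 1)) (k, (0, 0, 1)) (-1) 1 (-1)) => //=.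
- by apply: placed0; lia.
- by apply: IH => //; lia.
- by apply: placed1; lia.
- by apply: IH => //; lia.
- move/collinear_swap; apply: nc_top => //=; try lia.
  by tail_neq.
- by move=> B c' w'; rewrite tE; comb.
- by move=> B c' w'; rewrite tE; comb.
Qed.

(** Projection of a point of line k from the center [a]: the image is cut out by the line through
    [b] and the common point. *)
Lemma placed_shift a b k u t (mu be : L) :
  (0 < k < g)%N -> is_elt (k, u) -> is_elt (g, t) -> is_elt (g, a) -> is_elt (g, b) ->
  placed (g, a) -> placed (g, b) ->
  (forall (B : comPzRingType) (c' : {rmorphism L -> B}) w',
     vec c' w' (g, t) = vec c' w' (g, a) + c' mu *: vec c' w' (k, u)) ->
  (forall (B : comPzRingType) (c' : {rmorphism L -> B}) w',
     vec c' w' (g, t) = vec c' w' (g, b) + c' be *: vec c' w' f) ->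
  placed (g, t).
Proof.
move=> kg ke te ae b_e pa pb E1 E2; have fe := f_elt.
apply: (@place_top (g, a) (k, u) f (g, b) mu be 1) => //=.
- by apply: IH => //; lia.
- exact: placed_f.
- do 2 move/collinear_rot; apply: nc_top => //=; try lia.
  by case=> k0; lia.
- by move=> B c' w'; rewrite E2 rmorph1 scale1r addrC.
Qed.

Lemma uses_center k l : (0 < k < m)%N -> uses (G k) l -> exists u, [/\ is_elt (k, u),
  (k, (0, 0, 1)) <> (k, u) & forall (B : comPzRingType) (c' : {rmorphism L -> B}) w',
     vec c' w' (k, u) = w' k - w' l].
Proof.
move=> km; have n10 := oner_neq0 L.
case E: (G k) => [|||k' l'|k'|k' l'|k' l'|k' l'|k' l'] //= /eqP <-;
  [exists (-1, 0, 0) | exists (-1, 0, 0) | exists (0, -1, 0) | exists (0, -1, 0)]; split.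
all: try by split; rewrite /= ?/tails ?E ?inE ?eqxx ?orbT //; lia.
all: try by (case=> /eqP; rewrite eq_sym ?oppr_eq0 (negPf n10)).
all: intros; rewrite /vec /gline1 /gline2 /= E /= ?(rmorph0, rmorphN, rmorph1);
  by apply/rowP => j; rewrite !mxE; ring.
Qed.

Ltac is_tail E := by split; rewrite /= ?/tails ?E ?inE ?eqxx ?orbT //; lia.
Ltac elt E := first [ assumption | is_tail E | by apply: is_elt0; lia
  | by apply: (is_elt1); lia | by apply: (is_eltx); lia ].
Ltac side E xE := cbn [fst snd]; solve [ done | lia | elt E | by apply: IH; [lia | elt E]
  | by move/collinear_swap; apply: nc_top; cbn [fst snd]; first [elt E | tail_neq | lia]
  | intros; rewrite /vec /= ?/gline1 ?/gline2 ?E ?xE /=;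
    rewrite ?(rmorph0, rmorph1, rmorphN, rmorphM, rmorphD, rmorphB);
    by apply/rowP => ?; rewrite !mxE; ring ].
Ltac all_tails := rewrite !inE;
  repeat match goal with |- is_true (_ || _) -> _ => case/orP end; move/eqP=> -> //.

Lemma placed_x k t : (0 < k < g)%N -> (k < nv)%N ->
  is_elt (g, (0, 0, x k)) -> is_elt (g, t) -> placed (g, t) ->
  (forall (B : comPzRingType) (c' : {rmorphism L -> B}) w',
     vec c' w' (g, t) = w' g - w' k) -> placed (g, (0, 0, x k)).
Proof.
move=> kg kn xe te pt tE.
have g0 : is_elt (g, (0, 0, 0)) by apply: is_elt0; lia.
apply: (@placed_shift t (0, 0, 0) k (0, 0, x k) _ 1 (x k)) => //.
- by apply: (is_eltx); lia.
- by apply: placed0; lia.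
- by intros; rewrite tE; comb.
- by intros; comb.
Qed.

Lemma placed_gate t : t \in tails g -> placed (g, t).
Proof.
have gm0 : (g < m)%N by lia.
have gm1 : (0 < g < m)%N by lia.
have g0 : is_elt (g, (0, 0, 0)) by apply: is_elt0; lia.
have g1 : is_elt (g, (0, 0, 1)) by apply: (is_elt1); lia.
have p0 := placed0 gm1; have p1 := placed1 gm1.
have := config_gate ok gm0; have nvm := config_nv ok; rewrite /gate_ok.
move: t; case E: (G g) => [|||k l|k|k l|k l|k l|k l].
- lia.
- lia.
- move=> t gn; rewrite /tails E !inE => /or3P[] /eqP -> //; exact: placed_var.
- move=> t [gn kg lg kl xg].
  have pA : placed (g, (-1, 0, 0)) by apply: (@placed_center k); side E xg.
  have pk : placed (g, (0, 0, x k)) by apply: (@placed_x k (-1, 0, 0)); side E xg.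
  (* The multiplying center lies on the line of the two zeros and on the line joining x_k on line g
     to the unit point of line l. *)
  have pC : placed (g, (0, - x k, 0)).
    by apply: (@place_top (g, (0, 0, x k)) (l, (0, 0, 1)) (g, (0, 0, 0)) (l, (0, 0, 0))
      (- x k) 1 (- x k)); side E xg.
  have px : placed (g, (0, 0, x g)).
    by apply: (@placed_shift (0, - x k, 0) (0, 0, 0) l (0, 0, x l) _ (x k) (x g)); side E xg.
  by rewrite /tails E; all_tails.
- move=> t [gn kg xg].
  have pA : placed (g, (-1, 0, 0)) by apply: (@placed_center k); side E xg.
  have pk : placed (g, (0, 0, x k)) by apply: (@placed_x k (-1, 0, 0)); side E xg.
  have pC : placed (g, (- x k, 0, 0)).
    by apply: (@place_top (g, (0, 0, x k)) (k, (0, 0, 1)) (g, (0, 0, 0)) (k, (0, 0, 0))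
      (- x k) 1 (- x k)); side E xg.
  have px : placed (g, (0, 0, x g)).
    by apply: (@placed_shift (- x k, 0, 0) (0, 0, 0) k (0, 0, x k) _ (x k) (x g)); side E xg.
  by rewrite /tails E; all_tails.
- move=> t [gn kg lg dlk [xg _]].
  have kl : k <> l by move=> kl; rewrite kl ltnn in dlk.
  have pA : placed (g, (-1, 0, 0)) by apply: (@placed_center k); side E xg.
  have pB : placed (g, (0, -1, 0)) by apply: (@placed_center l); side E xg.
  (* w_g - w_k - w_l is the intersection of two lines through the plain centers. Projecting x_k from
     it yields the center w_g - w_l + x_k w_0, which adds x_k. *)
  have pD : placed (g, (-1, -1, 0)).
    by apply: (@place_top (g, (0, -1, 0)) (k, (0, 0, 0)) (g, (-1, 0, 0)) (l, (0, 0, 0))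
      (-1) 1 (-1)); side E xg.
  have pE : placed (g, (0, -1, x k)).
    by apply: (@placed_shift (-1, -1, 0) (0, -1, 0) k (0, 0, x k) _ 1 (x k)); side E xg.
  have px : placed (g, (0, 0, x g)).
    by apply: (@placed_shift (0, -1, x k) (0, 0, 0) l (0, 0, x l) _ 1 (x g)); side E xg.
  by rewrite /tails E; all_tails.
- move=> t [gn kg lg dlk [xg /uses_center]].
  case=> [|u [ue un uE]]; first by lia.
  have pB : placed (g, (0, -1, 0)) by apply: (@placed_center l); side E xg.
  (* The center [u] = w_k - w_l inherited from gate k replaces w_g - w_k: the point is (w_g + w_0) +
     (w_k - w_l) and also (w_g - w_l) + (w_k + w_0). *)
  have pK1 : placed (g, (1, -1, 1)).
    by apply: (@place_top (g, (0, -1, 0)) (k, (0, 0, 1)) (g, (0, 0, 1)) (k, u) 1 1 1);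
      try (by intros; rewrite uE; side E xg); side E xg.
  have pK : placed (g, (1, -1, x k)).
    by apply: (@placed_shift (0, -1, 0) (1, -1, 1) k (0, 0, x k) _ 1 (x k - 1)); side E xg.
  have pE : placed (g, (0, -1, x k)).
    by apply: (@placed_shift (1, -1, x k) (0, -1, 0) k (0, 0, 0) _ (-1) (x k)); side E xg.
  have px : placed (g, (0, 0, x g)).
    by apply: (@placed_shift (0, -1, x k) (0, 0, 0) l (0, 0, x l) _ 1 (x g)); side E xg.
  by rewrite /tails E; all_tails.
- move=> t [gn kn ln kl].
  have pA : placed (g, (-1, 0, 0)) by apply: (@placed_center k); side E E.
  have pB : placed (g, (0, -1, 0)) by apply: (@placed_center l); side E E.
  have pk : placed (g, (0, 0, x k)) by apply: (@placed_x k (-1, 0, 0)); side E E.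
  by rewrite /tails E; all_tails.
- move=> t [gn kn ln kl _].
  have pA : placed (g, (-1, 0, 0)) by apply: (@placed_center k); side E E.
  have pB : placed (g, (0, -1, 0)) by apply: (@placed_center l); side E E.
  have pk : placed (g, (0, 0, x k)) by apply: (@placed_x k (-1, 0, 0)); side E E.
  have pl : placed (g, (0, 0, x l)) by apply: (@placed_x l (0, -1, 0)); side E E.
  by rewrite /tails E; all_tails.
Qed.

End Gate.

Lemma all_placed e : is_elt e -> placed e.
Proof.
case: e => g t; elim/ltn_ind: g t => g IH t [/= gm tg].
have [g0|g0] := posnP g.
  rewrite g0 in tg *; move: tg; rewrite /tails (config_gate0 ok) inE => /eqP ->.
  exact: placed_f.
have [g1|g1] := ltnP 1 g; first by apply: placed_gate => [|k u kg ku|//]; [rewrite g1 | apply: IH].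
have {g0 g1}gE : g = 1%N by lia.
rewrite gE in tg gm *; move: tg; rewrite /tails (config_gate1 ok) !inE.
by case/orP=> /eqP ->; [apply: placed0 | apply: placed1]; lia.
Qed.

(** The collinear triple of an equality gadget has as bracket, up to sign, x_k - x_l times the unit
    bracket of w_g, w_l and w_0. *)
Lemma placed_admissible : admissible c.
Proof.
move=> g k l gm E; have := config_gate ok gm; rewrite /gate_ok E => -[gn kn ln kl].
have nvm := config_nv ok.
have [l1|l1] := eqVneq l 1%N; [by left | right].
have Be : is_elt (g, (0, -1, 0)) by split; rewrite //= /tails E !inE eqxx ?orbT.
have ke : is_elt (g, (0, 0, x k)) by split; rewrite //= /tails E !inE eqxx ?orbT.
have le : is_elt (l, (0, 0, x l)) by apply: (is_eltx).
have C : collinear (g, (0, -1, 0)) (l, (0, 0, x l)) (g, (0, 0, x k)).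
  move=> B c' adm w'; have [z|e] := adm g k l gm E; first by rewrite z eqxx in l1.
  rewrite /vec /= /gline1 /gline2 E /= ?(rmorph0, rmorphN, rmorph1) e /det3 !mxE.
  by ring.
have l0 : is_elt (l, (0, 0, 0)) by apply: is_elt0; lia.
have ge : is_elt (g, (0, 0, 0)) by apply: is_elt0; lia.
have N : ~ collinear (g, (0, 0, 0)) (l, (0, 0, 0)) f.
  apply: nc_top => //=; [exact: f_elt | by case=> l0'; lia | lia | lia].
have := placed_ncol ge l0 f_elt (all_placed ge) (all_placed l0) placed_f N.
have := placed_col Be le ke (all_placed Be) (all_placed le) (all_placed ke) C.
rewrite !vec_point rmorph0 !scale0r !addr0 {1}/vec /= /gline2 E /= -w0.
rewrite ?(rmorph0, rmorphN, rmorph1) => D U.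
apply/eqP; rewrite -subr_eq0; apply/eqP; apply: (is_unit_eq0 U).
by rewrite -[RHS]D /det3 !mxE; ring.
Qed.

(** The two copied points of an inequality gadget, with a third point off their line, have a unit
    bracket that is a multiple of x_k - x_l. *)
Lemma placed_neq g k l : (g < m)%N -> G g = GNeq k l -> is_unit (c (x k) - c (x l)).
Proof.
move=> gm E; have := config_gate ok gm; rewrite /gate_ok E => -[gn kn ln kl _].
have nvm := config_nv ok.
have ke : is_elt (g, (0, 0, x k)) by split; rewrite //= /tails E !inE eqxx ?orbT.
have le : is_elt (g, (0, 0, x l)) by split; rewrite //= /tails E !inE eqxx ?orbT.
have k0 : is_elt (k, (0, 0, 0)) by apply: is_elt0; lia.
have := placed_ncol ke le k0 (all_placed ke) (all_placed le) (all_placed k0) (nc_neq gm E).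
rewrite !vec_point (_ : det3 _ _ _ = (c (x k) - c (x l)) * det3 (v f) (w g) (vec c w (k, (0, 0, 0)))).
  exact: is_unitMl.
by rewrite vec_point /det3 !mxE rmorph0; ring.
Qed.

End Placed.

Lemma frame_choice : exists w : nat -> 'rV[A]_3, w 0%N = v f /\
  forall g, (0 < g < m)%N ->
  (exists2 la, is_unit la & v (g, (0, 0, 0)) = la *: w g) /\
  (exists2 la, is_unit la & v (g, (0, 0, 1)) = la *: (w g + v f)).
Proof.
have W g : exists w : 'rV[A]_3, (0 < g < m)%N ->
  (exists2 la, is_unit la & v (g, (0, 0, 0)) = la *: w) /\
  (exists2 la, is_unit la & v (g, (0, 0, 1)) = la *: (w + v f)).
  have [/line_frame [w wE]|_] := boolP (0 < g < m)%N; first by exists w.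
  by exists 0.
have [w wE] := boolp.choice W.
exists (fun g => if g == 0%N then v f else w g); split=> // g gm.
by case: eqP => [g0|_]; [rewrite g0 in gm | apply: wE].
Qed.

Lemma coordinates_choice (w : nat -> 'rV[A]_3) : (forall g, (0 < g < m)%N ->
  exists2 la, is_unit la & v (g, (0, 0, 0)) = la *: w g) ->
  exists c : {rmorphism L -> A}, forall g, (g < m)%N -> G g = GVar ->
    exists2 mu, is_unit mu & v (g, (0, 0, x g)) = mu *: (w g + c (x g) *: v f).
Proof.
move=> wE.
have Y g : exists y, (g < m)%N -> G g = GVar ->
    exists2 mu, is_unit mu & v (g, (0, 0, x g)) = mu *: (w g + y *: v f).
  case E: (G g); try by exists 0.
  have [gm|gm] := ltnP g m; last by exists 0.
  have g0 : (0 < g < m)%N.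
    by rewrite gm andbT lt0n; apply/eqP => g0; move: E; rewrite g0 (config_gate0 ok).
  have [la lau laE] := wE g g0.
  by have [y yE] := var_coord g0 E lau laE; exists y.
have [y yE] := boolp.choice Y.
have [c cE] := L_free y; exists c => g gm E; rewrite cE //.
exact: yE.
Qed.

Lemma reconstruction : exists (c : {rmorphism L -> A}) (w : nat -> 'rV[A]_3) (B C : 'M[A]_3),
  [/\ B *m C = 1%:M /\ C *m B = 1%:M,
      [/\ w 0%N = delta_mx 0 i0, w 1%N = delta_mx 0 i1 & w 2%N = delta_mx 0 i2],
      admissible c,
      forall g k l, (g < m)%N -> G g = GNeq k l -> is_unit (c (x k) - c (x l))
    & forall e, is_elt e -> exists2 la, is_unit la & v e = la *: (vec c w e *m B)].
Proof.
have [w [w0 wf]] := frame_choice.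
have [c cE] : exists c : {rmorphism L -> A}, forall g, (g < m)%N -> G g = GVar ->
    exists2 mu, is_unit mu & v (g, (0, 0, x g)) = mu *: (w g + c (x g) *: v f).
  by apply: coordinates_choice => g /wf [].
have P := all_placed w0 wf cE.
have nvm := config_nv ok.
pose B := \matrix_(i < 3) w i : 'M[A]_3.
have Bu : is_unit (\det B).
  have e0 := f_elt.
  have e1 : is_elt (1%N, (0, 0, 0)) by apply: is_elt0; lia.
  have e2 : is_elt (2%N, (0, 0, 0)) by apply: is_elt0; lia.
  have N : ~ collinear (2%N, (0, 0, 0)) f (1%N, (0, 0, 0)) by apply: nc_top.
  have := placed_ncol e2 e0 e1 (P _ e2) (P _ e0) (P _ e1) N.
  rewrite !(vec_point c w0) det_mx33 !rowK !rmorph0 !scale0r !addr0 [X in is_unit X -> _]det3_rot; exact.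
have [y By] := Bu; pose C := y *: \adj B.
have BC : B *m C = 1%:M by rewrite -scalemxAr mul_mx_adj scale_scalar_mx mulrC By.
have CB : C *m B = 1%:M by rewrite -scalemxAl mul_adj_mx scale_scalar_mx mulrC By.
have wB (i : 'I_3) : w i *m C = delta_mx 0 i.
  have -> : w i = row i B by rewrite rowK.
  by rewrite -row_mul BC row1.
exists c, (fun i => w i *m C), B, C; split=> //.
- by split; [rewrite -(wB i0) | rewrite -(wB i1) | rewrite -(wB i2)].
- exact: (placed_admissible w0 wf cE).
- exact: (placed_neq w0 wf cE).
- move=> e ee; have [la lau laE] := P e ee; exists la => //.
  by rewrite vec_mulmx -mulmxA CB mulmx1.
Qed.

End Reconstruction.

(** * Uniqueness of the coordinates *)

Section Rigidity.
Variables (A : comPzRingType) (c c' : {rmorphism L -> A}) (w w' : nat -> 'rV[A]_3).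
Hypothesis w_base : [/\ w 0%N = delta_mx 0 i0, w 1%N = delta_mx 0 i1 & w 2%N = delta_mx 0 i2].
Hypothesis w_base' : [/\ w' 0%N = delta_mx 0 i0, w' 1%N = delta_mx 0 i1 & w' 2%N = delta_mx 0 i2].
Hypothesis w_unit : forall g, (0 < g < m)%N -> exists z, is_unit (det3 (w g) (w 0%N) z).
Variables (B : 'M[A]_3) (la : elt -> A).
Hypothesis la_unit : forall e, is_elt e -> is_unit (la e).
Hypothesis wE : forall e, is_elt e -> vec c w e = la e *: (vec c' w' e *m B).

Lemma rigidity : exists b, [/\ is_unit b, B = b%:M, forall g, (g < m)%N -> w g = w' g
  & forall g, (g < m)%N -> G g = GVar -> c (x g) = c' (x g)].
Proof.
have vE (c1 : {rmorphism L -> A}) u g s : vec c1 u (g, (0, 0, s)) = u g + c1 s *: u 0%N.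
  by rewrite /vec /= !rmorph0 !scale0r !addr0.
have nvm := config_nv ok.
have e0 : is_elt (0%N, (0, 0, 0)) by apply: is_elt0; lia.
have inv g : (g < m)%N -> exists b, w' g *m B = b *: w g.
  move=> gm; have ge : is_elt (g, (0, 0, 0)) by apply: is_elt0.
  have [b lab] := la_unit ge; exists b; have := wE ge.
  rewrite !vE !rmorph0 !scale0r !addr0 => ->.
  by rewrite scalerA mulrC lab scale1r.
have [b0 b0E] : exists b, w' 0%N *m B = b *: w 0%N by apply: inv; lia.
(* The unit point w_g + w_0 is also preserved up to scaling, so B multiplies w_g and w_0 by the same
   factor. *)
have bE g : (g < m)%N -> w' g *m B = b0 *: w g.
  move=> gm; have [->//|g0] := posnP g.
  have [b bE] := inv g gm.
  have ge : is_elt (g, (0, 0, 1)) by apply: (is_elt1); lia.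
  have [|z /combination_inj U] := @w_unit g; first by lia.
  have := wE ge; rewrite !vE !rmorph1 !scale1r mulmxDl bE b0E scalerDr !scalerA.
  rewrite -{1}[w g]scale1r -{1}[w 0%N]scale1r => /U [E1 E2].
  by congr (_ *: _); apply: (is_unit_cancel (la_unit ge)); rewrite -E1.
have b0u : is_unit b0.
  have := wE e0; rewrite !vE !rmorph0 !scale0r !addr0 b0E scalerA.
  case: w_base => -> _ _ /matrixP /(_ 0 i0); rewrite !mxE !eqxx mulr1 => E.
  by exists (la (0%N, (0, 0, 0))); rewrite mulrC -E.
(* w_0, w_1, w_2 are the standard basis on both sides. *)
have BE : B = b0%:M.
  have R (i : 'I_3) : w i = delta_mx 0 i -> w' i = delta_mx 0 i -> row i B = row i b0%:M.
    move=> E E'; have im : (i < m)%N by have := ltn_ord i; lia.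
    by have := bE i im; rewrite E E' -rowE => ->; apply/rowP => j; rewrite !mxE eqxx /= eq_sym mulr_natr.
  case: w_base w_base' => p0 p1 p2 [q0 q1 q2].
  have E0 := R i0 p0 q0; have E1 := R i1 p1 q1; have E2 := R i2 p2 q2.
  apply/row_matrixP => -[[|[|[|//]]] lti].
  - by rewrite (_ : Ordinal lti = i0) //; apply: val_inj.
  - by rewrite (_ : Ordinal lti = i1) //; apply: val_inj.
  - by rewrite (_ : Ordinal lti = i2) //; apply: val_inj.
have ww g : (g < m)%N -> w g = w' g.
  move=> gm; have := bE g gm; rewrite BE mul_mx_scalar => E.
  by case: b0u => y yE; rewrite -[w g]scale1r -[w' g]scale1r -yE mulrC -!scalerA E.
exists b0; split=> // g gm E.
have g0 : (0 < g < m)%N.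
  by rewrite gm andbT lt0n; apply/eqP => g0; move: E; rewrite g0 (config_gate0 ok).
have ge : is_elt (g, (0, 0, x g)) by split; rewrite //= /tails E !inE eqxx ?orbT.
have [z /combination_inj U] := w_unit g0.
have := wE ge; rewrite !vE mulmxDl -scalemxAl b0E bE // scalerDr !scalerA -{1}[w g]scale1r.
by move/U => [E1 ->]; rewrite mulrAC -E1 mul1r.
Qed.

End Rigidity.

Lemma row_choice (A : Type) (k : nat) (P : 'I_k -> A -> Prop) :
  (forall i, exists a, P i a) -> exists la : 'rV[A]_k, forall i, P i (la 0 i).
Proof. by move=> /boolp.choice [h hP]; exists (\row_i h i) => i; rewrite mxE. Qed.

Lemma inverse_row (A : comPzRingType) (k : nat) (la : 'rV[A]_k) :
  (forall i, is_unit (la 0 i)) -> exists mu : 'rV[A]_k, forall i, la 0 i * mu 0 i = 1.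
Proof.
by move=> lau; apply: (row_choice (P := fun i a => la 0 i * a = 1)) => i; case: (lau i) => mu; exists mu.
Qed.

(** * The realization space *)

Section RealizationFunctor.
Notation els := all_elts.
Notation s := (size all_elts).
Notation f := ((0%N, (0, 0, 0)) : elt).
Notation N := (3 * (m - 3)).+1.

(** [ev psi t] evaluates at the point [psi] of Spec R and the parameter t. The hypotheses identify
    such pairs with the admissible values of the x_g whose inequalities are invertible. *)
Variables (R : comPzRingType)
  (ev : forall A : comPzRingType, {rmorphism R -> A} -> A -> {rmorphism L -> A}).
Hypothesis R_nz : (1 : R) <> 0.
Hypothesis ev_map : forall (A B : comPzRingType) (h : {rmorphism A -> B})
  (psi : {rmorphism R -> A}) (psi' : {rmorphism R -> B}) t l, psi' =1 h \o psi ->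
  ev psi' (h t) l = h (ev psi t l).
Hypothesis ev_t : forall (A : comPzRingType) (psi : {rmorphism R -> A}) t, ev psi t (x 2%N) = t.
Hypothesis ev_inj : forall (A : comPzRingType) (psi psi' : {rmorphism R -> A}) t,
  (forall g, (g < m)%N -> G g = GVar -> ev psi t (x g) = ev psi' t (x g)) -> psi =1 psi'.
Hypothesis ev_onto : forall (A : comPzRingType) (c : {rmorphism L -> A}),
  admissible c ->
  (forall g k l, (g < m)%N -> G g = GNeq k l -> is_unit (c (x k) - c (x l))) ->
  exists psi : {rmorphism R -> A}, ev psi (c (x 2%N)) =1 c.
Hypothesis ev_adm : forall (A : comPzRingType) (psi : {rmorphism R -> A}) t,
  admissible (ev psi t).
Hypothesis L_free : forall (A : comPzRingType) (y : nat -> A), exists c : {rmorphism L -> A},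
  forall g, (g < m)%N -> G g = GVar -> c (x g) = y g.
Hypothesis ev_field : forall (K : fieldType) (psi : {rmorphism R -> K}),
  exists c : {rmorphism L -> {poly K}},
  [/\ forall g, (1 <= g < nv)%N -> size (c (x g)) = (d g).+1,
      forall g k l, (g < m)%N -> G g = GNeq k l -> c (x k) <> c (x l)
    & forall (F : fieldType) (emb : {rmorphism {poly K} -> F}) l,
        ev (emb \o (polyC \o psi) : {rmorphism R -> F}) (emb 'X) l = emb (c l)].

Lemma field_admissible (K : fieldType) (psi : {rmorphism R -> K}) (c : {rmorphism L -> {poly K}}) :
  (forall (F : fieldType) (emb : {rmorphism {poly K} -> F}) l,
     ev (emb \o (polyC \o psi) : {rmorphism R -> F}) (emb 'X) l = emb (c l)) ->
  admissible c.
Proof.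
move=> cE g k l gm E.
have [e|e] := ev_adm ((@tofrac {poly K}) \o (polyC \o psi) : {rmorphism R -> {fraction {poly K}}})
  (tofrac ('X : {poly K})) gm E; first by left.
by right; apply: (@tofrac_inj K); rewrite -!cE.
Qed.

(** One field-valued point suffices for the combinatorial facts [nc_top], [nc_neq] and [nc_pair],
    since [collinear] does not depend on the point. *)
Lemma field_model : exists (K : fieldType) (c : {rmorphism L -> {poly K}}),
  [/\ forall g, (1 <= g < nv)%N -> size (c (x g)) = (d g).+1, admissible c
    & forall g k l, (g < m)%N -> G g = GNeq k l -> c (x k) <> c (x l)].
Proof.
have [K [psi _]] := field_point R_nz; have [c [c_size c_neq cE]] := ev_field psi.
by exists K, c; split=> //; apply: field_admissible cE.
Qed.

Lemma nc_top p q r : is_elt p -> is_elt q -> is_elt r -> q <> r ->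
  (q.1 < p.1)%N -> (r.1 < p.1)%N -> ~ collinear p q r.
Proof.
have [K [c [c_size c_adm c_neq]]] := field_model.
exact: (noncollinear_top c_size c_adm c_neq (@tofrac_inj K)).
Qed.

Lemma nc_neq g k l : (g < m)%N -> G g = GNeq k l ->
  ~ collinear (g, (0, 0, x k)) (g, (0, 0, x l)) (k, (0, 0, 0)).
Proof.
have [K [c [_ c_adm c_neq]]] := field_model.
exact: (noncollinear_neq c_adm c_neq (@tofrac_inj K)).
Qed.

Lemma nc_pair p q : is_elt p -> is_elt q -> p <> q ->
  exists2 r, is_elt r & ~ collinear p q r.
Proof.
have [K [c [c_size c_adm c_neq]]] := field_model.
exact: (third_point c_size c_adm c_neq (@tofrac_inj K)).
Qed.

Lemma els_uniq : uniq els.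
Proof.
have [K [c [c_size c_adm c_neq]]] := field_model.
exact: (all_elts_uniq c_size c_adm c_neq (@tofrac_inj K)).
Qed.

Definition e_ (i : 'I_s) : elt := nth f els i.

Lemma e_elt i : is_elt (e_ i).
Proof. by apply/mem_all_elts/mem_nth. Qed.

Lemma e_inj : injective e_.
Proof. by move=> i j /eqP; rewrite nth_uniq ?els_uniq // => /eqP /val_inj. Qed.

Lemma e_onto e : is_elt e -> exists i, e_ i = e.
Proof.
move/mem_all_elts=> ee; have ie : (index e els < s)%N by rewrite index_mem.
by exists (Ordinal ie); rewrite /e_ /= nth_index.
Qed.

Section Family.
Variables (A : comPzRingType) (V : 'M[A]_(s, 3)).

Definition family (e : elt) : 'rV[A]_3 :=
  oapp (fun i => row i V) 0 (insub (index e els) : option 'I_s).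

Lemma family_e i : family (e_ i) = row i V.
Proof. by rewrite /family /e_ index_uniq ?els_uniq // valK. Qed.

(** Realizations described by universal collinearity; the matroid is constructed at the end and
    compared with this notion through [M_spec]. *)
Definition realizes :=
  [/\ forall i, exists w : 'cV[A]_3, row i V *m w = 1%:M,
      forall p q r, collinear (e_ p) (e_ q) (e_ r) -> bracket V p q r = 0
    & forall p q r, ~ collinear (e_ p) (e_ q) (e_ r) -> is_unit (bracket V p q r)].

Hypothesis V_real : realizes.

Lemma family_unim e : is_elt e -> exists q : 'cV[A]_3, family e *m q = 1%:M.
Proof. by case: V_real => U _ _ /e_onto [i <-]; rewrite family_e. Qed.

Lemma family_col p q r : is_elt p -> is_elt q -> is_elt r -> collinear p q r ->
  det3 (family p) (family q) (family r) = 0.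
Proof.
case: V_real => _ C _ /e_onto [i <-] /e_onto [j <-] /e_onto [k <-] /C.
by rewrite !family_e bracketE.
Qed.

Lemma family_ncol p q r : is_elt p -> is_elt q -> is_elt r -> ~ collinear p q r ->
  is_unit (det3 (family p) (family q) (family r)).
Proof.
case: V_real => _ _ C /e_onto [i <-] /e_onto [j <-] /e_onto [k <-] /C.
by rewrite !family_e bracketE.
Qed.

End Family.

(* Coordinates of an affine space: the parameter t, followed by the last       *)
(* [m - 3] basic vectors.                                                      *)
Definition base_vec (A : comPzRingType) (v : 'rV[A]_N) (g : nat) : 'rV[A]_3 :=
  \row_j (if (g < 3)%N then (g == j)%:R else v 0 (inord (3 * (g - 3) + j).+1)).

Lemma base_vec_basis (A : comPzRingType) (v : 'rV[A]_N) : [/\ base_vec v 0 = delta_mx 0 i0,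
  base_vec v 1 = delta_mx 0 i1 & base_vec v 2 = delta_mx 0 i2].
Proof. by split; apply/rowP => j; rewrite !mxE /= eq_sym. Qed.

Lemma base_vec_onto (A : comPzRingType) (t : A) (w : nat -> 'rV[A]_3) :
  [/\ w 0%N = delta_mx 0 i0, w 1%N = delta_mx 0 i1 & w 2%N = delta_mx 0 i2] ->
  exists v : 'rV[A]_N, v 0 0 = t /\ forall g, (g < m)%N -> base_vec v g = w g.
Proof.
case=> w0 w1 w2.
exists (\row_(k < N) if (k : nat) is k'.+1 then w (3 + k' %/ 3)%N 0 (inord (k' %% 3)) else t).
split=> [|g gm]; first by rewrite mxE.
apply/rowP => j; rewrite mxE; case: ltnP => g3.
  case: g g3 {gm} => [|[|[|//]]] _; rewrite ?w0 ?w1 ?w2 mxE /= eq_sym; by [].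
have j3 := ltn_ord j; rewrite mxE inordK; last by lia.
congr (w _ 0 _); first by rewrite mulnC divnMDl // divn_small //; lia.
by apply: val_inj; rewrite /= inordK mulnC modnMDl modn_small.
Qed.

Lemma base_vec_inj (A : comPzRingType) (v v' : 'rV[A]_N) : v 0 0 = v' 0 0 ->
  (forall g, (g < m)%N -> base_vec v g = base_vec v' g) -> v = v'.
Proof.
move=> t_eq w_eq; apply/rowP => -[[|k] ltk].
  by rewrite (_ : Ordinal ltk = 0) //; apply: val_inj.
have gm : (3 + k %/ 3 < m)%N by lia.
have := w_eq _ gm => /rowP /(_ (inord (k %% 3))); rewrite !mxE /= inordK ?ltn_mod //.
have -> : (3 * (3 + k %/ 3 - 3) + k %% 3).+1 = k.+1 by lia.
by rewrite (_ : inord k.+1 = Ordinal ltk) //; apply: val_inj; rewrite /= inordK.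
Qed.

Lemma base_vec_map (A B : comPzRingType) (h : {rmorphism A -> B}) v g :
  base_vec (map_mx h v) g = map_mx h (base_vec v g).
Proof. by apply/rowP => j; rewrite !mxE; case: ifP; rewrite ?rmorph_nat ?mxE. Qed.

Notation X := (prod_functor (affine_space N) (Spec R)).

Definition conf (A : comPzRingType) (u : X A) : 'M[A]_(s, 3) :=
  \matrix_(i < s) vec (ev u.2 ((u.1 : 'rV[A]_N) 0 0)) (base_vec u.1) (e_ i).

Lemma conf_map (A B : comPzRingType) (h : {rmorphism A -> B}) (u : X A) :
  conf (fmap h u) = map_mx h (conf u).
Proof.
apply/row_matrixP => i; rewrite -map_row !rowK; case: (e_ i) => g t.
rewrite /vec /= !base_vec_map !map_mxD !map_mxZ mxE.
by congr (_ + _ *: _ + _ *: _ + _ *: _); apply: ev_map.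
Qed.

Lemma conf_col (A : comPzRingType) (u : X A) p q r :
  collinear (e_ p) (e_ q) (e_ r) -> bracket (conf u) p q r = 0.
Proof. by move=> C; rewrite bracketE !rowK; apply: C; apply: ev_adm. Qed.

Lemma third_index i : exists j k, ~ collinear (e_ i) (e_ j) (e_ k).
Proof.
have [q qe iq] : exists2 q, is_elt q & e_ i <> q.
  have nvm := config_nv ok.
  have fe : is_elt f by apply: is_elt0; lia.
  have qe : is_elt (1%N, (0, 0, 0)) by apply: is_elt0; lia.
  have [E|/eqP E] := eqVneq (e_ i) f; last by exists f.
  by exists (1%N, (0, 0, 0)); rewrite // E; case.
have [r re N'] := nc_pair (e_elt i) qe iq.
have [j jE] := e_onto qe; have [k kE] := e_onto re; exists j, k.
by rewrite jE kE.
Qed.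

Lemma conf_realizes (A : comPzRingType) (u : X A) :
  (forall p q r, ~ collinear (e_ p) (e_ q) (e_ r) -> is_unit (bracket (conf u) p q r)) ->
  realizes (conf u).
Proof.
move=> U; split=> // [i|p q r]; last exact: conf_col.
have [j [k /U]] := third_index i; rewrite bracketE; exact: unimodular_of_det3.
Qed.

(** * Orbits and their coordinates *)

Definition orb (A : comPzRingType) (u : X A) (V : 'M[A]_(s, 3)) :=
  exists (g h : 'M[A]_3) (la : 'rV[A]_s),
    [/\ g *m h = 1%:M, h *m g = 1%:M, forall i, is_unit (la 0 i)
      & V = diag_mx la *m conf u *m g].

Lemma row_scaled (A : comPzRingType) (la : 'rV[A]_s) (V : 'M[A]_(s, 3)) (g : 'M[A]_3) i :
  row i (diag_mx la *m V *m g) = la 0 i *: (row i V *m g).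
Proof. by rewrite !row_mul row_diag_mx -scalemxAl -rowE -scalemxAl. Qed.

Lemma bracket_scaled (A : comPzRingType) (la : 'rV[A]_s) (V : 'M[A]_(s, 3)) (g : 'M[A]_3) p q r :
  bracket (diag_mx la *m V *m g) p q r = la 0 p * la 0 q * la 0 r * (bracket V p q r * \det g).
Proof. by rewrite !bracketE !row_scaled det3ZZZ det3_mulmx. Qed.

Lemma orb_exists (A : comPzRingType) (V : 'M[A]_(s, 3)) : realizes V -> exists u, orb u V.
Proof.
move=> V_real.
have [c [w [B [C [[BC CB] wb adm neq wE]]]]] := reconstruction nc_top nc_neq nc_pair
  (family_unim V_real) (family_col V_real) (family_ncol V_real) (@L_free A).
have [psi psiE] := ev_onto adm neq.
have [v [vt vw]] := base_vec_onto (c (x 2%N)) wb.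
have la_ex i : exists la, is_unit la /\ row i V = la *: (vec c w (e_ i) *m B).
  by have [la lau laE] := wE (e_ i) (e_elt i); exists la; rewrite -family_e.
have [la laP] := row_choice la_ex.
exists (v, psi), B, C, la; split=> // [i|]; first by have [] := laP i.
apply/row_matrixP => i; rewrite row_scaled rowK; have [_ ->] := laP i.
congr (_ *: (_ *m _)); rewrite /= vt (vec_ext _ (e_elt i) vw) /vec.
by rewrite !psiE.
Qed.

Lemma orb_realizes (A : comPzRingType) (u : X A) (V : 'M[A]_(s, 3)) :
  orb u V -> realizes V -> realizes (conf u).
Proof.
case=> [g [h [la [gh hg lau VE]]]] [_ _ U]; apply: conf_realizes => p q r /U.
by rewrite VE bracket_scaled => /is_unitMr /is_unitMl.
Qed.

(** Both halves are needed: the equality of parameters makes coordinates unique on an orbit, and the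
    scalar matrix makes the action free. *)
Lemma orb_rigid (A : comPzRingType) (u u' : X A) (g : 'M[A]_3) (la : 'rV[A]_s) :
  realizes (conf u) -> (forall i, is_unit (la 0 i)) ->
  conf u = diag_mx la *m conf u' *m g -> u = u' /\ exists b, g = b%:M.
Proof.
case: u u' => [v psi] [v' psi'] /= real lau E.
have unit_frame k : (0 < k < m)%N -> exists z, is_unit (det3 (base_vec v k) (base_vec v 0) z).
  move=> km; have ge : is_elt (k, (0, 0, 0)) by apply: is_elt0; lia.
  have fe : is_elt f by apply: is_elt0; have := config_nv ok; lia.
  have [|r re N'] := nc_pair ge fe; first by case=> k0; lia.
  have [i iE] := e_onto ge; have [j jE] := e_onto fe; have [l lE] := e_onto re.
  have [_ _ U] := real; have := U i j l; rewrite iE jE lE => /(_ N').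
  rewrite bracketE !rowK iE jE lE /= => D; eexists; move: D; rewrite {1 2}/vec /=.
  by rewrite !rmorph0 !scale0r !addr0; exact.
pose lam (e : elt) := oapp (fun i => la 0 i) 1 (insub (index e els) : option 'I_s).
have lamE i : lam (e_ i) = la 0 i by rewrite /lam /e_ index_uniq ?els_uniq // valK.
have lam_unit e : is_elt e -> is_unit (lam e) by move=> /e_onto [i <-]; rewrite lamE.
have wE e : is_elt e -> vec (ev psi (v 0 0)) (base_vec v) e =
    lam e *: (vec (ev psi' (v' 0 0)) (base_vec v') e *m g).
  move=> /e_onto [i <-]; have := congr1 (row i) E.
  by rewrite row_scaled !rowK lamE.
have [b [bu gE ww cc]] := rigidity (base_vec_basis v) (base_vec_basis v') unit_frame lam_unit wE.
have nvm := config_nv ok.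
have tt : v 0 0 = v' 0 0.
  by have := cc 2%N; rewrite !ev_t => -> //; [lia | exact: config_gate2 ok].
have vv : v = v' by apply: base_vec_inj.
split; last by exists b.
rewrite vv in cc *; congr (_, _); apply: rmorph_ext; exact: ev_inj cc.
Qed.

Lemma orb_inj (A : comPzRingType) (u u' : X A) (V : 'M[A]_(s, 3)) :
  realizes V -> orb u V -> orb u' V -> u = u'.
Proof.
move=> V_real oV; have real := orb_realizes oV V_real.
case: oV => [g [h [la [gh hg lau VE]]]] [g' [h' [la' [gh' hg' lau' VE']]]].
have [mu muE] := inverse_row lau.
have [||uu _ //] := @orb_rigid A u u' (g' *m h) (\row_i (mu 0 i * la' 0 i)) real.
  by move=> i; rewrite mxE; apply: is_unitM => //; exists (la 0 i); rewrite mulrC.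
apply/row_matrixP => i; rewrite row_scaled mxE -scalerA mulmxA.
have := congr1 (row i) VE'; rewrite {1}VE !row_scaled => E.
rewrite scalemxAl -E -scalemxAl scalerA mulrC muE scale1r.
by rewrite -mulmxA gh mulmx1.
Qed.

Section Matroid.
Variable M : rank3_matroid 'I_s.
Hypothesis M_spec : forall (A : comPzRingType) (V : 'M[A]_(s, 3)),
  is_realization M V <-> realizes V.

Definition good_locus : subfunctor X.
Proof.
refine (@Subfunctor X (fun A u => is_realization M (conf u)) _).
by move=> A B h u uU; rewrite conf_map; apply: is_realization_map.
Defined.

(** The locus is the nonvanishing set of a single function, the product of the brackets of all
    noncollinear triples. *)
Lemma good_locus_open : is_open good_locus.
Proof.
move=> A u.
pose ncol (t : 'I_s * 'I_s * 'I_s) : bool :=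
  if excluded_middle_informative (collinear (e_ t.1.1) (e_ t.1.2) (e_ t.2)) then false else true.
have ncolP p q r : reflect (~ collinear (e_ p) (e_ q) (e_ r)) (ncol (p, q, r)).
  by rewrite /ncol; case: excluded_middle_informative => C; constructor; [apply | ].
pose S := [seq t <- enum {: 'I_s * 'I_s * 'I_s} | ncol t].
pose D := \prod_(t <- S) bracket (conf u) t.1.1 t.1.2 t.2.
exists (eq D) => B h.
have -> : ideal_gen (fun b => exists2 a, D = a & b = h a) 1 <-> is_unit (h D).
  rewrite -ideal_gen_eq1; split.
    move: (1 : B) => b; elim=> [|r _ y [_ <- ->] _ IH]; constructor => //.
  by move: (1 : B) => b; elim=> [|r _ y <- _ IH]; constructor => //; exists D.
rewrite rmorph_prod prod_unit /= conf_map; split.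
  move=> /M_spec [_ _ W] [[p q] r]; rewrite mem_filter => /andP[/ncolP C _].
  by rewrite -bracket_map; apply: W.
move=> W; rewrite -conf_map; apply/M_spec/conf_realizes => p q r C.
rewrite conf_map bracket_map; apply: (W (p, q, r)).
by rewrite mem_filter mem_enum andbT; apply/ncolP.
Qed.

Lemma M_free : acts_freely M.
Proof.
move=> A [V VM] g h la gh hg lau /= E; have V_real := proj1 (M_spec V) VM.
have [u uV] := orb_exists V_real; have real := orb_realizes uV V_real.
case: uV => [B [C [mu [BC CB muu VE]]]].
(* Conjugation carries the stabilizer of [V] to that of its normal form [conf u]. *)
have [|_ [b bE]] := @orb_rigid A u u (B *m g *m C) la real lau.
  apply/row_matrixP => i; rewrite row_scaled.
  have := congr1 (row i) E; rewrite row_scaled VE row_scaled -scalemxAl scalerA mulrC -scalerA.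
  move/(scaler_unit_inj (muu i)) => Ei.
  by rewrite -[LHS]mulmx1 -BC mulmxA Ei -scalemxAl !mulmxA.
exists b; have : C *m (B *m g *m C) *m B = C *m b%:M *m B by rewrite bE.
by rewrite !mulmxA CB mul1mx -mulmxA CB mulmx1 mul_mx_scalar -scalemxAl CB scalemx1.
Qed.

Lemma orb_map (A B : comPzRingType) (k : {rmorphism A -> B}) (u : X A) V :
  orb u V -> orb (fmap k u) (map_mx k V).
Proof.
case=> [g [h [la [gh hg lau ->]]]].
exists (map_mx k g), (map_mx k h), (map_mx k la); split.
- by rewrite -map_mxM gh map_scalar_mx rmorph1.
- by rewrite -map_mxM hg map_scalar_mx rmorph1.
- by move=> i; rewrite mxE; apply: is_unit_rmorph.
- by rewrite conf_map !map_mxM map_diag_mx.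
Qed.

(** The parameters are chosen for each realization separately; functoriality follows from their
    uniqueness. *)
Definition pi_coord (A : comPzRingType) (V : realizations M A) : X A :=
  proj1_sig (constructive_indefinite_description _
    (orb_exists (proj1 (M_spec (sval V)) (svalP V)))).

Lemma pi_coordP (A : comPzRingType) (V : realizations M A) : orb (pi_coord V) (sval V).
Proof.
exact: (proj2_sig (constructive_indefinite_description _
  (orb_exists (proj1 (M_spec (sval V)) (svalP V))))).
Qed.

Lemma pi_coord_in (A : comPzRingType) (V : realizations M A) : good_locus A (pi_coord V).
Proof. by apply/M_spec/(orb_realizes (pi_coordP V))/M_spec/(svalP V). Qed.

Definition pi_fun (A : comPzRingType) (V : realizations M A) : sub_functor good_locus A :=
  exist _ (pi_coord V) (pi_coord_in V).

Lemma pi_funP (A : comPzRingType) (V : realizations M A) : orb (sval (pi_fun V)) (sval V).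
Proof. exact: pi_coordP. Qed.

Lemma pi_fun_eq (A : comPzRingType) (V : realizations M A) (u : sub_functor good_locus A) :
  orb (sval u) (sval V) -> pi_fun V = u.
Proof.
move=> uV; apply: eq_sig_hprop => [y|]; first exact: proof_irrelevance.
apply: (orb_inj (V := sval V)) => //; last exact: pi_funP.
by apply/M_spec/(svalP V).
Qed.

Definition coord_mor : morphism (realizations M) (sub_functor good_locus).
Proof.
exists pi_fun => A B h V; apply: pi_fun_eq; exact: orb_map (pi_funP V).
Defined.

Lemma orb_same (A : comPzRingType) (V W : realizations M A) (u : X A) :
  orb u (sval V) -> orb u (sval W) -> same_orbit V W.
Proof.
case=> [g [h [la [gh hg lau VE]]]] [g' [h' [la' [gh' hg' lau' WE]]]].
have [mu muE] := inverse_row lau.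
exists (h *m g'), (h' *m g), (\row_i (la' 0 i * mu 0 i)); split.
- by rewrite mulmxA -[_ *m g' *m _]mulmxA gh' mulmx1.
- by rewrite mulmxA -[_ *m g *m _]mulmxA gh mulmx1.
- by move=> i; rewrite mxE; apply: is_unitM => //; exists (la 0 i); rewrite mulrC.
apply/row_matrixP => i; rewrite VE WE !row_scaled mxE -scalemxAl scalerA -mulrA.
by rewrite [mu 0 i * _]mulrC muE mulr1 -mulmxA (mulmxA g) gh mul1mx.
Qed.

Lemma same_orb (A : comPzRingType) (V W : realizations M A) (u : X A) :
  same_orbit V W -> orb u (sval V) -> orb u (sval W).
Proof.
case=> [g [h [la [gh hg lau ->]]]] [g' [h' [la' [gh' hg' lau' ->]]]].
exists (g' *m g), (h *m h'), (\row_i (la 0 i * la' 0 i)); split.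
- by rewrite mulmxA -[_ *m g *m _]mulmxA gh mulmx1.
- by rewrite mulmxA -[_ *m h' *m _]mulmxA hg' mulmx1.
- by move=> i; rewrite mxE; apply: is_unitM.
by apply/row_matrixP => i; rewrite !row_scaled mxE -scalerA -scalemxAl !mulmxA.
Qed.

Lemma pi_same (A : comPzRingType) (V W : realizations M A) :
  same_orbit V W -> coord_mor A V = coord_mor A W.
Proof. by move=> VW; apply/esym/pi_fun_eq/(same_orb VW)/pi_funP. Qed.

(** Equal coordinates give one global orbit, and each point of the locus is the image of its own
    configuration. Only the descent of locally equal coordinates uses a cover, through
    [zariski_separated]. *)
Lemma sheaf_quotient : is_sheaf_quotient (@same_orbit s M) coord_mor.
Proof.
split=> [A V W|A u]; first split.
- move=> E; apply: zariski_globally; apply: (@orb_same _ _ _ (sval (coord_mor A V))).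
    by move: (pi_funP (fmap idfun V)); rewrite -/(pi_fun (fmap _ V)) (fmap_id _ (f := idfun)).
  by rewrite E; move: (pi_funP (fmap idfun W)); rewrite (fmap_id _ (f := idfun)).
- move=> loc; apply: eq_sig_hprop => [y|]; first exact: proof_irrelevance.
  have {}loc : zariski_locally (fun (B : comPzRingType) (h : {rmorphism A -> B}) =>
      fmap h (sval (coord_mor A V)) = fmap h (sval (coord_mor A W))).
    case: loc => D [D1 DP]; exists D; split=> // z /DP [B [h [hl VW]]]; exists B, h; split=> //.
    by have := pi_same VW; rewrite !morE => /(congr1 (@sval _ _)).
  have loc_comp (T : Type) (p : forall B : comPzRingType, X B -> T -> B) :
      (forall (B : comPzRingType) (h : {rmorphism A -> B}) (u : X A) t, p B (fmap h u) t = h (p A u t)) ->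
      forall t, p A (sval (coord_mor A V)) t = p A (sval (coord_mor A W)) t.
    move=> pE t; apply: zariski_separated.
    case: loc => D [D1 DP]; exists D; split=> // z /DP [B [h [hl VW]]]; exists B, h; split=> //.
    by rewrite -!pE VW.
  have E1 := loc_comp _ (fun (B : comPzRingType) (u : X B) i => (u.1 : 'rV[B]_N) 0 i).
  have E2 := loc_comp _ (fun (B : comPzRingType) (u : X B) r => (u.2 : {rmorphism R -> B}) r).
  rewrite [LHS]surjective_pairing [RHS]surjective_pairing; congr (_, _).
    by apply/rowP; apply: E1 => B h u t; rewrite /= mxE.
  by apply: rmorph_ext; apply: E2.
- apply: zariski_globally; exists (exist _ (conf (sval u)) (svalP u) : realizations M A).
  rewrite fmap_id //; apply: pi_fun_eq => /=.
  exists 1%:M, 1%:M, (const_mx 1); split; rewrite ?mul1mx //.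
    by move=> i; rewrite mxE; apply: is_unit1.
  by rewrite mulmx1 diag_const_mx mul1mx.
Qed.

End Matroid.

(** * The matroid of a generic configuration *)

Lemma generic_conf (K : fieldType) (psi : {rmorphism R -> K}) :
  exists u : X {fraction {poly K}}, (forall r, u.2 r = tofrac ((psi r)%:P : {poly K})) /\
  forall p q r, ~ collinear (e_ p) (e_ q) (e_ r) -> bracket (conf u) p q r != 0.
Proof.
have [c [c_size c_neq cE]] := ev_field psi.
have c_adm := field_admissible cE.
pose emb : {rmorphism {poly K} -> {fraction {poly K}}} := @tofrac {poly K}.
have emb_inj : injective emb by exact: tofrac_inj.
have [w [w0 w1 w2 wP]] := generic_configuration c_size c_adm c_neq emb_inj
   (@fraction_infinite K).
have [v [vt vw]] := base_vec_onto (emb 'X) (And3 w0 w1 w2).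
exists (v, (emb \o (polyC \o psi) : {rmorphism R -> _})); split=> // p q r nC.
have := wP _ _ _ (e_elt p) (e_elt q) (e_elt r) nC.
by rewrite bracketE !rowK /= vt !(vec_ext _ (e_elt _) vw) /vec /cF !cE.
Qed.

Lemma realizes_open : exists M : rank3_matroid 'I_s, realizes_open_of M N R.
Proof.
have [K [psi _]] := field_point R_nz; have [u [_ uP]] := generic_conf psi.
have [M MP] : exists M : rank3_matroid 'I_s, forall p q r,
    (exists2 X, X \in flats M & [&& p \in X, q \in X & r \in X]) <->
    det3 (row p (conf u)) (row q (conf u)) (row r (conf u)) = 0.
  apply: (@matroid_of_configuration _ _ (fun i => row i (conf u))) => [p q pq|].
    have [|e ee nC] := nc_pair (e_elt p) (e_elt q).
      by move/e_inj/eqP; rewrite (negPf pq).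
    by have [r rE] := e_onto ee; exists r; rewrite -bracketE; apply: uP; rewrite rE.
  have nvm := config_nv ok.
  have e0 : is_elt (0%N, (0, 0, 0)) by apply: is_elt0; lia.
  have e1 : is_elt (1%N, (0, 0, 0)) by apply: is_elt0; lia.
  have e2 : is_elt (2%N, (0, 0, 0)) by apply: is_elt0; lia.
  have [[p pE] [q qE] [r rE]] := And3 (e_onto e2) (e_onto e0) (e_onto e1).
  exists p, q, r; rewrite -bracketE; apply: uP; rewrite pE qE rE.
  by apply: nc_top.
(* The flats of M come from one configuration over one field, but since that configuration is
   generic they record exactly the universal collinearities. *)
have M_spec (A : comPzRingType) (V : 'M[A]_(s, 3)) : is_realization M V <-> realizes V.
  have flatP p q r : (exists2 X, X \in flats M & [&& p \in X, q \in X & r \in X]) <->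
      collinear (e_ p) (e_ q) (e_ r).
    rewrite MP -bracketE; split; last by move=> C; apply: conf_col.
    by move=> D; apply: Classical_Prop.NNPP => /uP; rewrite D eqxx.
  split=> -[V1 V2 V3]; split=> //.
  - by move=> p q r /flatP [X XM /and3P [pX qX rX]]; apply: V2 pX qX rX.
  - move=> p q r nC; apply: V3 => X XM; apply/negP => pqr; apply: nC.
    by apply/flatP; exists X.
  - by move=> X XM p q r pX qX rX; apply/V2/flatP; exists X => //; apply/and3P.
  - move=> p q r nX; apply: V3 => /flatP [X XM pqr].
    by have := nX X XM; rewrite pqr.
exists M, (good_locus M); split.
- exact: (good_locus_open M_spec).
(* Surjectivity: a point over K' lifts to the locus after passing to K'(t), with generic lines. *)
- move=> K' psi'; have [u' [u'E u'P]] := generic_conf psi'.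
  have u'U : good_locus M _ u'.
    apply/M_spec/(conf_realizes) => p q r /u'P nz.
    exact/is_unit_field.
  exists {fraction {poly K'}}.
  exists ((@tofrac {poly K'}) \o polyC : {rmorphism K' -> {fraction {poly K'}}}).
  by exists (exist _ u' u'U); apply: rmorph_ext => r; rewrite /= u'E.
split; first exact: (M_free M_spec).
exists (coord_mor M_spec).
exact: sheaf_quotient.
Qed.

End RealizationFunctor.

End Configuration.

Lemma ltn_predn a b : (0 < a)%N -> (a < b)%N -> (a.-1 < b.-1)%N.
Proof. lia. Qed.

(** * Elementary monic data *)

Section ConfigurationOfData.
Variables (n : nat) (D : elementary_monic_data n).
Notation S := {mpoly int[n]}.
Notation L := {poly S}.
Notation st := (emr_steps D).
Notation vr := (emr_var D).
Notation nL := (n + size st)%N.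
Notation es := (enum (emr_eqs D)).
Notation ns := (enum (emr_ineqs D)).

Let nv := nL.+3.
Let m := (nv + size es + size ns)%N.

Definition val_line (g : nat) : L := if g is j.+2 then vr j else 1.
Definition deg_line (g : nat) : nat := (size (val_line g)).-1.

Definition step_gate (c : step) : gate :=
  match c with
  | Mul k l => if k == l then GSqr k.+2 else GMul k.+2 l.+2
  | Add k l => if (size (vr k) < size (vr l))%N then GAdd l.+2 k.+2 else GAdd k.+2 l.+2
  | Incr k => GAdd k.+2 1
  end.

Definition pre_gate (g : nat) : gate :=
  match g with
  | 0 => GInf
  | 1 => GUnit
  | j.+2 =>
    if (j <= n)%N then GVar
    else if (j <= nL)%N then step_gate (nth (Incr 0) st (j - n.+1))
    else if (j < nL.+1 + size es)%N then
      let p := nth (ord0, ord0) es (j - nL.+1) in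
      GEq p.1.+2 (if p.1 == p.2 then 1%N else p.2.+2)
    else let p := nth (ord0, ord0) ns (j - (nL.+1 + size es)) in GNeq p.1.+2 p.2.+2
  end.

Definition gate_at (g : nat) : gate :=
  if pre_gate g is GAdd k l then
    if uses (pre_gate k) l then GAdd' k l else GAdd k l
  else pre_gate g.

Lemma uses_gate g l : uses (gate_at g) l = uses (pre_gate g) l.
Proof. by rewrite /gate_at; case: (pre_gate g) => // k' l'; case: ifP. Qed.

Lemma gate_at_var j : (j <= n)%N -> gate_at j.+2 = GVar.
Proof. by rewrite /gate_at /= => ->. Qed.

Lemma gate_at_step j : (n < j <= nL)%N ->
  pre_gate j.+2 = step_gate (nth (Incr 0) st (j - n.+1)).
Proof. by case/andP=> nj jL; rewrite /= leqNgt nj jL. Qed.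

Lemma gate_at_eq i : (i < size es)%N -> let p := nth (ord0, ord0) es i in
  gate_at (nv + i) = GEq p.1.+2 (if p.1 == p.2 then 1%N else p.2.+2).
Proof.
move=> ie; have -> : (nv + i = (nL.+1 + i).+2)%N by rewrite /nv; lia.
have h1 : (nL.+1 + i <= n)%N = false by lia.
have h2 : (nL.+1 + i <= nL)%N = false by lia.
have h3 : (nL.+1 + i < nL.+1 + size es)%N by lia.
by rewrite /gate_at /pre_gate h1 h2 h3 addKn.
Qed.

Lemma gate_at_neq i : let p := nth (ord0, ord0) ns i in
  gate_at (nv + size es + i) = GNeq p.1.+2 p.2.+2.
Proof.
have -> : (nv + size es + i = (nL.+1 + size es + i).+2)%N by rewrite /nv; lia.
have h1 : (nL.+1 + size es + i <= n)%N = false by lia.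
have h2 : (nL.+1 + size es + i <= nL)%N = false by lia.
have h3 : (nL.+1 + size es + i < nL.+1 + size es)%N = false by lia.
by rewrite /gate_at /pre_gate h1 h2 h3 addKn.
Qed.

Lemma two_neq0 : (1 + 1 : S) != 0.
Proof.
apply/eqP => /(congr1 (fun p : S => p@_0%MM)).
by rewrite mcoeffD mcoeff1 eqxx mcoeff0.
Qed.

Lemma vr_monic j : (j <= nL)%N -> vr j \is monic.
Proof.
move=> jL; have [jn|jn] := leqP j n; last by apply: emr_monic; rewrite jn.
case: j jL jn => [|j] jL jn; first by rewrite emr_var0 monicX.
rewrite (emr_var_free D (Ordinal jn)) addrC -[_%:P]opprK -polyCN; exact: monicXsubC.
Qed.

(** For equal degrees the sum would have leading coefficient 2, which is neither 0 nor 1 in Z[y]. *)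
Lemma monic_add_size (p q : L) : p \is monic -> q \is monic -> p + q \is monic ->
  size p != size q.
Proof.
move=> /monicP p1 /monicP q1 /monicP pq1; apply/eqP => pq.
have c2 : (p + q)`_(size p).-1 = 1 + 1.
  by rewrite coefD -/(lead_coef p) p1 pq -/(lead_coef q) q1.
have [le|gt] := leqP (size p) (size (p + q)).
  have e : size (p + q) = size p.
    by apply/eqP; rewrite eqn_leq le andbT (leq_trans (size_polyD _ _)) // pq maxnn.
  move: pq1; rewrite lead_coefE e c2 => /eqP.
  by rewrite -subr_eq0 addrK oner_eq0.
move: c2; rewrite nth_default; last by case: (size p) gt.
by move/esym/eqP; rewrite (negPf two_neq0).
Qed.

Lemma size_vr j : (j <= nL)%N -> (1 < size (vr j))%N.
Proof.
elim/ltn_ind: j => j IH jL; have [jn|jn] := leqP j n.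
  case: j {IH} jL jn => [|j] jL jn; first by rewrite emr_var0 size_polyX.
  by rewrite (emr_var_free D (Ordinal jn)) addrC size_XaddC.
have jr : (n < j <= nL)%N by rewrite jn.
have jm := vr_monic jL; have := emr_var_step jr; case: nth => [k l [kj lj E]|k l [kj lj E]|k [kj E]].
- have km : vr k \is monic by apply: vr_monic; lia.
  have lm : vr l \is monic by apply: vr_monic; lia.
  have := monic_add_size km lm; rewrite -E => /(_ jm) kl.
  have k1 := IH k kj (leq_trans (ltnW kj) jL); have l1 := IH l lj (leq_trans (ltnW lj) jL).
  rewrite E; have [lt|gt|eq] := ltngtP (size (vr k)) (size (vr l)).
  + by rewrite addrC size_polyDl.
  + by rewrite size_polyDl.
  + by rewrite eq eqxx in kl.
- have km : vr k \is monic by apply: vr_monic; lia.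
  have lm : vr l \is monic by apply: vr_monic; lia.
  have k1 := IH k kj (leq_trans (ltnW kj) jL); have l1 := IH l lj (leq_trans (ltnW lj) jL).
  by rewrite E size_proper_mul ?(monicP km) ?(monicP lm) ?mulr1 ?oner_neq0 //; lia.
- have k1 := IH k kj (leq_trans (ltnW kj) jL).
  by rewrite E size_polyDl // size_poly1.
Qed.

Variables (R B : comPzRingType) (f : {rmorphism S -> B}) (g : {rmorphism B -> R}).
Hypothesis f_loc : is_localization (emr_differences (emr_ineqs D)) f.
Hypothesis g_quo : is_quotient_ring
  (fun b => exists2 c, emr_differences (emr_eqs D) c & b = f c) g.
Hypothesis R_nz : (1 : R) <> 0.

(** Otherwise 0 would be inverted and R would be zero. *)
Lemma ineq_neq p : p \in emr_ineqs D -> p.1 != p.2.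
Proof.
move=> pI; apply/eqP => e; apply: R_nz.
have [|y] := quotient_rmorph_unit g f_loc (d := 0).
  by exists p; rewrite // e subrr polyC0.
by rewrite !rmorph0 mul0r => <-.
Qed.

Lemma size_vr_const j k c : (j <= nL)%N -> (k <= nL)%N -> vr j - vr k = c%:P ->
  size (vr j) = size (vr k).
Proof.
move=> jL kL /eqP; rewrite subr_eq addrC => /eqP ->; apply: size_polyDl.
by apply: leq_ltn_trans (size_polyC_leq1 _) (size_vr kL).
Qed.

Lemma step_gate_ok j : (n < j <= nL)%N -> gate_ok val_line gate_at nv deg_line j.+2.
Proof.
move=> jr; have jn : (j.+2 < nv)%N by rewrite /nv; lia.
have add k l : (k < j)%N -> (0 < l < j.+2)%N -> pre_gate j.+2 = GAdd k.+2 l ->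
    val_line j.+2 = val_line k.+2 + val_line l -> (deg_line l < deg_line k.+2)%N ->
    gate_ok val_line gate_at nv deg_line j.+2.
  move=> kj lj E xE dlk; rewrite /gate_ok /gate_at E.
  have kr : (2 <= k.+2 < j.+2)%N by lia.
  have jr' : (2 <= j.+2 < nv)%N by rewrite jn andbT.
  by case: ifP => u; split=> //; split=> //; rewrite uses_gate u.
have := gate_at_step jr; have := emr_var_step jr.
case: nth => [k l [kj lj E]|k l [kj lj E]|k [kj E]]; rewrite /step_gate.
- have kL : (k <= nL)%N by lia.
  have lL : (l <= nL)%N by lia.
  have jL : (j <= nL)%N by lia.
  have k1 := size_vr kL; have l1 := size_vr lL.
  have kl : size (vr k) != size (vr l).
    by apply: monic_add_size; rewrite -?E; apply: vr_monic.
  case: ltnP => lt G.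
    apply: (add l k.+2) => //; first by rewrite /= E addrC.
    by apply: ltn_predn => //; apply: ltnW.
  apply: (add k l.+2) => //; apply: ltn_predn; first exact: ltnW.
  by rewrite ltn_neqAle eq_sym kl.
- case: eqVneq => [kl|kl] G; rewrite /gate_ok /gate_at G.
    by split=> //; rewrite /= ?E -?kl //; lia.
  by split=> //=; try lia; case=> e; rewrite e eqxx in kl.
- move=> G; have k1 := @size_vr k.
  apply: (add k 1%N) => //.
  by apply: ltn_predn; rewrite /= size_poly1 // k1 //; lia.
Qed.

Lemma data_config_ok : config_ok val_line gate_at m nv deg_line.
Proof.
have jL (p : 'I_nL.+1 * 'I_nL.+1) : (p.1 <= nL)%N /\ (p.2 <= nL)%N.
  by have := ltn_ord p.1; have := ltn_ord p.2; lia.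
split=> //.
- by rewrite /nv /m; lia.
- move=> k km; have [kv|kv] := ltnP k nv.
    case: k km kv => [//|[//|j]] _ kv; have [jn|jn] := leqP j n.
      by rewrite /gate_ok gate_at_var //; rewrite kv.
    by apply: step_gate_ok; rewrite /nv in kv; lia.
  have [ke|ke] := ltnP k (nv + size es).
    have := @gate_at_eq (k - nv); rewrite subnKC // => E; rewrite /gate_ok E; last by lia.
    have [p1 p2] := jL (nth (ord0, ord0) es (k - nv)).
    case: eqVneq => [_|ne]; split=> //; rewrite /nv; try lia.
    by case=> /val_inj e; rewrite e eqxx in ne.
  have := gate_at_neq (k - (nv + size es)); rewrite subnKC // => E; rewrite /gate_ok E.
  have pI : nth (ord0, ord0) ns (k - (nv + size es)) \in emr_ineqs D.
    by rewrite -mem_enum mem_nth // ltn_subLR.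
  move: (nth _ _ _) pI => p pI; have [p1 p2] := jL p.
  split=> //; rewrite /nv; try lia.
    by have := ineq_neq pI => /eqP ne; case=> /val_inj.
  have [|c cE] := emr_constant (jk := p); first by rewrite inE pI orbT.
  by rewrite /deg_line /=; congr _.-1; apply: size_vr_const cE.
- by rewrite /deg_line /= size_poly1.
- move=> [|[|j]] // jv; have jn : (j <= nL)%N by rewrite /nv in jv; lia.
  exact: (@ltn_predn 1 _ isT (size_vr jn)).
Qed.

Lemma size_tails_step j : (n < j <= nL)%N ->
  size (tails val_line gate_at j.+2) =
    (if is_mul (nth (Incr 0) st (j - n.+1)) then 6 else 7)%N.
Proof.
move=> jr; rewrite /tails /gate_at (gate_at_step jr).
by case: nth => [k l|k l|k] /=; repeat case: ifP.
Qed.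

Lemma size_all_elts : size (all_elts val_line gate_at m) =
  (3 * n + 7 * count is_add st + 7 * count is_incr st + 6 * count is_mul st
   + 5 * #|emr_eqs D| + 6 * #|emr_ineqs D| + 6)%N.
Proof.
rewrite /all_elts size_allpairs_dep !cardE.
have -> : m = (2 + (n.+1 + (size st + (size es + size ns))))%N by rewrite /m /nv; lia.
rewrite !iotaD !map_cat !sumn_cat !add0n.
have const k l z : (forall i, (k <= i < k + l)%N -> size (tails val_line gate_at i) = z) ->
    sumn [seq size (tails val_line gate_at i) | i <- iota k l] = (z * l)%N.
  elim: l k => [|l IHl] k kz /=; first by rewrite muln0.
  rewrite IHl ?kz ?mulnS // => [|i il]; first by lia.
  by apply: kz; lia.
have -> : sumn [seq size (tails val_line gate_at i) | i <- iota 0 2] = 3 by [].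
rewrite (@const 2 n.+1 3); last first.
  case=> [|[|j]] jr; try lia.
  by rewrite /tails gate_at_var //; lia.
rewrite (@const _ (size es) 5); last first.
  move=> i ir; have := @gate_at_eq (i - nv); rewrite subnKC /nv; last by lia.
  by move=> E; rewrite /tails E //; lia.
rewrite (@const _ (size ns) 6); last first.
  move=> i ir; have := gate_at_neq (i - (nv + size es)); rewrite subnKC /nv; last by lia.
  by move=> E; rewrite /tails E.
have -> : sumn [seq size (tails val_line gate_at i) | i <- iota (2 + n.+1) (size st)] =
    sumn [seq (if is_mul c then 6 else 7)%N | c <- st].
  congr sumn; apply: (@eq_from_nth _ 0%N) => [|i]; rewrite !size_map size_iota // => ist.
  rewrite (nth_map 0%N) ?size_iota // (nth_map (Incr 0)) // nth_iota //.
  have -> : (2 + n.+1 + i = (n.+1 + i).+2)%N by lia.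
  by rewrite size_tails_step ?addKn //; lia.
have -> : sumn [seq (if is_mul c then 6 else 7)%N | c <- st] =
    (7 * count is_add st + 7 * count is_incr st + 6 * count is_mul st)%N.
  by elim: st => //= c s ->; case: c => *; rewrite /=; lia.
lia.
Qed.

Lemma num_params : (3 * (m - 3)).+1 =
  (3 * (n + count is_add st + count is_incr st + count is_mul st
        + #|emr_eqs D| + #|emr_ineqs D|) + 1)%N.
Proof.
have mE : (m - 3 = n + size st + size es + size ns)%N by rewrite /m /nv; lia.
have sE : size st = (count is_add st + count is_incr st + count is_mul st)%N.
  by elim: st => //= c s ->; case: c => *; rewrite /=; lia.
rewrite mE !cardE; lia.
Qed.

Section Point.
Variables (A : comPzRingType) (psi : {rmorphism R -> A}) (t : A).

Definition data_ev : {rmorphism L -> A} :=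
  proj1_sig (constructive_indefinite_description _ (evp_rmorph (psi \o (g \o f)) t)).

Lemma data_evE p : data_ev p = evp (psi \o (g \o f)) t p.
Proof.
exact: (proj2_sig (constructive_indefinite_description _ (evp_rmorph (psi \o (g \o f)) t))).
Qed.

Lemma data_evC c : data_ev c%:P = psi (g (f c)).
Proof. by rewrite data_evE evpC. Qed.

Lemma data_evX : data_ev 'X = t.
Proof. by rewrite data_evE evpX. Qed.

End Point.

Lemma poly_rmorph_ext (A : comPzRingType) (c c' : {rmorphism L -> A}) :
  c 'X = c' 'X -> (forall a, c a%:P = c' a%:P) -> c =1 c'.
Proof.
move=> cX cC p; rewrite -[p]coefK poly_def !rmorph_sum; apply: eq_bigr => i _.
by rewrite -mul_polyC !rmorphM !rmorphXn /= cX cC.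
Qed.

Lemma gate_at_value k : (k < nv)%N -> if gate_at k is (GEq _ _ | GNeq _ _) then False else True.
Proof.
case: k => [//|[//|j]] kv; have [jn|jn] := leqP j n; first by rewrite gate_at_var.
rewrite /gate_at gate_at_step; last by rewrite /nv in kv; lia.
by case: nth => [? ?|? ?|?] /=; repeat case: ifP.
Qed.

Lemma admissible_eqs (A : comPzRingType) (c : {rmorphism L -> A}) :
  admissible val_line gate_at m c <->
  forall e, emr_differences (emr_eqs D) e -> c e%:P = 0.
Proof.
split=> [adm e [p pE <-]|H k k1 k2 km E].
  have ip : (index p es < size es)%N by rewrite index_mem mem_enum.
  have := gate_at_eq ip; rewrite nth_index ?mem_enum // => E.
  have [|l1|] := adm _ _ _ _ E; first by rewrite /m; lia.
    by move: l1; case: eqVneq => [-> _|//]; rewrite subrr rmorph0.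
  by case: eqVneq => [->|_] /= cE; rewrite rmorphB ?subrr // cE subrr.
have [kv|kv] := ltnP k nv.
  by have := gate_at_value kv; rewrite E.
have [ke|ke] := ltnP k (nv + size es); last first.
  by have := gate_at_neq (k - (nv + size es)); rewrite subnKC // E.
have := @gate_at_eq (k - nv); rewrite subnKC // E ltn_subLR // ke => /(_ isT) [-> ->].
set p := nth _ _ _; case: eqVneq => [_|_]; [by left | right].
have pE : p \in emr_eqs D by rewrite -mem_enum mem_nth // ltn_subLR.
have [|e eE] := emr_constant (jk := p); first by rewrite inE pE.
by apply/eqP; rewrite -subr_eq0 -rmorphB /= eE H //; exists p.
Qed.

Lemma neq_ineqs (A : comPzRingType) (c : {rmorphism L -> A}) k k1 k2 : (k < m)%N ->
  gate_at k = GNeq k1 k2 ->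
  exists2 e, emr_differences (emr_ineqs D) e & c (val_line k1) - c (val_line k2) = c e%:P.
Proof.
move=> km E; have [kv|kv] := ltnP k nv.
  by have := gate_at_value kv; rewrite E.
have [ke|ke] := ltnP k (nv + size es).
  by have := @gate_at_eq (k - nv); rewrite subnKC // E ltn_subLR // ke => /(_ isT).
have := gate_at_neq (k - (nv + size es)); rewrite subnKC // E => -[-> ->].
set p := nth _ _ _.
have pI : p \in emr_ineqs D by rewrite -mem_enum mem_nth // ltn_subLR.
have [|e eE] := emr_constant (jk := p); first by rewrite inE pI orbT.
by exists e; [exists p | rewrite /= -eE rmorphB].
Qed.

Lemma ineqs_neq (A : comPzRingType) (c : {rmorphism L -> A}) :
  (forall k k1 k2, (k < m)%N -> gate_at k = GNeq k1 k2 ->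
     is_unit (c (val_line k1) - c (val_line k2))) ->
  forall e, emr_differences (emr_ineqs D) e -> is_unit (c e%:P).
Proof.
move=> H e [p pI <-]; have ip : (index p ns < size ns)%N by rewrite index_mem mem_enum.
have := gate_at_neq (index p ns); rewrite nth_index ?mem_enum // => E.
by rewrite rmorphB; apply: (H _ _ _ _ E); rewrite /m; lia.
Qed.

Lemma data_realizes_open : exists M : rank3_matroid
     'I_(3 * n + 7 * count is_add st + 7 * count is_incr st + 6 * count is_mul st
         + 5 * #|emr_eqs D| + 6 * #|emr_ineqs D| + 6),
  realizes_open_of M (3 * (n + count is_add st + count is_incr st + count is_mul st
        + #|emr_eqs D| + #|emr_ineqs D|) + 1) R.
Proof.
rewrite -num_params -size_all_elts.
have gvar k : (k < m)%N -> gate_at k = GVar -> exists2 j, k = j.+2 & (j <= n)%N.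
  move=> km; case: k km => [//|[//|j]] jm E; exists j => //; rewrite leqNgt; apply/negP => jn.
  have [jL|jL] := leqP j nL.
    move: E; rewrite /gate_at gate_at_step ?jn //.
    by case: nth => [? ?|? ?|?] /=; repeat case: ifP.
  have jv : (nv <= j.+2)%N by rewrite /nv.
  have [ke|ke] := ltnP j.+2 (nv + size es).
    by have := @gate_at_eq (j.+2 - nv); rewrite subnKC // E ltn_subLR // ke => /(_ isT).
  by have := gate_at_neq (j.+2 - (nv + size es)); rewrite subnKC // E.
have vfree (i : 'I_n) : vr i.+1 = ('X_i)%:P + 'X := emr_var_free D i.
apply: (realizes_open data_config_ok R_nz (ev := data_ev)).
- move=> A A' h psi psi' t p psiE; rewrite !data_evE -evp_map.
  by apply: eq_bigr => i _; rewrite /= psiE.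
- by move=> A psi t; rewrite /= emr_var0 data_evX.
- move=> A psi psi' t E; apply: (quotient_rmorph_ext f_loc g_quo).
  apply: (@mpoly_rmorph_ext n A (psi \o (g \o f)) (psi' \o (g \o f))) => i /=.
  have := E i.+3; rewrite gate_at_var //= vfree !rmorphD /= !data_evX !data_evC.
  move=> /(_ _ erefl) H; apply: (addIr t); apply: H.
  by have := ltn_ord i; rewrite /m /nv; lia.
- move=> A c adm neq.
  have [||psi psiE] := quotient_rmorph_exists f_loc g_quo (phi := c \o polyC).
  + by move=> e eI; apply: ineqs_neq eI.
  + by move=> e eE; move/admissible_eqs: adm; apply.
  exists psi; apply: poly_rmorph_ext => [|a]; first by rewrite /= data_evX emr_var0.
  by rewrite data_evC psiE.
- move=> A psi t; apply/admissible_eqs => e eE; rewrite data_evC.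
  by rewrite (quotient_rmorph_eq0 g_quo eE) rmorph0.
- move=> A y; have [phi phiE] := mpoly_rmorph_exists (fun i : 'I_n => y i.+3 - y 2%N).
  have [c cE] := evp_rmorph phi (y 2%N); exists c => k km /(gvar _ km) [[|j] -> jn] /=.
    by rewrite emr_var0 cE evpX.
  by rewrite (vfree (Ordinal jn)) cE evpD evpX evpC phiE subrK.
(* Coefficients are mapped to K and t is kept as an indeterminate; degrees survive because the x_j
   are monic. *)
- move=> K psi; have phi1 : (psi \o (g \o f)) 1 = 1 by rewrite rmorph1.
  exists (map_poly (psi \o (g \o f))); split.
  + move=> [//|[|j]] kr; first by rewrite /= rmorph1 /deg_line /= !size_poly1.
    have jL : (j <= nL)%N by rewrite /nv in kr; lia.
    rewrite /= /deg_line /= prednK ?(ltnW (size_vr jL)) // size_map_poly_id0 //.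
    by rewrite (monicP (vr_monic jL)) phi1 oner_neq0.
  + move=> k k1 k2 km E H.
    have [e eI /eqP] := neq_ineqs (map_poly (psi \o (g \o f))) km E.
    rewrite H subrr eq_sym /= map_polyC polyC_eq0 => /eqP e0.
    have := is_unit_rmorph psi (quotient_rmorph_unit g f_loc eI).
    by move=> /is_unit_field; rewrite -[psi _]/((psi \o (g \o f)) e) e0 eqxx.
  + move=> F emb p; rewrite -[RHS]/((emb \o map_poly (psi \o (g \o f))) p).
    apply: poly_rmorph_ext => [|a]; first by rewrite /= data_evX map_polyX.
    by rewrite data_evC /= map_polyC.
Qed.

End ConfigurationOfData.

(** * The zero ring *)

(** Pappus' theorem over a ring, with unit brackets as nondegeneracy conditions. In the basis v1,
    v2, v4 it becomes a polynomial identity. *)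
Lemma pappus (A : comPzRingType) (v1 v2 v3 v4 v5 v6 v7 v8 v9 : 'rV[A]_3) :
  is_unit (det3 v1 v2 v4) -> is_unit (det3 v1 v2 v5) -> is_unit (det3 v1 v2 v6) ->
  is_unit (det3 v2 v4 v3) ->
  det3 v1 v2 v3 = 0 -> det3 v4 v5 v6 = 0 -> det3 v1 v5 v7 = 0 -> det3 v2 v4 v7 = 0 ->
  det3 v1 v6 v8 = 0 -> det3 v3 v4 v8 = 0 -> det3 v2 v6 v9 = 0 -> det3 v3 v5 v9 = 0 ->
  det3 v7 v8 v9 = 0.
Proof.
move=> u124 u125 u126 u243 d123 d456 d157 d247 d168 d348 d269 d359.
pose B := \matrix_(i < 3) (if i == i0 then v1 else if i == i1 then v2 else v4) : 'M[A]_3.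
have detB : \det B = det3 v1 v2 v4 by rewrite det_mx33 !rowK.
have [y By] : is_unit (\det B) by rewrite detB.
pose C := y *: \adj B.
have BC : B *m C = 1%:M by rewrite -scalemxAr mul_mx_adj scale_scalar_mx mulrC By.
have Cu : is_unit (\det C).
  by apply: (@is_unit_inv _ (\det B)); rewrite -det_mulmx BC det1.
have rowC i : row i B *m C = delta_mx 0 i by rewrite -row_mul BC row1.
have e1 : v1 *m C = delta_mx 0 i0 by rewrite -(rowC i0) rowK.
have e2 : v2 *m C = delta_mx 0 i1 by rewrite -(rowC i1) rowK.
have e4 : v4 *m C = delta_mx 0 i2 by rewrite -(rowC i2) rowK.
have U u v w : is_unit (det3 u v w) -> is_unit (det3 (u *m C) (v *m C) (w *m C)).
  by rewrite det3_mulmx => /is_unitM; apply.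
have Z u v w : det3 u v w = 0 -> det3 (u *m C) (v *m C) (w *m C) = 0.
  by rewrite det3_mulmx => ->; rewrite mul0r.
apply: (is_unit_eq0 Cu); rewrite mulrC -det3_mulmx.
move/Z: d123; move/Z: d456; move/Z: d157; move/Z: d247; move/Z: d168; move/Z: d348.
move/Z: d269; move/Z: d359; move/U: u125; move/U: u126; move/U: u243.
rewrite e1 e2 e4 /det3; move: (v3 *m C) (v5 *m C) (v6 *m C) => {v3}v3 {v5}v5 {v6}v6.
move: (v7 *m C) (v8 *m C) (v9 *m C) => {v7}v7 {v8}v8 {v9}v9.
rewrite !mxE /= !(mul0r, mulr0, mul1r, mulr1, subr0, sub0r, addr0, add0r, oppr0, opprK).
move: (v3 0 i0) (v3 0 i1) (v3 0 i2) (v5 0 i0) (v5 0 i1) (v5 0 i2) => a b w p q r.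
move: (v6 0 i0) (v6 0 i1) (v6 0 i2) (v7 0 i0) (v7 0 i1) (v7 0 i2) => x6 y6 z6 x7 y7 z7.
move: (v8 0 i0) (v8 0 i1) (v8 0 i2) (v9 0 i0) (v9 0 i1) (v9 0 i2) => x8 y8 z8 x9 y9 z9.
move=> au zu ru h359 h269 h348 h168 x0 h157 h456 w0; rewrite {}x0 {}w0 in h359 *.
have H1 : a * (q * z9 - r * y9) - b * (p * z9 - r * x9) = 0 by rewrite -[RHS]h359; ring.
have H2 : z6 * x9 - x6 * z9 = 0 by rewrite -[RHS]h269; ring.
have H3 : b * x8 - a * y8 = 0 by rewrite -[RHS]h348; ring.
apply: (is_unit_eq0 (is_unitM (is_unitM au zu) ru)).
(* The certificate: the unit a z6 r times the bracket of v7, v8, v9 is a combination of the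
   incidence relations. *)
transitivity (a * z6 * (q * z7 - r * y7) * (x8 * z9 - z8 * x9)
  - z7 * z6 * (x8 * (a * (q * z9 - r * y9) - b * (p * z9 - r * x9))
               + (b * x8 - a * y8) * (p * z9 - r * x9))
  + z7 * a * (q * z8 * (z6 * x9 - x6 * z9) + p * z9 * (y6 * z8 - z6 * y8)
              - z8 * z9 * (p * y6 - q * x6))); first by ring.
by rewrite H1 H2 H3 h168 h157 h456; ring.
Qed.

(** The Pappus configuration without its ninth line through 6, 7 and 8. *)
Definition pappus_blocks : seq (seq nat) :=
  [:: [:: 0; 1; 2]; [:: 3; 4; 5]; [:: 0; 4; 6]; [:: 1; 3; 6]; [:: 0; 5; 7]; [:: 2; 3; 7];
      [:: 1; 5; 8]; [:: 2; 4; 8]]%N.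

Section NonPappus.

Definition pappus_through (x y : nat) := [seq b <- pappus_blocks | (x \in b) && (y \in b)].
(** Two points on no common block span a line with no further points; in particular points of index
    9 and above are in general position, so the number of elements can be chosen freely. *)
Definition pappus_line (x y z : nat) : bool :=
  if pappus_through x y is b :: _ then z \in b else (z == x) || (z == y).

Lemma pappus_through_unique (x y : nat) (b b' : seq nat) : x != y ->
  b \in pappus_blocks -> b' \in pappus_blocks ->
  x \in b -> y \in b -> x \in b' -> y \in b' -> b = b'.
Proof.
move=> xy bP b'P xb yb xb' yb'.
have /allP /(_ _ bP) /allP /(_ _ b'P) : all (fun b : seq nat => all (fun b' : seq nat =>
  (b == b') || (size (undup [seq z <- b | z \in b']) <= 1)%N) pappus_blocks) pappus_blocks by [].
case/orP=> [/eqP //|]; rewrite leqNgt => /negP []; apply: (@uniq_leq_size _ [:: x; y]); first by rewrite /= inE xy.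
by move=> z; rewrite !inE mem_undup mem_filter => /orP[] /eqP ->; apply/andP.
Qed.

Lemma pappus_line_l x y : pappus_line x y x.
Proof.
rewrite /pappus_line; case E: (pappus_through x y) => [|b s]; first by rewrite eqxx.
have : b \in pappus_through x y by rewrite E inE eqxx.
by rewrite mem_filter => /andP[/andP[]].
Qed.

Lemma pappus_line_sym x y z : pappus_line x y z = pappus_line y x z.
Proof.
rewrite /pappus_line (_ : pappus_through x y = pappus_through y x).
  by case: (pappus_through y x) => //; rewrite orbC.
by apply: eq_filter => b; rewrite andbC.
Qed.

Lemma pappus_line_eq p q x y z : x != y -> pappus_line p q x -> pappus_line p q y ->
  pappus_line p q z = pappus_line x y z.
Proof.
move=> xy; rewrite {1 2 3}/pappus_line; case E: (pappus_through p q) => [|b s].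
  move=> /orP[] /eqP xE /orP[] /eqP yE; rewrite xE yE.
  - by rewrite xE yE eqxx in xy.
  - by rewrite /pappus_line E.
  - by rewrite pappus_line_sym /pappus_line E.
  - by rewrite xE yE eqxx in xy.
move=> xb yb; have bP : b \in pappus_blocks.
  by have : b \in pappus_through p q; [rewrite E inE eqxx | rewrite mem_filter => /andP[]].
rewrite /pappus_line; case E': (pappus_through x y) => [|b' s'].
  by have : b \in pappus_through x y; [rewrite mem_filter xb yb | rewrite E'].
have : b' \in pappus_through x y by rewrite E' inE eqxx.
rewrite mem_filter => /andP[/andP[xb' yb'] b'P].
by rewrite (pappus_through_unique xy bP b'P xb yb xb' yb').
Qed.

Variable s : nat.
Hypothesis s_ge : (9 <= s)%N.

Lemma pappus_matroid : exists M : rank3_matroid 'I_s, forall p q r : 'I_s,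
  (exists2 F, F \in flats M & [&& p \in F, q \in F & r \in F]) <->
  (p == q) || pappus_line p q r.
Proof.
apply: matroid_of_lines => [p q|p q|p q x y z _|].
- exact: pappus_line_l.
- by rewrite pappus_line_sym pappus_line_l.
- exact: pappus_line_eq.
pose o k (ks : (k < 9)%N) := Ordinal (leq_trans ks s_ge).
by exists (@o 0 isT), (@o 1 isT), (@o 3 isT).
Qed.

(** The bracket of 6, 7, 8 must be a unit in a realization, whereas Pappus' theorem makes it 0. *)
Lemma unrealizable_matroid : exists M : rank3_matroid 'I_s,
  forall (A : comPzRingType) (V : 'M[A]_(s, 3)), is_realization M V -> (1 : A) = 0.
Proof.
have [M MP] := pappus_matroid; exists M => A V [_ col ncol].
pose o k (ks : (k < 9)%N) := Ordinal (leq_trans ks s_ge).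
pose v k ks := row (@o k ks) V.
have C i j k (i9 : (i < 9)%N) (j9 : (j < 9)%N) (k9 : (k < 9)%N) :
    pappus_line i j k -> det3 (v i i9) (v j j9) (v k k9) = 0.
  move=> l; have [|F FM /and3P [pF qF rF]] := (MP (o i i9) (o j j9) (o k k9)).2.
    by rewrite l orbT.
  by rewrite -bracketE; apply: col pF qF rF.
have N i j k (i9 : (i < 9)%N) (j9 : (j < 9)%N) (k9 : (k < 9)%N) :
    ~~ ((i == j) || pappus_line i j k) -> is_unit (det3 (v i i9) (v j j9) (v k k9)).
  move=> /negP l; rewrite -bracketE; apply: ncol => F FM; apply/negP => pqr; apply: l.
  by apply/(MP (o i i9) (o j j9) (o k k9)); exists F.
have [y] := N 6 7 8 isT isT isT isT.
rewrite (pappus (N 0 1 3 isT isT isT isT) (N 0 1 4 isT isT isT isT) (N 0 1 5 isT isT isT isT)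
  (N 1 3 2 isT isT isT isT) (C 0 1 2 isT isT isT isT) (C 3 4 5 isT isT isT isT)
  (C 0 4 6 isT isT isT isT) (C 1 3 6 isT isT isT isT) (C 0 5 7 isT isT isT isT)
  (C 2 3 7 isT isT isT isT) (C 1 5 8 isT isT isT isT) (C 2 4 8 isT isT isT isT)).
by rewrite mul0r => <-.
Qed.

End NonPappus.

(** Over nonzero rings both sides are empty, and over the zero ring all points coincide. *)
Lemma zero_ring_realizes_open (R : comPzRingType) (s N : nat) : (1 : R) = 0 -> (9 <= s)%N ->
  exists M : rank3_matroid 'I_s, realizes_open_of M N R.
Proof.
move=> R0 s9; have [M MP] := unrealizable_matroid s9; exists M.
pose X := prod_functor (affine_space N) (Spec R).
have XA (A : comPzRingType) (u : X A) : (1 : A) = 0 by exact: rmorph_trivial u.2 R0.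
have MA (A : comPzRingType) (V : realizations M A) : (1 : A) = 0 := MP A _ (svalP V).
have mx_eq (A : comPzRingType) k l (a b : 'M[A]_(k, l)) : (1 : A) = 0 -> a = b.
  by move=> A0; apply/matrixP => i j; apply: trivial_ring.
have rm_eq (A : comPzRingType) (a b : {rmorphism R -> A}) : (1 : A) = 0 -> a = b.
  by move=> A0; apply: rmorph_ext => r; apply: trivial_ring.
pose U : subfunctor X := @Subfunctor X (fun A u => True) (fun _ _ _ _ _ => I).
have U_eq (A : comPzRingType) (u u' : sub_functor U A) : u = u'.
  apply: eq_sig_hprop => [y|]; first exact: proof_irrelevance.
  have A0 := XA A (sval u); rewrite [LHS]surjective_pairing [RHS]surjective_pairing.
  by congr (_, _); [apply: mx_eq | apply: rm_eq].
have M_ex (A : comPzRingType) : (1 : A) = 0 -> is_realization M (0 : 'M[A]_(s, 3)).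
  move=> A0; have tr (x y : A) : x = y by exact: trivial_ring.
  by split=> [i|F _ p q r _ _ _|p q r _]; [exists 0; apply: mx_eq | apply: tr | exists 0; apply: tr].
exists U; split.
- move=> A u; exists (fun=> True) => B f; split=> // _.
  rewrite (_ : 1 = 0); first exact: ideal_gen0.
  by apply: rmorph_trivial f _; apply: XA u.
- move=> K y; have K0 : (1 : K) = 0 := rmorph_trivial y R0.
  by have := oner_neq0 K; rewrite K0 eqxx.
split.
  by move=> A V g h la _ _ _ _; exists 0; apply: mx_eq; apply: MA V.
have pt (A : comPzRingType) (V : realizations M A) : exists u : X A, True.
  by have [f _] := @trivial_rmorph R A (MA A V); exists (0 : 'rV[A]_N, f).
pose p (A : comPzRingType) (V : realizations M A) : sub_functor U A :=
  exist _ (proj1_sig (constructive_indefinite_description _ (pt A V))) I.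
have pE (A B : comPzRingType) (f : {rmorphism A -> B}) (V : realizations M A) :
  p B (fmap f V) = fmap f (p A V) by exact: U_eq.
exists (Morphism pE); split=> [A V W|A u]; first (split=> _; last exact: U_eq).
- have A0 := MA A V; apply: zariski_globally; exists 0, 0, 0; split; try exact: mx_eq.
  by move=> i; exists 0; apply: trivial_ring.
- apply: zariski_globally; exists (exist _ 0 (M_ex A (XA A (sval u)))); exact: U_eq.
Qed.

(** * Existence of elementary monic representations *)

Definition is_ideal (A : comPzRingType) (I : A -> Prop) :=
  [/\ I 0, forall x y, I x -> I y -> I (x + y) & forall r x, I x -> I (r * x)].

Definition noetherian (A : comNzRingType) := forall I : A -> Prop, is_ideal I ->
  exists2 l : seq A, forall x, x \in l -> I x & forall x, I x -> ideal_gen (fun y => y \in l) x.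

Lemma ideal_gen_mono (A : comPzRingType) (D D' : A -> Prop) x :
  (forall d, D d -> D' d) -> ideal_gen D x -> ideal_gen D' x.
Proof. by move=> DD'; elim=> [|r d y Dd _ IH]; constructor => //; apply: DD'. Qed.

Lemma int_noetherian : noetherian int.
Proof.
move=> I [I0 ID IM].
have IN x : I x -> I (- x) by move=> Ix; rewrite -mulN1r; apply: IM.
have [[k Ik]|N] := excluded_middle_informative (exists k, I k.+1%:Z); last first.
  exists [::] => // x Ix; suff -> : x = 0 by constructor.
  case: x Ix => [[|k]|k] Ix //; first by case: N; exists k.
  by case: N; exists k; have := IN _ Ix; rewrite NegzE opprK.
have [k0 Ik0 kmin] : exists2 k, I k.+1%:Z & forall j, I j.+1%:Z -> (k <= j)%N.
  elim/ltn_ind: k Ik => k IH Ik.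
  have [[j [jk Ij]]|N] := excluded_middle_informative (exists j, (j < k)%N /\ I j.+1%:Z).
    exact: IH jk Ij.
  by exists k => // j Ij; rewrite leqNgt; apply/negP => jk; apply: N; exists j.
exists [:: k0.+1%:Z] => x; first by rewrite inE => /eqP ->.
move=> Ix; have xE := divz_eq x k0.+1%:Z.
have r0 : (0 <= x %% k0.+1%:Z)%Z by apply: modz_ge0.
have rk : (x %% k0.+1%:Z < k0.+1%:Z)%Z by apply: ltz_pmod.
have Ir : I (x %% k0.+1%:Z)%Z.
  rewrite (_ : (x %% _)%Z = x + - ((x %/ k0.+1%:Z)%Z * k0.+1%:Z)); last by rewrite {2}xE addrAC subrr add0r.
  by apply: ID => //; apply/IN/IM.
rewrite xE; case: (x %% k0.+1%:Z)%Z r0 rk Ir => [[|j]|//] _ rk Ir.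
  by constructor; [rewrite inE | constructor].
by have := kmin _ Ir; move: rk; rewrite ltz_nat; lia.
Qed.

(** * Hilbert's basis theorem *)

Section HilbertBasis.
Variable A : comNzRingType.
Hypothesis A_noeth : noetherian A.
Variable J : {poly A} -> Prop.
Hypothesis J_ideal : is_ideal J.

(** The ideal of leading coefficients of the members of J of degree d, together with 0. *)
Definition coef_ideal d (a : A) := exists p, [/\ J p, (size p <= d.+1)%N & p`_d = a].

Lemma coef_ideal_ideal d : is_ideal (coef_ideal d).
Proof.
case: J_ideal => J0 JD JM; split.
- by exists 0; rewrite size_poly0 coef0.
- move=> _ _ [p [Jp sp <-]] [q [Jq sq <-]]; exists (p + q); rewrite coefD; split=> //; first exact: JD.
  by rewrite (leq_trans (size_polyD _ _)) // geq_max sp.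
- move=> r _ [p [Jp sp <-]]; exists (r%:P * p); rewrite coefCM; split=> //; first exact: JM.
  by rewrite mul_polyC (leq_trans (size_scale_leq _ _)).
Qed.

Lemma coef_ideal_le d d' a : (d <= d')%N -> coef_ideal d a -> coef_ideal d' a.
Proof.
case: J_ideal => J0 JD JM dd [p [Jp sp <-]]; exists ('X^(d' - d) * p); split; first exact: JM.
  rewrite (leq_trans (size_polyMleq _ _)) // size_polyXn addSn /=.
  by rewrite (leq_trans (leq_add (leqnn _) sp)) // addnS subnK.
by rewrite coefXnM ltnNge leq_subr /= subKn.
Qed.

Lemma coef_ideal_union : is_ideal (fun a => exists d, coef_ideal d a).
Proof.
split; first by exists 0%N; case: (coef_ideal_ideal 0).
- move=> x y [d xd] [d' yd]; exists (maxn d d').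
  have [_ D _] := coef_ideal_ideal (maxn d d').
  by apply: D; [apply: coef_ideal_le xd | apply: coef_ideal_le yd]; rewrite ?leq_maxl ?leq_maxr.
- by move=> r x [d xd]; exists d; case: (coef_ideal_ideal d) => _ _; apply.
Qed.

Definition lifts (Q : seq {poly A}) d a :=
  exists q, [/\ ideal_gen (fun p => p \in Q) q, (size q <= d.+1)%N & q`_d = a].

Lemma lift_generators d : exists2 Q : seq {poly A}, forall q, q \in Q -> J q &
  forall a, coef_ideal d a -> lifts Q d a.
Proof.
have [l lI Il] := A_noeth (coef_ideal_ideal d).
have [Q QJ lQ] : exists2 Q : seq {poly A}, forall q, q \in Q -> J q /\ (size q <= d.+1)%N &
    forall a, a \in l -> exists2 q, q \in Q & q`_d = a.
  elim: l lI {Il} => [|a l IHl] lI; first by exists [::].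
  have [|Q QJ lQ] := IHl; first by move=> b bl; apply: lI; rewrite inE bl orbT.
  have [|p [Jp sp pa]] := lI a; first by rewrite inE eqxx.
  exists (p :: Q) => [q|b]; rewrite inE.
    by case/orP=> [/eqP ->|/QJ].
  case/orP=> [/eqP ->|/lQ [q qQ qb]]; first by exists p; rewrite ?inE ?eqxx.
  by exists q; rewrite // inE qQ orbT.
exists Q => [q /QJ []//|a /Il].
elim=> [|r b c /lQ [p pQ <-] _ [q [qQ sq qc]]].
  by exists 0; rewrite size_poly0 coef0; split=> //; constructor.
exists (r%:P * p + q); split; first by constructor.
  rewrite (leq_trans (size_polyD _ _)) // geq_max sq mul_polyC andbT.
  by rewrite (leq_trans (size_scale_leq _ _)) //; have [] := QJ p pQ.
by rewrite coefD coefCM qc.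
Qed.

Lemma lift_generators_upto N : exists2 Q : seq {poly A}, forall q, q \in Q -> J q &
  forall d a, (d <= N)%N -> coef_ideal d a -> lifts Q d a.
Proof.
elim: N => [|N [Q QJ QL]].
  have [Q QJ QL] := lift_generators 0; exists Q => // d a.
  by rewrite leqn0 => /eqP ->; apply: QL.
have [Q' QJ' QL'] := lift_generators N.+1; exists (Q ++ Q') => [q|d a].
  by rewrite mem_cat => /orP[/QJ|/QJ'].
rewrite leq_eqVlt ltnS => /orP[/eqP -> /QL' [q [qQ sq qa]]|dN /(QL _ _ dN) [q [qQ sq qa]]].
  by exists q; split=> //; apply: ideal_gen_mono qQ => p; rewrite mem_cat orbC => ->.
by exists q; split=> //; apply: ideal_gen_mono qQ => p; rewrite mem_cat => ->.
Qed.

Lemma hilbert_basis_aux : exists2 l : seq {poly A}, forall x, x \in l -> J x &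
  forall x, J x -> ideal_gen (fun y => y \in l) x.
Proof.
have [J0 JD JM] := J_ideal.
have [l lI Il] := A_noeth coef_ideal_union.
have [N lN] : exists N, forall a, a \in l -> coef_ideal N a.
  elim: l lI {Il} => [|a l IHl] lI; first by exists 0%N.
  have [|N lN] := IHl; first by move=> b bl; apply: lI; rewrite inE bl orbT.
  have [|d ad] := lI a; first by rewrite inE eqxx.
  exists (maxn N d) => b; rewrite inE => /orP[/eqP ->|/lN bN].
    by apply: coef_ideal_le ad; rewrite leq_maxr.
  by apply: coef_ideal_le bN; rewrite leq_maxl.
have unionN a d : coef_ideal d a -> coef_ideal N a.
  move=> ad; have [c0 cD cM] := coef_ideal_ideal N.
  have : ideal_gen (fun y => y \in l) a by apply: Il; exists d.
  by elim=> [//|r b c bl _ IH]; apply: cD => //; apply/cM/lN.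
have [Q QJ QL] := lift_generators_upto N; exists Q => // p.
have QI q : ideal_gen (fun p => p \in Q) q -> J q.
  by elim=> [//|r b c /QJ Jb _ Jc]; apply: JD => //; apply: JM.
move eK : (size p) => k; have {eK} : (size p <= k)%N by rewrite eK.
elim: k p => [|k IHk] p.
  by rewrite leqn0 size_poly_eq0 => /eqP -> _; constructor.
move=> sp Jp.
(* A combination of the generators with the same leading term as [p]: up to degree N a lift in that
   degree, beyond it a lift in degree N times a power of the variable. *)
have [q [qQ sq qE]] : exists q, [/\ ideal_gen (fun p => p \in Q) q, (size q <= k.+1)%N & q`_k = p`_k].
  have ck : coef_ideal k p`_k by exists p.
  have [kN|Nk] := leqP k N; first exact: QL kN ck.
  have [q [qQ sq qE]] := QL N _ (leqnn N) (unionN _ _ ck).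
  exists ('X^(k - N) * q); split; first exact: ideal_genM.
    rewrite (leq_trans (size_polyMleq _ _)) // size_polyXn addSn /=.
    by rewrite (leq_trans (leq_add (leqnn _) sq)) // addnS subnK // ltnW.
  by rewrite coefXnM ltnNge leq_subr /= subKn // ltnW.
rewrite -[p](subrK q); apply: ideal_genD => //; apply: IHk.
  apply/leq_sizeP => j; rewrite leq_eqVlt => /orP[/eqP <-|kj]; first by rewrite coefB qE subrr.
  by rewrite coefB !nth_default ?subrr // (leq_trans _ kj).
by apply: JD => //; rewrite -mulN1r; apply/JM/QI.
Qed.

End HilbertBasis.

Lemma hilbert_basis (A : comNzRingType) : noetherian A -> noetherian {poly A}.
Proof. by move=> nA J; apply: hilbert_basis_aux. Qed.

Fixpoint iterated_poly (k : nat) : comNzRingType :=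
  if k is k'.+1 then {poly (iterated_poly k')} else int.

Lemma iterated_poly_noetherian k : noetherian (iterated_poly k).
Proof. by elim: k => [|k IHk]; [apply: int_noetherian | apply: hilbert_basis]. Qed.

(** The outermost variable of the tower is sent to the variable of index k, or to 0 if there is
    none. *)
Lemma iterated_poly_onto n k : exists h : {rmorphism iterated_poly k -> {mpoly int[n]}},
  forall i : 'I_n, (i < k)%N -> exists p, h p = 'X_i.
Proof.
elim: k => [|k [h hX]]; first by exists (@mpolyC n int).
pose y : {mpoly int[n]} := oapp (fun i => 'X_i) 0 (insub k : option 'I_n).
exists (horner_eval y \o map_poly h) => i; rewrite ltnS leq_eqVlt => /orP[/eqP ik|/hX [p <-]].
  by exists 'X; rewrite /= /horner_eval map_polyX hornerX /y -ik valK.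
by exists p%:P; rewrite /= /horner_eval map_polyC hornerC.
Qed.

Lemma mpoly_int_noetherian n : noetherian {mpoly int[n]}.
Proof.
move=> I [I0 ID IM]; have [h hX] := iterated_poly_onto n n.
have h_onto p : exists q, h q = p.
  move: p; apply: mpoly_int_ind.
  - by move=> p q [p' <-] [q' <-]; exists (p' - q'); rewrite rmorphB.
  - by move=> p q [p' <-] [q' <-]; exists (p' * q'); rewrite rmorphM.
  - by exists 1; rewrite rmorph1.
  - by move=> i; apply: hX.
have [|l lI Il] := @iterated_poly_noetherian n (fun q => I (h q)).
  split=> [|x y Ix Iy|r x Ix]; rewrite ?rmorph0 // ?rmorphD ?rmorphM; [exact: ID | exact: IM].
exists (map h l) => [_ /mapP [q ql ->]|p Ip]; first exact: lI.
have [q qp] := h_onto p; rewrite -qp in Ip *.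
elim: (Il q Ip) => [|r d z dl _ IH]; first by rewrite rmorph0; constructor.
by rewrite rmorphD rmorphM; constructor => //; apply: map_f.
Qed.

(** * Polynomials computed by monic steps *)

Section StraightLinePrograms.
Variable n : nat.
Notation S := {mpoly int[n]}.
Notation L := {poly S}.

Definition step_value (c : step) (j : nat) (vs : seq L) (p : L) : Prop :=
  match c with
  | Add k l => [/\ (k < j)%N, (l < j)%N & p = vs`_k + vs`_l]
  | Mul k l => [/\ (k < j)%N, (l < j)%N & p = vs`_k * vs`_l]
  | Incr k => (k < j)%N /\ p = vs`_k + 1
  end.

Record program (st : seq step) (vs : seq L) : Prop := Program {
  program_size : size vs = (n + size st).+1;
  program_var0 : vs`_0 = 'X;
  program_free : forall i : 'I_n, vs`_i.+1 = ('X_i)%:P + 'X;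
  program_step : forall j, (n < j <= n + size st)%N ->
    step_value (nth (Incr 0) st (j - n.+1)) j vs vs`_j;
  program_monic : forall j, (n < j <= n + size st)%N -> vs`_j \is monic }.

Lemma program_nil : program [::] ('X :: [seq ('X_i)%:P + 'X | i <- enum 'I_n]).
Proof.
split=> [|//|i|j|j] /=; try by lia.
  by rewrite size_map size_enum_ord addn0.
have nthF (F : 'I_n -> L) : nth 0 [seq F k | k <- enum 'I_n] i = F i.
  by rewrite (nth_map i) ?size_enum_ord // nth_ord_enum.
exact: (nthF (fun k => ('X_k)%:P + 'X)).
Qed.

Lemma step_value_rcons c j vs p q : (j <= size vs)%N ->
  step_value c j vs p -> step_value c j (rcons vs q) p.
Proof.
move=> jv; have E k : (k < j)%N -> (rcons vs q)`_k = vs`_k.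
  by move=> kj; rewrite nth_rcons (leq_trans kj jv).
by case: c => [k l|k l|k] /=; [case=> kj lj -> | case=> kj lj -> | case=> kj ->]; rewrite !E.
Qed.

Lemma program_rcons st vs c p : program st vs -> step_value c (size vs) vs p ->
  p \is monic -> program (rcons st c) (rcons vs p).
Proof.
case=> szE v0 vf vst vm cp pm.
have old j : (j <= n + size st)%N -> (rcons vs p)`_j = vs`_j.
  by move=> jn; rewrite nth_rcons szE ltnS jn.
have new j : (n < j <= n + size (rcons st c))%N -> (n < j <= n + size st)%N \/ j = size vs.
  by rewrite size_rcons szE addnS; lia.
have newE : (rcons vs p)`_(size vs) = p by rewrite nth_rcons ltnn eqxx.
split=> [||i|j /new [jr|->]|j /new [jr|->]]; rewrite ?newE //.
- by rewrite !size_rcons szE addnS.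
- by rewrite old.
- by rewrite old ?vf //; have := ltn_ord i; lia.
- rewrite old; last by case/andP: jr.
  rewrite nth_rcons (_ : (j - n.+1 < size st)%N); last by lia.
  by apply: step_value_rcons; [lia | apply: vst].
- rewrite szE subSS addKn nth_rcons ltnn eqxx -szE.
  exact: step_value_rcons.
- by rewrite old ?vm //; case/andP: jr.
Qed.

(** Any given program can be extended to compute [p], so that computations of several polynomials
    can be chained. *)
Definition computable (p : L) := p \is monic /\ forall st vs, program st vs ->
  exists st' vs', [/\ program st' vs', {subset vs <= vs'} & p \in vs'].

Lemma computable_step (p : L) (qs : seq L) : p \is monic -> (forall q, q \in qs -> computable q) ->
  (forall j vs, size vs = j -> {subset qs <= vs} -> exists c, step_value c j vs p) ->
  computable p.
Proof.
move=> pm qsC step; split=> // st vs P.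
have [st' [vs' [P' vv qv]]] : exists st' vs',
    [/\ program st' vs', {subset vs <= vs'} & {subset qs <= vs'}].
  elim: qs qsC {step} => [|q qs IHqs] qsC; first by exists st, vs; split.
  have [|st1 [vs1 [P1 v1 q1]]] := IHqs; first by move=> r rq; apply: qsC; rewrite inE rq orbT.
  have [_ qC] := qsC q (mem_head _ _).
  have [st2 [vs2 [P2 v2 q2]]] := qC _ _ P1; exists st2, vs2; split=> // [r /v1/v2 //|r].
  by rewrite inE => /orP[/eqP ->|/q1/v2].
have [c cp] := step _ vs' erefl qv.
exists (rcons st' c), (rcons vs' p); split; first exact: program_rcons.
  by move=> r /vv rv; rewrite mem_rcons inE rv orbT.
by rewrite mem_rcons inE eqxx.
Qed.

Lemma computable_add (p q : L) : computable p -> computable q -> p + q \is monic ->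
  computable (p + q).
Proof.
move=> pC qC m; apply: (@computable_step _ [:: p; q]) => // [r|j vs <- sub].
  by rewrite !inE => /orP[] /eqP ->.
exists (Add (index p vs) (index q vs)); rewrite /= !index_mem !nth_index.
- by split=> //; apply: sub; rewrite !inE eqxx ?orbT.
- by apply: sub; rewrite !inE eqxx ?orbT.
- by apply: sub; rewrite !inE eqxx ?orbT.
Qed.

Lemma computable_mul (p q : L) : computable p -> computable q -> computable (p * q).
Proof.
move=> pC qC; have m : p * q \is monic by rewrite monicMl; [case: qC | case: pC].
apply: (@computable_step _ [:: p; q]) => // [r|j vs <- sub].
  by rewrite !inE => /orP[] /eqP ->.
exists (Mul (index p vs) (index q vs)); rewrite /= !index_mem !nth_index.
- by split=> //; apply: sub; rewrite !inE eqxx ?orbT.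
- by apply: sub; rewrite !inE eqxx ?orbT.
- by apply: sub; rewrite !inE eqxx ?orbT.
Qed.

Lemma computable_incr (p : L) : computable p -> p + 1 \is monic -> computable (p + 1).
Proof.
move=> pC m; apply: (@computable_step _ [:: p]) => // [r|j vs <- sub].
  by rewrite inE => /eqP ->.
have pv : p \in vs by apply: sub; rewrite inE.
by exists (Incr (index p vs)); rewrite /= index_mem nth_index.
Qed.

Lemma program_mem_size st vs j : program st vs -> (j <= n)%N -> (j < size vs)%N.
Proof. by move=> P jn; rewrite (program_size P); lia. Qed.

Lemma computableX : computable 'X.
Proof.
split=> [|st vs P]; first exact: monicX.
exists st, vs; split=> //; rewrite -(program_var0 P).
by apply: mem_nth; apply: program_mem_size P _.
Qed.

Lemma computable_free i : computable (('X_i)%:P + 'X).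
Proof.
split=> [|st vs P]; first by rewrite addrC -[_%:P]opprK -polyCN monicXsubC.
exists st, vs; split=> //; rewrite -(program_free P).
by apply: mem_nth; apply: program_mem_size P _.
Qed.

Lemma computableXn M : computable 'X^(M.+1).
Proof.
elim: M => [|M IHM]; first exact: computableX.
by rewrite exprS; apply: computable_mul => //; apply: computableX.
Qed.

Lemma computable_shift M (p : L) : computable p -> (size p <= M.+1)%N ->
  computable ('X^(M.+1) + p).
Proof.
move=> pC pM; apply: computable_add => //; first exact: computableXn.
by rewrite monicE lead_coefDl ?lead_coefXn // size_polyXn ltnS.
Qed.

Lemma computable_shift_add M (p q : L) : computable p -> computable q ->
  (size p <= M.+1)%N -> (size q <= M.+1)%N -> computable ('X^(M.+1) + p + q).
Proof.
move=> pC qC pM qM; apply: computable_add => //; first exact: computable_shift.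
have pX : (size p < size ('X^(M.+1) : L))%N by rewrite size_polyXn.
by rewrite monicE lead_coefDl ?lead_coefDl ?lead_coefXn // size_polyDl // size_polyXn.
Qed.

Definition difference (f : S) := exists p q, [/\ computable p, computable q & p - q = f%:P].

(* The summand 'X^M makes all the intermediate results monic. *)
Lemma difference_shift (f : S) p q p' q' : computable p -> computable q ->
  computable p' -> computable q' -> (p + q) - (p' + q') = f%:P -> difference f.
Proof.
move=> pC qC pC' qC' E.
pose M := (size p + size q + size p' + size q')%N.
exists ('X^(M.+1) + p + q), ('X^(M.+1) + p' + q'); split.
- by apply: computable_shift_add => //; rewrite /M; lia.
- by apply: computable_shift_add => //; rewrite /M; lia.
- by rewrite -E; move: ('X^(M.+1)) => T; ring.
Qed.

(** The generators are 1 = (t + 1) - t and y_i = (y_i + t) - t. Differences and products of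
    differences are again of the form (p + q) - (p' + q'), to which [difference_shift] applies. *)
Lemma differenceP (f : S) : difference f.
Proof.
move: f; apply: mpoly_int_ind.
- move=> f g [p [q [pC qC E]]] [p' [q' [pC' qC' E']]].
  by apply: (difference_shift pC qC' qC pC'); rewrite polyCB -E -E'; ring.
- move=> f g [p [q [pC qC E]]] [p' [q' [pC' qC' E']]].
  apply: (@difference_shift _ (p * p') (q * q') (p * q') (q * p')); try exact: computable_mul.
  by rewrite polyCM -E -E'; ring.
- exists ('X + 1), 'X; split; last by rewrite addrAC subrr add0r.
    apply: computable_incr; first exact: computableX.
    by rewrite -[1]opprK -polyCN monicXsubC.
  exact: computableX.
- move=> i; exists (('X_i)%:P + 'X), 'X; split; last by rewrite addrK.
    exact: computable_free.
  exact: computableX.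
Qed.

Lemma program_differences (l : seq S) : exists st vs, program st vs /\
  forall f, f \in l -> exists p q, [/\ p \in vs, q \in vs & p - q = f%:P].
Proof.
elim: l => [|f l [st [vs [P vl]]]]; first by exists [::]; eexists; split; [apply: program_nil | ].
have [p [q [[_ pC] [_ qC] E]]] := differenceP f.
have [st1 [vs1 [P1 sub1 p1]]] := pC _ _ P.
have [st2 [vs2 [P2 sub2 q2]]] := qC _ _ P1.
exists st2, vs2; split=> // g; rewrite inE => /orP[/eqP ->|/vl [p' [q' [p'v q'v E']]]].
  by exists p, q; split=> //; apply: sub2.
by exists p', q'; split=> //; apply/sub2/sub1.
Qed.

Lemma elementary_monic_data_exists (l : seq S) : exists D : elementary_monic_data n,
  emr_ineqs D = set0 /\ forall f, emr_differences (emr_eqs D) f <-> f \in l.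
Proof.
have [st [vs [P vl]]] := program_differences l.
pose idx : finType := 'I_(n + size st).+1.
pose E : {set idx * idx} := [set jk | vs`_(jk.1 : idx) - vs`_(jk.2 : idx) \in [seq f%:P | f <- l]].
have const jk : jk \in E :|: set0 -> exists c : S, vs`_(jk.1 : idx) - vs`_(jk.2 : idx) = c%:P.
  by rewrite setU0 inE => /mapP [c _ ->]; exists c.
pose D := @ElementaryMonicData n st (nth 0 vs) E set0 (program_var0 P) (program_free P)
  (program_step P) (program_monic P) const.
exists D; split=> // f; split=> [[jk]|fl].
  by rewrite inE => /mapP [g gl ->] /polyC_inj <-.
have [p [q [pv qv pq]]] := vl f fl.
have jp : (index p vs < (n + size st).+1)%N by rewrite -(program_size P) index_mem.
have jq : (index q vs < (n + size st).+1)%N by rewrite -(program_size P) index_mem.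
have pqE : vs`_(index p vs) - vs`_(index q vs) = f%:P by rewrite !nth_index.
exists (Ordinal jp, Ordinal jq); last exact: pqE.
by rewrite inE /= pqE; apply: map_f.
Qed.

End StraightLinePrograms.

(** The kernel of a presentation is finitely generated, and its generators become the equalities.
    There are no inequalities, so the localization is the identity. *)
Lemma finite_type_representation (R : comPzRingType) : finite_type R ->
  exists (n : nat) (D : elementary_monic_data n), has_elementary_monic_representation D R.
Proof.
case=> n [phi phi_onto]; exists n.
have [|l lI Il] := @mpoly_int_noetherian n (fun p => phi p = 0).
  split=> [|x y x0 y0|r x x0]; first exact: rmorph0.
    by rewrite rmorphD x0 y0 addr0.
  by rewrite rmorphM x0 mulr0.
have [D [DI DE]] := elementary_monic_data_exists l.
exists D, {mpoly int[n]}, idfun, phi; split.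
  split=> [d [jk]|b|a a' /= ->]; first by rewrite DI inE.
    by exists b, 1; split; [constructor | rewrite mulr1].
  by exists 1; [constructor | ].
split=> [//|a]; split=> [/Il|].
  by apply: ideal_gen_mono => c cl; exists c; rewrite // DE.
elim=> [|r _ y [c cE ->] _ IH]; first exact: rmorph0.
by rewrite rmorphD rmorphM IH /= (lI c) ?mulr0 ?addr0 //; apply/DE.
Qed.

(** With neither equalities nor inequalities R would be Z[y], which is nonzero. For R = 0 the
    prescribed number of elements is therefore at least 6 + 5, enough for the nine Pappus points. *)
Lemma representation_nontrivial n (D : elementary_monic_data n) (R : comPzRingType) :
  has_elementary_monic_representation D R -> (1 : R) = 0 ->
  (0 < #|emr_eqs D| + #|emr_ineqs D|)%N.
Proof.
case=> B [f [g [[_ _ inj] [_ quo]]]] R0; rewrite lt0n addn_eq0 !cards_eq0.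
apply/negP => /andP[/eqP E0 /eqP I0].
have {quo} : ideal_gen (fun b => exists2 c, emr_differences (emr_eqs D) c & b = f c) 1.
  by apply/quo; rewrite rmorph1.
move eb : (1 : B) => b Ib; case: Ib eb => [|r d x [c [jk +]]]; last by rewrite E0 inE.
rewrite -(rmorph1 f) -(rmorph0 f) => /inj [s]; case=> [|d x [jk +]]; last by rewrite I0 inE.
by rewrite mulr1 mulr0 => /eqP; rewrite oner_eq0.
Qed.

Lemma representation_realizes_open n (D : elementary_monic_data n) (R : comPzRingType) :
  has_elementary_monic_representation D R ->
  exists M : rank3_matroid
     'I_(3 * n + 7 * count is_add (emr_steps D) + 7 * count is_incr (emr_steps D)
         + 6 * count is_mul (emr_steps D) + 5 * #|emr_eqs D| + 6 * #|emr_ineqs D| + 6),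
  realizes_open_of M (3 * (n + count is_add (emr_steps D) + count is_incr (emr_steps D)
    + count is_mul (emr_steps D) + #|emr_eqs D| + #|emr_ineqs D|) + 1) R.
Proof.
move=> rep; have [R0|R1] := excluded_middle_informative ((1 : R) = 0).
  have := representation_nontrivial rep R0 => nontriv.
  by apply: zero_ring_realizes_open => //; lia.
have [B [f [g [floc gquo]]]] := rep.
exact: data_realizes_open floc gquo R1.
Qed.

Theorem theorem5p3 (R : comPzRingType) :
  finite_type R ->
  (exists (s : nat) (M : rank3_matroid 'I_s) (N : nat), realizes_open_of M N R)
  /\
  (forall (n : nat) (D : elementary_monic_data n),
     has_elementary_monic_representation D R ->
     let a := count is_add (emr_steps D) in
     let m := count is_mul (emr_steps D) in
     let o := count is_incr (emr_steps D) in
     let e := #|emr_eqs D| in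
     let i := #|emr_ineqs D| in
     exists M : rank3_matroid
         'I_(3 * n + 7 * a + 7 * o + 6 * m + 5 * e + 6 * i + 6),
       realizes_open_of M (3 * (n + a + o + m + e + i) + 1) R).
Proof.
move=> /finite_type_representation [n [D rep]]; split; last first.
  by move=> n' D' rep'; apply: representation_realizes_open.
have [M MR] := representation_realizes_open rep.
by eexists; exists M; eexists; exact: MR.
Qed.
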